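(* The cut locus $\mathrm{Cut}_2$ of the sub-Riemannian space $(SU(1,1)\times\mathbb R,d_2)$ corresponding to $\mathrm{Id}$ is the set $\mathrm{Cut}_2=\mathrm{Cut}_2^{\rm loc}\cup\mathrm{Cut}_2^{\rm glob}$, where $$\mathrm{Cut}_2^{\rm loc}=\{(A,B,v)\in SU(1,1)\times\mathbb R\mid A\ne1,\ B=0,\ v\in\mathbb R\},$$ $$\mathrm{Cut}_2^{\rm glob}=\{(A,B,v)\in SU(1,1)\times\mathbb R\mid \mathrm{Re}(A)<-1,\ \mathrm{Im}(A)=0,\ v\in\mathbb R\}.$$
   Context: $SU(1,1)\times\mathbb R$ is the group of matrices $(A,B,v):=\begin{pmatrix}A&B&0\\ \overline B&\overline A&0\\0&0&e^v\end{pmatrix}$ with $A,B\in\mathbb C$, $|A|^2-|B|^2=1$, $v\in\mathbb R$; its Lie algebra has basis $E_1=\frac12(e_{12}+e_{21})$, $E_2=\frac i2(e_{12}-e_{21})$, $E_3=\frac i2(e_{11}-e_{22})$, $E_4=e_{33}$ ($e_{ij}$ are $3\times3$ matrix units). $d_2$ is the left-invariant sub-Riemannian metric defined by the left-invariant distribution with value $\mathrm{span}(E_1,E_4,E_2)$ at the unit $\mathrm{Id}$ and the inner product with orthonormal basis $E_1,E_4,E_2$. A shortest arc is a curve whose length equals the distance between its endpoints. The cut locus (for $\mathrm{Id}$) is the set of endpoints $g$ of all shortest arcs starting at $\mathrm{Id}$ and noncontinuable beyond $g$ (i.e. not extendable beyond $g$ to a longer shortest arc). *)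

(* Defs.v *)
From Stdlib Require Import Reals Arith.
From Coquelicot Require Import Coquelicot.
Open Scope R_scope.

(* Indices of 3 x 3 matrices run over 0, 1, 2, one less than usual. *)
Definition mat3 : Type := @matrix C 3 3.

Definition entry (M : mat3) (i j : nat) : C := coeff_mat (RtoC 0) M i j.

Definition mmul (M N : mat3) : mat3 := @Mmult C_Ring 3 3 3 M N.

Definition madd (M N : mat3) : mat3 := @Mplus C_Ring 3 3 M N.

Definition mscal (c : C) (M : mat3) : mat3 :=
  mk_matrix 3 3 (fun i j => Cmult c (entry M i j)).

Definition munit (k l : nat) : mat3 :=
  mk_matrix 3 3 (fun i j => if (Nat.eqb i k && Nat.eqb j l)%bool
                            then RtoC 1 else RtoC 0).

Definition su11R_mat (A B : C) (v : R) : mat3 :=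
  mk_matrix 3 3 (fun i j =>
    match i, j with
    | 0%nat, 0%nat => A
    | 0%nat, 1%nat => B
    | 1%nat, 0%nat => Cconj B
    | 1%nat, 1%nat => Cconj A
    | 2%nat, 2%nat => RtoC (exp v)
    | _, _ => RtoC 0
    end).

Definition SU11R (g : mat3) : Prop :=
  exists (A B : C) (v : R),
    Cmod A ^ 2 - Cmod B ^ 2 = 1 /\ g = su11R_mat A B v.

Definition Id3 : mat3 := @Mone C_Ring 3.

Definition E_1 : mat3 := mscal (RtoC (/ 2)) (madd (munit 0 1) (munit 1 0)).
Definition E_2 : mat3 :=
  mscal (Cmult (RtoC (/ 2)) Ci)
    (madd (munit 0 1) (mscal (RtoC (-1)) (munit 1 0))).
Definition E_4 : mat3 := munit 2 2.

(* Elements of span(E_1, E_4, E_2) are given by their coordinates (x1, x4, x2). *)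
Definition span_elt (x : R * R * R) : mat3 :=
  let '(x1, x4, x2) := x in
  madd (mscal (RtoC x1) E_1) (madd (mscal (RtoC x4) E_4) (mscal (RtoC x2) E_2)).

(* The norm for which E_1, E_4, E_2 are orthonormal. *)
Definition span_norm (x : R * R * R) : R :=
  let '(x1, x4, x2) := x in sqrt (x1 ^ 2 + x4 ^ 2 + x2 ^ 2).

Definition mat_continuous_on (c : R -> mat3) (a b : R) : Prop :=
  forall i j, (i < 3)%nat -> (j < 3)%nat ->
    @continuous_on R_UniformSpace C_UniformSpace
      (fun t => a <= t <= b) (fun t => entry (c t) i j).

Definition mat_derive (c : R -> mat3) (t : R) (V : mat3) : Prop :=
  forall i j, (i < 3)%nat -> (j < 3)%nat ->
    @is_derive R_AbsRing C_R_NormedModule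
      (fun s => entry (c s) i j) t (entry V i j).

(* a = ts 0 < ts 1 < ... < ts (n + 1) = b *)
Definition subdivision (a b : R) (n : nat) (ts : nat -> R) : Prop :=
  ts 0%nat = a /\ ts (S n) = b /\
  forall i, (i <= n)%nat -> ts i < ts (S i).

(* c is a piecewise continuously differentiable curve [a, b] -> SU(1,1) x R
   tangent to the left-invariant distribution g |-> g span(E_1, E_4, E_2), and
   u t are the coordinates of its velocity at time t in the frame
   (c t) E_1, (c t) E_4, (c t) E_2. The functions w are continuous on all of R,
   so that u has finite one-sided limits at the points of the subdivision;
   the values of u at these points are irrelevant. *)
Definition horizontal_curve (c : R -> mat3) (u : R -> R * R * R) (a b : R)
  : Prop :=
  a < b /\
  (forall t, a <= t <= b -> SU11R (c t)) /\
  mat_continuous_on c a b /\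
  exists (n : nat) (ts : nat -> R), subdivision a b n ts /\
    forall i, (i <= n)%nat ->
      exists w : R -> R * R * R,
        (forall t, continuous w t) /\
        forall t, ts i < t < ts (S i) ->
          u t = w t /\ mat_derive c t (mmul (c t) (span_elt (u t))).

Definition sr_length (u : R -> R * R * R) (a b : R) : R :=
  RInt (fun t => span_norm (u t)) a b.

(* The infimum is finite for g, h in SU(1,1) x R: together with the bracket
   [E_1, E_2] = diag(-i/2, i/2, 0) the matrices E_1, E_4, E_2 span the Lie
   algebra, so g and h are joined by a horizontal curve. *)
Definition d2 (g h : mat3) : R :=
  real (Glb_Rbar (fun L =>
    exists (c : R -> mat3) (u : R -> R * R * R) (a b : R),
      horizontal_curve c u a b /\ c a = g /\ c b = h /\ L = sr_length u a b)).

(* Length with respect to the metric d2: the supremum over subdivisions. *)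
Definition curve_length (c : R -> mat3) (a b : R) : Rbar :=
  Lub_Rbar (fun s =>
    exists (n : nat) (ts : nat -> R), subdivision a b n ts /\
      s = sum_n (fun i => d2 (c (ts i)) (c (ts (S i)))) n).

Definition shortest_arc (c : R -> mat3) (a b : R) : Prop :=
  a < b /\
  (forall t, a <= t <= b -> SU11R (c t)) /\
  mat_continuous_on c a b /\
  curve_length c a b = Finite (d2 (c a) (c b)).

(* The strict increase of length excludes extensions that merely rest at the
   endpoint. *)
Definition continuable (c : R -> mat3) (a b : R) : Prop :=
  exists (c' : R -> mat3) (b' : R),
    b < b' /\ (forall t, a <= t <= b -> c' t = c t) /\
    shortest_arc c' a b' /\
    Rbar_lt (curve_length c a b) (curve_length c' a b').

Definition Cut2 (g : mat3) : Prop :=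
  exists (c : R -> mat3) (a b : R),
    shortest_arc c a b /\ c a = Id3 /\ c b = g /\ ~ continuable c a b.

Definition Cut2_loc (g : mat3) : Prop :=
  exists (A B : C) (v : R),
    Cmod A ^ 2 - Cmod B ^ 2 = 1 /\ g = su11R_mat A B v /\
    A <> RtoC 1 /\ B = RtoC 0.

Definition Cut2_glob (g : mat3) : Prop :=
  exists (A B : C) (v : R),
    Cmod A ^ 2 - Cmod B ^ 2 = 1 /\ g = su11R_mat A B v /\
    Re A < -1 /\ Im A = 0.

(* Main.v *)
From Stdlib Require Import Reals Ranalysis5 Lra Lia Psatz Arith.
From Coquelicot Require Import Coquelicot.
Require Import Defs.

(** Since [E_4] commutes with [E_1] and [E_2], the space is a metric product:
    the square of the distance from (g, v) to (h, w) is d(g, h)^2 + (w - v)^2,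
    where d is the distance of the distribution spanned by [E_1] and [E_2] on
    SU(1,1) ([d2_formula]). There a horizontal curve satisfies
    A' = B conj(w) / 2 and B' = A w / 2 with a control w whose modulus is the
    speed. Its projection to the hyperbolic plane has the same length, its
    distance r to the origin is given by |A| = cosh (r / 2), and the argument of
    A, followed continuously, is minus one half of the area swept from the
    origin. Thus d solves a problem of Dido: the shortest curve to a point at
    distance r that encloses a given area with its chord. The solutions have
    constant curvature kap, that is w = exp (i (th + kap t)) ([ray]).

    Their optimality is proved by calibrations, which need no existence theorem
    for minimizers. Suppose that the argument of A runs from 0 to some
    value <= - P.
    For kap <= 1 and |xi| = 1 the function Z = log (A + xi conj(B)) satisfies
    |Z'| = |w| / 2, so the length is at least 2 |Z| ([lower_bound_null]).
    For kap > 1 the pair (A exp (i kap S / 2), B exp (- i kap S / 2)), S being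
    the arc length, is a timelike curve of SU(1,1), regarded as anti-de Sitter
    space. Timelike geodesics maximize proper time there: the Lorentzian
    distance to the totally geodesic slice orthogonal to the candidate at its
    midpoint grows at least at the rate sqrt (kap^2 - 1) / 2
    ([lower_bound_timelike], [lower_bound_elliptic]). In both cases equality
    forces w to turn at the rate kap, from a starting direction determined by
    the endpoint; as A knows its argument only modulo 2 pi, the endpoint
    leaves the choice of a sign for kap ([lower_bound]). By the intermediate
    value theorem every endpoint is reached by such a geodesic
    ([geodesic_data_exists], [geodesic_exists]).

    A point g is a cut point if and only if no h <> g satisfies
    d2(Id, h) = d2(Id, g) + d2(g, h) ([Cut2_characterization]). If B <> 0 and the
    argument of A is not pi modulo 2 pi, the geodesic to g extends beyond g, as
    do the lines above A = 1, B = 0. If B = 0 and A <> 1, the geodesics to g form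
    a circle, obtained by rotating the starting direction; if A is real and
    A < -1, the mirror images with curvatures kap and - kap both end at g. A
    point beyond g would make the continuations of all of them optimal, which
    contradicts the uniqueness of the optimal control ([no_geodesic_beyond]). *)

(** * Piecewise differentiable functions *)

Definition inside (n : nat) (ts : nat -> R) (t : R) : Prop :=
  exists i, (i <= n)%nat /\ ts i < t < ts (S i).

Lemma subdivision_mono (a b : R) (n : nat) (ts : nat -> R) :
  subdivision a b n ts ->
  forall i j, (i <= j)%nat -> (j <= S n)%nat -> ts i <= ts j.
Proof.
  intros (_ & _ & H) i j Hij. induction Hij as [|j Hij IH]; intros Hj; [lra|].
  specialize (H j ltac:(lia)). specialize (IH ltac:(lia)). lra.
Qed.

Lemma subdivision_lt (a b : R) (n : nat) (ts : nat -> R) :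
  subdivision a b n ts -> a < b.
Proof.
  intros H. pose proof (subdivision_mono _ _ _ _ H 1 (S n) ltac:(lia) ltac:(lia)).
  destruct H as (<- & <- & H). specialize (H 0%nat ltac:(lia)). lra.
Qed.

Lemma inside_bounds (a b : R) (n : nat) (ts : nat -> R) (t : R) :
  subdivision a b n ts -> inside n ts t -> a < t < b.
Proof.
  intros H (i & Hi & Ht).
  pose proof (subdivision_mono _ _ _ _ H 0 i ltac:(lia) ltac:(lia)).
  pose proof (subdivision_mono _ _ _ _ H (S i) (S n) ltac:(lia) ltac:(lia)).
  destruct H as (<- & <- & H). lra.
Qed.

Lemma is_derive_continuous (f : R -> R) (x l : R) :
  is_derive f x l -> continuous f x.
Proof. intros H. apply (ex_derive_continuous (V := R_NormedModule)). now exists l. Qed.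

Lemma le_of_derive_nonneg (F : R -> R) (s t : R) :
  s <= t -> (forall x, s <= x <= t -> continuous F x) ->
  (forall x, s < x < t -> exists l, is_derive F x l /\ 0 <= l) ->
  F s <= F t.
Proof.
  intros Hst Hc Hd.
  destruct (MVT_gen F s t
    (fun x => if Rlt_dec s x then if Rlt_dec x t then Derive F x else 0 else 0))
    as (c & Hc' & E).
  - rewrite Rmin_left, Rmax_right by lra. intros x Hx.
    destruct (Rlt_dec s x); [|lra]. destruct (Rlt_dec x t); [|lra].
    apply Derive_correct. destruct (Hd x Hx) as (l & Hl & _). now exists l.
  - rewrite Rmin_left, Rmax_right by lra. intros x Hx.
    apply continuity_pt_filterlim, Hc, Hx.
  - assert (0 <= F t - F s); [|lra]. rewrite E.
    apply Rmult_le_pos; [|lra].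
    destruct (Rlt_dec s c); [|lra]. destruct (Rlt_dec c t); [|lra].
    destruct (Hd c) as (l & Hl & Hl0); [lra|].
    now rewrite (is_derive_unique _ _ _ Hl).
Qed.

Lemma pw_monotone (F : R -> R) (a b : R) (n : nat) (ts : nat -> R) :
  subdivision a b n ts -> (forall t, a <= t <= b -> continuous F t) ->
  (forall t, inside n ts t -> exists l, is_derive F t l /\ 0 <= l) ->
  forall s t, a <= s -> s <= t -> t <= b -> F s <= F t.
Proof.
  intros H Hc Hd.
  pose proof (subdivision_mono _ _ _ _ H) as Hm.
  assert (K : forall i, (i <= S n)%nat ->
    forall s t, ts 0%nat <= s -> s <= t -> t <= ts i -> F s <= F t).
  { induction i as [|i IH]; intros Hi s t Hs Hst Ht.
    - replace t with s by lra. lra.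
    - assert (Hp : forall s t, ts i <= s -> s <= t -> t <= ts (S i) -> F s <= F t).
      { intros s' t' H1 H2 H3. pose proof (Hm 0 i ltac:(lia) ltac:(lia))%nat.
        pose proof (Hm (S i) (S n) ltac:(lia) ltac:(lia))%nat. destruct H as (<- & <- & H).
        apply le_of_derive_nonneg; auto. { intros x Hx. apply Hc. lra. }
        intros x Hx. apply Hd. exists i. split; [lia|lra]. }
      destruct (Rle_dec t (ts i)); [apply IH; auto; lia|].
      destruct (Rle_dec (ts i) s); [apply Hp; lra|].
      apply Rle_trans with (F (ts i)); [apply IH; try lia; lra|apply Hp; lra]. }
  destruct H as (<- & <- & H). intros. apply (K (S n)); auto.
Qed.

Lemma pw_constant (F : R -> R) (a b : R) (n : nat) (ts : nat -> R) :
  subdivision a b n ts -> (forall t, a <= t <= b -> continuous F t) ->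
  (forall t, inside n ts t -> is_derive F t 0) ->
  forall t, a <= t <= b -> F t = F a.
Proof.
  intros H Hc Hd t Ht. apply Rle_antisym.
  - enough (- F a <= - F t) by lra.
    apply (pw_monotone (fun t => - F t) a b n ts); auto; try lra.
    + intros x Hx. apply (continuous_opp (V := R_NormedModule) F). auto.
    + intros x Hx. exists (-0). split; [|lra]. apply (is_derive_opp F). auto.
  - apply (pw_monotone F a b n ts); auto; try lra. intros x Hx. exists 0; split; [auto|lra].
Qed.

(** The equality case of every calibration below: a monotone quantity that does not grow
    has derivative 0, which turns the inequality behind its monotonicity into an equality. *)
Lemma pw_rigid (F : R -> R) (a b : R) (n : nat) (ts : nat -> R) :
  subdivision a b n ts -> (forall t, a <= t <= b -> continuous F t) ->
  (forall t, inside n ts t -> exists l, is_derive F t l /\ 0 <= l) ->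
  F b <= F a -> forall t, inside n ts t -> is_derive F t 0.
Proof.
  intros H Hc Hd Hab t Ht.
  pose proof (inside_bounds _ _ _ _ _ H Ht) as Htb.
  assert (E : forall x, a <= x <= b -> F x = F a).
  { intros x Hx. pose proof (pw_monotone F a b n ts H Hc Hd a x).
    pose proof (pw_monotone F a b n ts H Hc Hd x b). lra. }
  apply (is_derive_ext_loc (fun _ => F a)); [|auto_derive; auto].
  apply (locally_interval _ t a b); simpl; try lra.
  intros y H1 H2. symmetry. apply E. simpl in *. lra.
Qed.

(** The extension G to the whole line provides the one-sided limits at the breakpoints. *)
Definition pw_continuous (n : nat) (ts : nat -> R) (F : R -> R) : Prop :=
  forall i, (i <= n)%nat -> exists G, (forall t, continuous G t) /\
    forall t, ts i < t < ts (S i) -> F t = G t.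

Lemma pw_continuous_of_continuous n ts F : (forall t, continuous F t) -> pw_continuous n ts F.
Proof. intros H i _. exists F. auto. Qed.

Lemma pw_continuous_plus n ts F G : pw_continuous n ts F -> pw_continuous n ts G ->
  pw_continuous n ts (fun t => F t + G t).
Proof.
  intros HF HG i Hi. destruct (HF i Hi) as (F' & C1 & E1), (HG i Hi) as (G' & C2 & E2).
  exists (fun t => F' t + G' t). split.
  - intros t. apply (continuous_plus F' G'); auto.
  - intros t Ht. now rewrite E1, E2.
Qed.

Lemma pw_continuous_mult n ts F G : pw_continuous n ts F -> pw_continuous n ts G ->
  pw_continuous n ts (fun t => F t * G t).
Proof.
  intros HF HG i Hi. destruct (HF i Hi) as (F' & C1 & E1), (HG i Hi) as (G' & C2 & E2).
  exists (fun t => F' t * G' t). split.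
  - intros t. apply (continuous_mult F' G'); auto.
  - intros t Ht. now rewrite E1, E2.
Qed.

Lemma pw_continuous_comp n ts (f : R -> R) F : (forall x, continuous f x) -> pw_continuous n ts F ->
  pw_continuous n ts (fun t => f (F t)).
Proof.
  intros Hf HF i Hi. destruct (HF i Hi) as (F' & C1 & E1).
  exists (fun t => f (F' t)). split.
  - intros t. apply (continuous_comp F' f); auto.
  - intros t Ht. now rewrite E1.
Qed.

Lemma pw_continuous_ext n ts F G : (forall t, F t = G t) -> pw_continuous n ts F ->
  pw_continuous n ts G.
Proof.
  intros E HF i Hi. destruct (HF i Hi) as (F' & C1 & E1).
  exists F'. split; auto. intros; rewrite <- E; auto.
Qed.

Definition primitive (a : R) (n : nat) (ts : nat -> R) (F Phi : R -> R) : Prop :=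
  (forall t, continuous Phi t) /\ Phi a = 0 /\
  forall t, inside n ts t -> is_derive Phi t (F t).

Lemma continuous_Rmin (c t : R) : continuous (fun t => Rmin t c) t.
Proof.
  apply (continuous_ext (fun t => (t + c - Rabs (t - c)) / 2)).
  - intros x. unfold Rmin, Rabs. destruct Rle_dec, Rcase_abs; lra.
  - apply (continuous_scal_l (V := R_NormedModule) (fun t => t + c - Rabs (t - c)) (/2)).
    apply (continuous_minus (V := R_NormedModule) (fun t => t + c) (fun t => Rabs (t - c))).
    + apply (continuous_plus (fun t => t) (fun _ => c)); [apply continuous_id|apply continuous_const].
    + apply (continuous_comp (fun t => t - c) Rabs).
      * apply (continuous_minus (V := R_NormedModule) (fun t => t) (fun _ => c)); [apply continuous_id|apply continuous_const].
      * apply (continuous_Rabs (t - c)).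
Qed.

Lemma continuous_Rmax (c t : R) : continuous (fun t => Rmax t c) t.
Proof.
  apply (continuous_ext (fun t => - Rmin (- t) (- c))).
  - intros x. rewrite <- Ropp_Rmax. apply Ropp_involutive.
  - apply (continuous_opp (V := R_NormedModule) (fun t => Rmin (- t) (- c))).
    apply (continuous_comp (fun t => - t) (fun t => Rmin t (- c))).
    + apply (continuous_opp (V := R_NormedModule) (fun t => t)), continuous_id.
    + apply continuous_Rmin.
Qed.

(** The primitive of each piece is attached to the previous ones through [Rmin] and [Rmax],
    which keeps the result continuous on the line. *)
Lemma primitive_exists (a b : R) (n : nat) (ts : nat -> R) (F : R -> R) :
  subdivision a b n ts -> pw_continuous n ts F ->
  exists Phi, primitive a n ts F Phi /\ is_RInt F a b (Phi b).
Proof.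
  intros (Ha & Hb & Hs) HF.
  assert (K : forall k, (k <= S n)%nat -> exists Phi, (forall t, continuous Phi t) /\
     Phi a = 0 /\ is_RInt F a (ts k) (Phi (ts k)) /\
     forall t i, (i < k)%nat -> ts i < t < ts (S i) -> is_derive Phi t (F t)).
  { induction k as [|k IH]; intros Hk.
    - exists (fun _ => 0). refine (conj _ (conj _ (conj _ _))); [intros; apply continuous_const|reflexivity| |intros; lia].
      rewrite Ha. apply (is_RInt_point (V := R_NormedModule)).
    - destruct IH as (Phi & C & E0 & HI & HD); [lia|].
      destruct (HF k ltac:(lia)) as (G & CG & EG).
      set (c := ts k). assert (Hck : c < ts (S k)) by (apply Hs; lia).
      assert (Hmon : forall i j, (i <= j)%nat -> (j <= S n)%nat -> ts i <= ts j)
        by (apply (subdivision_mono a b); repeat split; auto).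
      assert (Hac : a <= c) by (rewrite <- Ha; apply Hmon; lia).
      assert (DG : forall t, is_derive (fun x => RInt G c x) t (G t)).
      { intros t. apply (is_derive_RInt G _ c); [|apply CG].
        apply filter_forall. intros x. apply (RInt_correct (V := R_CompleteNormedModule)).
        apply (ex_RInt_continuous (V := R_CompleteNormedModule)). auto. }
      exists (fun t => Phi (Rmin t c) + RInt G c (Rmax t c)).
      refine (conj _ (conj _ (conj _ _))).
      + intros t. apply (continuous_plus (fun t => Phi (Rmin t c)) (fun t => RInt G c (Rmax t c))).
        * apply (continuous_comp (fun t => Rmin t c) Phi); [apply continuous_Rmin|apply C].
        * apply (continuous_comp (fun t => Rmax t c) (fun x => RInt G c x)); [apply continuous_Rmax|].
          apply (is_derive_continuous _ _ _ (DG _)).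
      + rewrite Rmin_left, Rmax_right by lra. rewrite E0, RInt_point. apply Rplus_0_l.
      + rewrite Rmin_right, Rmax_left by lra.
        apply (is_RInt_Chasles F a c); [exact HI|].
        apply (is_RInt_ext G).
        * rewrite Rmin_left, Rmax_right by lra. intros x Hx. symmetry. apply EG. exact Hx.
        * apply (RInt_correct (V := R_CompleteNormedModule)).
          apply (ex_RInt_continuous (V := R_CompleteNormedModule)). auto.
      + intros t i Hi Ht. assert (i < k \/ i = k)%nat as [Hik| ->] by lia.
        * assert (ts (S i) <= c) by (apply Hmon; lia).
          apply (is_derive_ext_loc Phi); [|apply (HD t i); auto].
          apply (locally_interval _ t (ts i) (ts (S i))); simpl; try lra.
          intros y H1 H2. simpl in *. rewrite Rmin_left, Rmax_right, RInt_point by lra.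
          symmetry; apply Rplus_0_r.
        * fold c in Ht. apply (is_derive_ext_loc (fun t => Phi c + RInt G c t)).
          -- apply (locally_interval _ t c (ts (S k))); simpl; try lra.
             intros y H1 H2. simpl in *. rewrite Rmin_right, Rmax_left by lra. reflexivity.
          -- rewrite EG by exact Ht. replace (G t) with (0 + G t) by ring.
             apply (is_derive_plus (fun _ => Phi c) (fun t => RInt G c t)); [auto_derive; auto|apply DG]. }
  destruct (K (S n) ltac:(lia)) as (Phi & C & E0 & HI & HD).
  exists Phi. rewrite Hb in HI. refine (conj (conj C (conj E0 _)) HI).
  intros t (i & Hi & Ht). apply (HD t i); auto. lia.
Qed.

(** * Continuity and polar angles *)

Lemma Rcont_plus (f g : R -> R) x : continuous f x -> continuous g x ->
  continuous (fun t => f t + g t) x.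
Proof. apply (continuous_plus f g). Qed.
Lemma Rcont_minus (f g : R -> R) x : continuous f x -> continuous g x ->
  continuous (fun t => f t - g t) x.
Proof. apply (continuous_minus (V := R_NormedModule) f g). Qed.
Lemma Rcont_mult (f g : R -> R) x : continuous f x -> continuous g x ->
  continuous (fun t => f t * g t) x.
Proof. apply (continuous_mult f g). Qed.
Lemma Rcont_opp (f : R -> R) x : continuous f x -> continuous (fun t => - f t) x.
Proof. apply (continuous_opp (V := R_NormedModule) f). Qed.
Lemma Rcont_inv (f : R -> R) x : continuous f x -> f x <> 0 -> continuous (fun t => / f t) x.
Proof.
  intros H H0. apply continuity_pt_filterlim. apply continuity_pt_filterlim in H.
  apply (continuity_pt_inv f); auto.
Qed.
Lemma Rcont_div (f g : R -> R) x : continuous f x -> continuous g x -> g x <> 0 ->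
  continuous (fun t => f t / g t) x.
Proof. intros. apply Rcont_mult; auto. apply Rcont_inv; auto. Qed.
Lemma Rcont_pow (f : R -> R) n x : continuous f x -> continuous (fun t => f t ^ n) x.
Proof.
  intros H. induction n; simpl; [apply continuous_const|]. now apply Rcont_mult.
Qed.
Lemma Rcont_comp (f g : R -> R) x : (forall y, continuous g y) -> continuous f x ->
  continuous (fun t => g (f t)) x.
Proof. intros Hg Hf. apply (continuous_comp f g); auto. Qed.
Lemma Rcont_comp_pt (f g : R -> R) x : continuous f x -> continuous g (f x) ->
  continuous (fun t => g (f t)) x.
Proof. intros Hg Hf. apply (continuous_comp f g); auto. Qed.

Lemma continuous_ln_comp (f : R -> R) x : continuous f x -> 0 < f x ->
  continuous (fun t => ln (f t)) x.
Proof.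
  intros Hf H. apply (Rcont_comp_pt f ln); auto.
  apply (is_derive_continuous _ _ (/ f x)). auto_derive; auto. field. lra.
Qed.

(** Reduces continuity of an expression to continuity of the functions occurring in it and
    leaves the conditions on denominators and logarithms as goals. *)
Ltac cont :=
  intros;
  lazymatch goal with
  | |- continuous (fun t => t) _ => apply continuous_id
  | |- continuous (fun t => @?f t + @?g t) _ => apply (Rcont_plus f g); cont
  | |- continuous (fun t => @?f t - @?g t) _ => apply (Rcont_minus f g); cont
  | |- continuous (fun t => @?f t * @?g t) _ => apply (Rcont_mult f g); cont
  | |- continuous (fun t => @?f t / @?g t) _ => apply (Rcont_div f g); [cont|cont|]
  | |- continuous (fun t => / @?g t) _ => apply (Rcont_inv g); [cont|]
  | |- continuous (fun t => - @?f t) _ => apply (Rcont_opp f); cont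
  | |- continuous (fun t => (@?f t) ^ ?n) _ => apply (Rcont_pow f n); cont
  | |- continuous (fun t => cos (@?f t)) _ => apply (Rcont_comp f cos); [exact continuous_cos|cont]
  | |- continuous (fun t => sin (@?f t)) _ => apply (Rcont_comp f sin); [exact continuous_sin|cont]
  | |- continuous (fun t => sqrt (@?f t)) _ => apply (Rcont_comp f sqrt); [exact continuous_sqrt|cont]
  | |- continuous (fun t => exp (@?f t)) _ => apply (Rcont_comp f exp); [exact continuous_exp|cont]
  | |- continuous (fun t => ln (@?f t)) _ => apply (continuous_ln_comp f); [cont|]
  | |- continuous (fun t => Rmin (@?f t) ?c) _ => apply (Rcont_comp f (fun y => Rmin y c)); [exact (continuous_Rmin c)|cont]
  | |- continuous (fun t => Rmax (@?f t) ?c) _ => apply (Rcont_comp f (fun y => Rmax y c)); [exact (continuous_Rmax c)|cont]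
  | |- continuous (fun t => ?F (@?f t)) _ =>
      first [assumption | solve [auto] | apply (Rcont_comp f F); [solve [auto]|cont] | apply continuous_const]
  | |- continuous (fun t => ?c) _ => apply continuous_const
  | |- continuous ?F _ => solve [auto]
  end.

Lemma polar_exists (x y : R) : 0 < x ^ 2 + y ^ 2 ->
  exists th, x = sqrt (x ^ 2 + y ^ 2) * cos th /\ y = sqrt (x ^ 2 + y ^ 2) * sin th.
Proof.
  intros H. set (r := sqrt (x ^ 2 + y ^ 2)).
  assert (Hr : 0 < r) by (now apply sqrt_lt_R0).
  assert (Hr2 : r * r = x ^ 2 + y ^ 2) by (apply sqrt_sqrt; lra).
  assert (B : -1 <= x / r <= 1).
  { split.
    - apply Rmult_le_reg_r with r; [lra|]. unfold Rdiv. rewrite Rmult_assoc, Rinv_l by lra. nra.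
    - apply Rmult_le_reg_r with r; [lra|]. unfold Rdiv. rewrite Rmult_assoc, Rinv_l by lra. nra. }
  assert (S2 : (r * sqrt (1 - (x / r)²)) = Rabs y).
  { rewrite <- (sqrt_Rsqr r) at 1 by lra. rewrite <- sqrt_mult.
    - rewrite <- sqrt_Rsqr_abs. f_equal. unfold Rsqr. field_simplify; [|lra]. nra.
    - apply Rle_0_sqr.
    - unfold Rsqr. nra. }
  destruct (Rle_dec 0 y).
  - exists (acos (x / r)). rewrite cos_acos by lra. rewrite sin_acos by lra.
    split; [field; lra|]. rewrite S2. rewrite Rabs_pos_eq; lra.
  - exists (- acos (x / r)). rewrite cos_neg, sin_neg. rewrite cos_acos by lra. rewrite sin_acos by lra.
    split; [field; lra|]. rewrite <- Ropp_mult_distr_r, S2, Rabs_left; lra.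
Qed.

Lemma atan_polar X Y : 0 < X ->
  X = sqrt (X ^ 2 + Y ^ 2) * cos (atan (Y / X)) /\ Y = sqrt (X ^ 2 + Y ^ 2) * sin (atan (Y / X)).
Proof.
  intros HX. set (r := sqrt (X ^ 2 + Y ^ 2)).
  assert (Hr : 0 < r) by (apply sqrt_lt_R0; nra).
  assert (Hr2 : r * r = X ^ 2 + Y ^ 2) by (apply sqrt_sqrt; nra).
  assert (E : cos (atan (Y / X)) = X / r).
  { rewrite cos_atan. replace (sqrt (1 + (Y / X)²)) with (r / X); [field; lra|].
    apply Rsqr_inj; [apply Rlt_le, Rdiv_lt_0_compat; lra|apply sqrt_pos|].
    rewrite Rsqr_sqrt by (pose proof (Rle_0_sqr (Y / X)); lra). unfold Rsqr.
    transitivity ((r * r) / (X * X)); [field; lra|rewrite Hr2; field; lra]. }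
  assert (E' : sin (atan (Y / X)) = Y / r).
  { transitivity (tan (atan (Y / X)) * cos (atan (Y / X))).
    - unfold tan. field. rewrite E. apply Rgt_not_eq, Rdiv_lt_0_compat; lra.
    - rewrite tan_atan, E. field. lra. }
  rewrite E, E'. split; field; lra.
Qed.

Definition is_lift (z1 z2 th : R -> R) (t : R) : Prop :=
  z1 t = sqrt (z1 t ^ 2 + z2 t ^ 2) * cos (th t) /\
  z2 t = sqrt (z1 t ^ 2 + z2 t ^ 2) * sin (th t).

Lemma is_derive_eq (f : R -> R) (x l l' : R) : is_derive f x l -> l = l' -> is_derive f x l'.
Proof. now intros H <-. Qed.

(** Replaces the derivatives of abstract functions left by [auto_derive] by the values found
    in the context. *)
Ltac known_derive :=
  repeat match goal with
  | H : is_derive ?f ?x ?l |- context [Derive (fun y => ?f y) ?x] =>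
      replace (Derive (fun y => f y) x) with l by (symmetry; exact (is_derive_unique f x l H))
  end.
Ltac exder :=
  repeat match goal with |- _ /\ _ => split | |- True => exact I end;
  try match goal with H : is_derive ?f ?x ?l |- ex_derive _ ?x => exists l; exact H end.

(** The angle is the integral of Im (z' / z), because z exp (- i th) / |z| then has
    derivative 0. *)
Lemma lift_exists (z1 z2 d1 d2 : R -> R) (a b : R) (n : nat) (ts : nat -> R) (th0 : R) :
  subdivision a b n ts -> (forall t, continuous z1 t) -> (forall t, continuous z2 t) ->
  (forall t, 0 < z1 t ^ 2 + z2 t ^ 2) ->
  pw_continuous n ts d1 -> pw_continuous n ts d2 ->
  (forall t, inside n ts t -> is_derive z1 t (d1 t) /\ is_derive z2 t (d2 t)) ->
  is_lift z1 z2 (fun _ => th0) a ->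
  exists th, (forall t, continuous th t) /\ th a = th0 /\
    (forall t, a <= t <= b -> is_lift z1 z2 th t) /\
    (forall t, inside n ts t ->
      is_derive th t ((z1 t * d2 t - z2 t * d1 t) / (z1 t ^ 2 + z2 t ^ 2))).
Proof.
  intros Hs C1 C2 Hz P1 P2 HD (L1 & L2).
  destruct (primitive_exists a b n ts
    (fun t => (z1 t * / (z1 t ^ 2 + z2 t ^ 2)) * d2 t + (- z2 t * / (z1 t ^ 2 + z2 t ^ 2)) * d1 t) Hs)
    as (Phi & (CP & P0 & DP) & _).
  { apply pw_continuous_plus; apply pw_continuous_mult; auto; apply pw_continuous_of_continuous; cont; specialize (Hz t); nra. }
  set (r := fun t => sqrt (z1 t ^ 2 + z2 t ^ 2)).
  assert (Hr : forall t, 0 < r t) by (intros; apply sqrt_lt_R0, Hz).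
  assert (Hr2 : forall t, r t * r t = z1 t ^ 2 + z2 t ^ 2)
    by (intros; apply sqrt_sqrt; specialize (Hz t); lra).
  assert (Cr : forall t, continuous r t) by (unfold r; cont).
  assert (Dr : forall t, inside n ts t -> is_derive r t ((z1 t * d1 t + z2 t * d2 t) / r t)).
  { intros t Ht. destruct (HD t Ht) as (D1 & D2). unfold r. auto_derive.
    - exder. specialize (Hz t). nra.
    - known_derive. fold (r t). replace (z1 t * (z1 t * 1) + z2 t * (z2 t * 1)) with (z1 t ^ 2 + z2 t ^ 2) by ring.
      fold (r t). field. specialize (Hr t). lra. }
  set (th := fun t => th0 + Phi t).
  assert (Cth : forall t, continuous th t) by (unfold th; cont).
  assert (Dth : forall t, inside n ts t -> is_derive th t ((z1 t * d2 t - z2 t * d1 t) / (r t * r t))).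
  { intros t Ht. unfold th. pose proof (DP t Ht) as DPt. auto_derive; [exder|].
    known_derive. rewrite Hr2. field. specialize (Hz t). lra. }
  exists th. refine (conj Cth (conj _ (conj _ _))).
  - unfold th. rewrite P0. apply Rplus_0_r.
  - assert (E1 : forall t, a <= t <= b -> (z1 t * cos (th t) + z2 t * sin (th t)) / r t
       = (z1 a * cos (th a) + z2 a * sin (th a)) / r a).
    { apply (pw_constant (fun t => (z1 t * cos (th t) + z2 t * sin (th t)) / r t) a b n ts Hs).
      - cont. specialize (Hr t). lra.
      - intros t Ht. destruct (HD t Ht) as (D1 & D2). pose proof (Dr t Ht). pose proof (Dth t Ht).
        auto_derive; [exder; specialize (Hr t); lra|]. known_derive.
        pose proof (Hr t). pose proof (Hr2 t). field_simplify; [|lra].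
        apply Rmult_eq_reg_r with (r t ^ 3); [|apply pow_nonzero; lra].
        rewrite Rmult_0_l. unfold Rdiv. rewrite Rmult_assoc, Rinv_l by (apply pow_nonzero; lra).
        replace (r t ^ 2) with (z1 t ^ 2 + z2 t ^ 2) by (rewrite <- Hr2; ring). ring. }
    assert (E2 : forall t, a <= t <= b -> (z2 t * cos (th t) - z1 t * sin (th t)) / r t
       = (z2 a * cos (th a) - z1 a * sin (th a)) / r a).
    { apply (pw_constant (fun t => (z2 t * cos (th t) - z1 t * sin (th t)) / r t) a b n ts Hs).
      - cont. specialize (Hr t). lra.
      - intros t Ht. destruct (HD t Ht) as (D1 & D2). pose proof (Dr t Ht). pose proof (Dth t Ht).
        auto_derive; [exder; specialize (Hr t); lra|]. known_derive.
        pose proof (Hr t). pose proof (Hr2 t). field_simplify; [|lra].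
        apply Rmult_eq_reg_r with (r t ^ 3); [|apply pow_nonzero; lra].
        rewrite Rmult_0_l. unfold Rdiv. rewrite Rmult_assoc, Rinv_l by (apply pow_nonzero; lra).
        replace (r t ^ 2) with (z1 t ^ 2 + z2 t ^ 2) by (rewrite <- Hr2; ring). ring. }
    assert (Ea : th a = th0) by (unfold th; rewrite P0; ring).
    pose proof (sin2_cos2 th0) as T. unfold Rsqr in T. cbv beta in L1, L2. fold (r a) in L1, L2. pose proof (Hr a).
    assert (A1 : (z1 a * cos (th a) + z2 a * sin (th a)) / r a = 1).
    { rewrite Ea, L1, L2. transitivity (sin th0 * sin th0 + cos th0 * cos th0); [field; lra|exact T]. }
    assert (A2 : (z2 a * cos (th a) - z1 a * sin (th a)) / r a = 0).
    { rewrite Ea, L1, L2. field. lra. }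
    intros t Ht. specialize (E1 t Ht). specialize (E2 t Ht). rewrite A1 in E1. rewrite A2 in E2.
    pose proof (Hr t). clear T. pose proof (sin2_cos2 (th t)) as T. unfold Rsqr in T.
    assert (F1 : z1 t * cos (th t) + z2 t * sin (th t) = r t).
    { apply Rmult_eq_reg_r with (/ r t); [|apply Rinv_neq_0_compat; lra]. rewrite Rinv_r by lra. exact E1. }
    assert (F2 : z2 t * cos (th t) - z1 t * sin (th t) = 0).
    { apply Rmult_eq_reg_r with (/ r t); [|apply Rinv_neq_0_compat; lra]. rewrite Rmult_0_l. exact E2. }
    unfold is_lift. fold (r t). rewrite <- F1. split.
    + transitivity (z1 t * (sin (th t) * sin (th t) + cos (th t) * cos (th t))); [rewrite T; ring|].
      transitivity ((z1 t * cos (th t) + z2 t * sin (th t)) * cos (th t)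
        - (z2 t * cos (th t) - z1 t * sin (th t)) * sin (th t)); [ring|rewrite F2; ring].
    + transitivity (z2 t * (sin (th t) * sin (th t) + cos (th t) * cos (th t))); [rewrite T; ring|].
      transitivity ((z1 t * cos (th t) + z2 t * sin (th t)) * sin (th t)
        + (z2 t * cos (th t) - z1 t * sin (th t)) * cos (th t)); [ring|rewrite F2; ring].
  - intros t Ht. eapply is_derive_eq; [apply Dth, Ht|]. now rewrite Hr2.
Qed.

(** The cosine vanishes at both ends of the interval, so x cannot cross them. *)
Lemma stays_close (x : R -> R) (a b : R) :
  (forall t, continuous x t) -> (forall t, a <= t <= b -> 0 < cos (x t)) ->
  - (PI / 2) < x a < PI / 2 -> forall t, a <= t <= b -> - (PI / 2) < x t < PI / 2.
Proof.
  intros C Hc Ha t Ht.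
  assert (Cc : continuity x) by (intros y; apply continuity_pt_filterlim, C).
  pose proof PI_RGT_0.
  split; apply Rnot_le_lt; intros Hx.
  - destruct (IVT_gen x a t (- (PI / 2)) Cc) as (y & Hy & E).
    { rewrite Rmin_right, Rmax_left by lra. lra. }
    rewrite Rmin_left, Rmax_right in Hy by lra.
    specialize (Hc y ltac:(lra)). rewrite E, cos_neg, cos_PI2 in Hc. lra.
  - destruct (IVT_gen x a t (PI / 2) Cc) as (y & Hy & E).
    { rewrite Rmin_left, Rmax_right by lra. lra. }
    rewrite Rmin_left, Rmax_right in Hy by lra.
    specialize (Hc y ltac:(lra)). rewrite E, cos_PI2 in Hc. lra.
Qed.

(** * Horizontal curves and the bound for curvature at most 1 *)

Lemma is_derive_uniq (f : R -> R) (x l l' : R) : is_derive f x l -> is_derive f x l' -> l = l'.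
Proof. intros H H'. rewrite <- (is_derive_unique _ _ _ H). apply is_derive_unique, H'. Qed.

(** A = ca1 + i ca2 and B = cb1 + i cb2 are the entries of a curve in SU(1,1), and
    w = cp + i cq is its control. *)
Record curve : Type := Curve
  { ca1 : R -> R; ca2 : R -> R; cb1 : R -> R; cb2 : R -> R; cp : R -> R; cq : R -> R }.

Definition speed (k : curve) (t : R) : R := sqrt (cp k t ^ 2 + cq k t ^ 2).

(** A' = B conj(w) / 2 and B' = A w / 2, that is g' = g (cp E_1 + cq E_2). *)
Definition is_horizontal_at (k : curve) (t : R) : Prop :=
    is_derive (ca1 k) t ((cb1 k t * cp k t + cb2 k t * cq k t) / 2) /\
    is_derive (ca2 k) t ((cb2 k t * cp k t - cb1 k t * cq k t) / 2) /\
    is_derive (cb1 k) t ((ca1 k t * cp k t - ca2 k t * cq k t) / 2) /\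
    is_derive (cb2 k) t ((ca2 k t * cp k t + ca1 k t * cq k t) / 2).

Definition continuous_curve (k : curve) : Prop :=
  (forall t, continuous (ca1 k) t) /\ (forall t, continuous (ca2 k) t) /\
  (forall t, continuous (cb1 k) t) /\ (forall t, continuous (cb2 k) t).

Definition horizontal (k : curve) (a b : R) (n : nat) (ts : nat -> R) : Prop :=
  subdivision a b n ts /\
  continuous_curve k /\
  (forall t, ca1 k t ^ 2 + ca2 k t ^ 2 - (cb1 k t ^ 2 + cb2 k t ^ 2) = 1) /\
  (pw_continuous n ts (cp k) /\ pw_continuous n ts (cq k)) /\
  forall t, inside n ts t ->
    is_horizontal_at k t.

Lemma pw_continuous_speed k n ts : pw_continuous n ts (cp k) -> pw_continuous n ts (cq k) ->
  pw_continuous n ts (speed k).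
Proof.
  intros H1 H2. unfold speed.
  apply (pw_continuous_comp n ts sqrt (fun t => cp k t ^ 2 + cq k t ^ 2)); [exact continuous_sqrt|].
  apply (pw_continuous_ext n ts (fun t => cp k t * cp k t + cq k t * cq k t)); [intros; ring|].
  apply pw_continuous_plus; apply pw_continuous_mult; auto.
Qed.

Lemma speed_nonneg k t : 0 <= speed k t.
Proof. apply sqrt_pos. Qed.
Lemma speed_sqr k t : speed k t * speed k t = cp k t ^ 2 + cq k t ^ 2.
Proof. apply sqrt_sqrt. nra. Qed.

Lemma dot_unit_le p q s c r : c * c + s * s = 1 -> 0 <= r -> p ^ 2 + q ^ 2 <= r * r ->
  p * c + q * s <= r.
Proof.
  intros H Hr Hn. destruct (Rle_dec (p * c + q * s) 0); [lra|].
  apply Rsqr_incr_0_var; [|lra]. unfold Rsqr.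
  assert (0 <= (p * s - q * c) * (p * s - q * c)) by apply Rle_0_sqr.
  assert ((p * c + q * s) * (p * c + q * s) + (p * s - q * c) * (p * s - q * c) = (p^2+q^2) * (c * c + s * s)) by ring.
  rewrite H in *. lra.
Qed.

Lemma dot_unit_eq p q s c r : c * c + s * s = 1 -> 0 <= r -> p ^ 2 + q ^ 2 <= r * r ->
  p * c + q * s = r -> p = r * c /\ q = r * s.
Proof.
  intros H Hr Hn E.
  assert ((p * c + q * s) * (p * c + q * s) + (p * s - q * c) * (p * s - q * c) = (p^2+q^2) * (c * c + s * s)) by ring.
  rewrite H, E in *.
  assert (Z : p * s - q * c = 0).
  { apply Rsqr_0_uniq. unfold Rsqr. pose proof (Rle_0_sqr (p * s - q * c)) as K. unfold Rsqr in K. lra. }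
  split.
  - transitivity (p * (c * c + s * s)); [rewrite H; ring|].
    transitivity ((p * c + q * s) * c + (p * s - q * c) * s); [ring|rewrite E, Z; ring].
  - transitivity (q * (c * c + s * s)); [rewrite H; ring|].
    transitivity ((p * c + q * s) * s - (p * s - q * c) * c); [ring|rewrite E, Z; ring].
Qed.

Lemma cos2_sin2 x : cos x * cos x + sin x * sin x = 1.
Proof. pose proof (sin2_cos2 x) as H. unfold Rsqr in H. lra. Qed.

Lemma sin_cos_inj x y : - (PI / 2) < x < PI / 2 -> - (PI / 2) < y < PI / 2 -> sin x = sin y -> x = y.
Proof. intros. rewrite <- (asin_sin x), <- (asin_sin y) by lra. now f_equal. Qed.

(** The bound holds because |B| < |A|: a vector as long as B cannot cancel A. *)
Lemma dot_bound a1 a2 b1 b2 : a1 ^ 2 + a2 ^ 2 - (b1 ^ 2 + b2 ^ 2) = 1 ->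
  forall x y, x ^ 2 + y ^ 2 = b1 ^ 2 + b2 ^ 2 -> 0 < a1 ^ 2 + a2 ^ 2 + (a1 * x + a2 * y).
Proof.
  intros H x y E. assert (0 < a1^2+a2^2) by nra.
  assert ((a1 * x + a2 * y)^2 + (a1*y - a2*x)^2 = (a1^2+a2^2)*(x^2+y^2)) by ring.
  rewrite E in *. set (X := a1 ^ 2 + a2 ^ 2) in *. set (d := a1 * x + a2 * y) in *.
  assert (0 <= (a1*y - a2*x)^2) by apply pow2_ge_0.
  assert (0 <= b1 ^ 2 + b2 ^ 2) by nra. set (N := b1 ^ 2 + b2 ^ 2) in *.
  apply Rnot_le_lt. intros K. assert (X * X <= d * d) by nra. nra.
Qed.

Definition lift_of (k : curve) (a b : R) (n : nat) (ts : nat -> R) (al : R -> R) : Prop :=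
  (forall t, continuous al t) /\ (forall t, a <= t <= b -> is_lift (ca1 k) (ca2 k) al t) /\
  (forall t, inside n ts t -> is_derive al t
     ((ca1 k t * ((cb2 k t * cp k t - cb1 k t * cq k t) / 2)
       - ca2 k t * ((cb1 k t * cp k t + cb2 k t * cq k t) / 2)) / (ca1 k t ^ 2 + ca2 k t ^ 2))).

Lemma lift_of_exists k a b n ts th0 : horizontal k a b n ts ->
  is_lift (ca1 k) (ca2 k) (fun _ => th0) a -> exists al, lift_of k a b n ts al /\ al a = th0.
Proof.
  intros (Hs & (C1 & C2 & C3 & C4) & HN & (P1 & P2) & HD) L.
  destruct (lift_exists (ca1 k) (ca2 k)
    (fun t => (cb1 k t * cp k t + cb2 k t * cq k t) / 2)
    (fun t => (cb2 k t * cp k t - cb1 k t * cq k t) / 2) a b n ts th0) as (al & H1 & H2 & H3 & H4); auto.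
  - intros t. specialize (HN t). nra.
  - apply (pw_continuous_ext n ts (fun t => (cb1 k t / 2) * cp k t + (cb2 k t / 2) * cq k t)); [intros; field|].
    apply pw_continuous_plus; apply pw_continuous_mult; auto; apply pw_continuous_of_continuous; cont; lra.
  - apply (pw_continuous_ext n ts (fun t => (cb2 k t / 2) * cp k t + (- cb1 k t / 2) * cq k t)); [intros; field|].
    apply pw_continuous_plus; apply pw_continuous_mult; auto; apply pw_continuous_of_continuous; cont; lra.
  - intros t Ht. destruct (HD t Ht) as (D1 & D2 & _). auto.
  - exists al. exact (conj (conj H1 (conj H3 H4)) H2).
Qed.

Definition starts_at_unit (k : curve) (a : R) : Prop :=
  ca1 k a = 1 /\ ca2 k a = 0 /\ cb1 k a = 0 /\ cb2 k a = 0.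

(** The control of a geodesic of curvature kap, up to parametrization: S is the arc length,
    and the direction of the control turns at the rate kap with respect to S. *)
Definition has_rotating_control (k : curve) (n : nat) (ts : nat -> R) (S : R -> R) (kap ph : R) : Prop :=
  forall t, inside n ts t ->
    cp k t = speed k t * cos (ph + kap * S t) /\ cq k t = speed k t * sin (ph + kap * S t).

(** Calibration by Z = log (A + xi conj(B)) with xi = exp (i de), whose derivative is
    exp (i (de - 2 Im Z)) conj(w) / 2. The candidate moves Z along a straight line, and the
    real linear form of Z that is increasing along this line gives the bound. At the end
    s = |B|, c = |A| and be is the argument of B; for the candidate C + i kap s has argument
    Th, and the last hypothesis says that A has turned at least as far as on the candidate. *)
Lemma lower_bound_null (k : curve) (a b : R) n ts (al S : R -> R)
  (s c C kap nu T Th be : R) :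
  horizontal k a b n ts -> starts_at_unit k a ->
  lift_of k a b n ts al -> al a = 0 ->
  primitive a n ts (speed k) S ->
  0 < c ->
  cb1 k b = s * cos be -> cb2 k b = s * sin be -> c * c = ca1 k b ^ 2 + ca2 k b ^ 2 ->
  kap = sin nu -> 0 <= kap ->
  0 <= Th < PI -> 0 < C -> C = c * cos Th -> kap * s = c * sin Th ->
  C + cos nu * s = exp (cos nu / 2 * T) ->
  al b <= Th - kap * T / 2 ->
  T <= S b /\
  (S b <= T -> has_rotating_control k n ts S kap (be - kap * T / 2)).
Proof.
  intros Hh (I1 & I2 & I3 & I4) (Cal & Lal & _) Ia (CS & S0 & DS) Hc Hb1 Hb2 Hcc Hk Hk0 HTh HC HCc Hks Hexp Hal.
  pose proof Hh as (Hs & (C1 & C2 & C3 & C4) & HN & (P1 & P2) & HD).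
  pose proof (subdivision_lt _ _ _ _ Hs) as Hab. pose proof PI_RGT_0 as HPI.
  assert (HTh2 : Th < PI / 2).
  { apply Rnot_le_lt. intros K. assert (cos Th <= 0) by (apply cos_le_0; lra). nra. }
  set (de := al b - Th + be - nu).
  set (xi1 := cos de). set (xi2 := sin de).
  assert (Hxi : xi1 * xi1 + xi2 * xi2 = 1) by apply cos2_sin2.
  set (z1 := fun t => ca1 k t + (xi1 * cb1 k t + xi2 * cb2 k t)).
  set (z2 := fun t => ca2 k t + (xi2 * cb1 k t - xi1 * cb2 k t)).
  assert (HRe : forall t, 0 < ca1 k t * z1 t + ca2 k t * z2 t).
  { intros t. unfold z1, z2. specialize (HN t).
    pose proof (dot_bound _ _ _ _ HN (xi1 * cb1 k t + xi2 * cb2 k t) (xi2 * cb1 k t - xi1 * cb2 k t)) as K.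
    assert (E : (xi1 * cb1 k t + xi2 * cb2 k t) ^ 2 + (xi2 * cb1 k t - xi1 * cb2 k t) ^ 2
      = (xi1 * xi1 + xi2 * xi2) * (cb1 k t ^ 2 + cb2 k t ^ 2)) by ring.
    rewrite Hxi in E. specialize (K ltac:(lra)). lra. }
  assert (Hz : forall t, 0 < z1 t ^ 2 + z2 t ^ 2).
  { intros t. specialize (HRe t). destruct (Req_dec (z1 t) 0); [destruct (Req_dec (z2 t) 0)|]; nra. }
  assert (Cz1 : forall t, continuous z1 t) by (unfold z1; cont).
  assert (Cz2 : forall t, continuous z2 t) by (unfold z2; cont).
  set (d1 := fun t => (xi1 * (z1 t * cp k t - z2 t * cq k t) + xi2 * (z2 t * cp k t + z1 t * cq k t)) / 2).
  set (d2 := fun t => (xi2 * (z1 t * cp k t - z2 t * cq k t) - xi1 * (z2 t * cp k t + z1 t * cq k t)) / 2).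
  assert (Dz : forall t, inside n ts t -> is_derive z1 t (d1 t) /\ is_derive z2 t (d2 t)).
  { intros t Ht. destruct (HD t Ht) as (D1 & D2 & D3 & D4). unfold z1, z2, d1, d2. split.
    - auto_derive; [exder|]. known_derive.
      transitivity ((xi1 * (ca1 k t * cp k t - ca2 k t * cq k t) + xi2 * (ca2 k t * cp k t + ca1 k t * cq k t)
        + (xi1 * xi1 + xi2 * xi2) * (cb1 k t * cp k t + cb2 k t * cq k t)) / 2); [rewrite Hxi; field|unfold z1, z2; field].
    - auto_derive; [exder|]. known_derive.
      transitivity ((xi2 * (ca1 k t * cp k t - ca2 k t * cq k t) - xi1 * (ca2 k t * cp k t + ca1 k t * cq k t)
        + (xi1 * xi1 + xi2 * xi2) * (cb2 k t * cp k t - cb1 k t * cq k t)) / 2); [rewrite Hxi; field|unfold z1, z2; field]. }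
  destruct (lift_exists z1 z2 d1 d2 a b n ts 0) as (y & Cy & Ya & Ly & Dy); auto.
  { unfold d1. apply (pw_continuous_ext n ts (fun t => ((xi1 * z1 t + xi2 * z2 t) / 2) * cp k t + ((xi2 * z1 t - xi1 * z2 t) / 2) * cq k t)); [intros; field|].
    apply pw_continuous_plus; apply pw_continuous_mult; auto; apply pw_continuous_of_continuous; cont; lra. }
  { unfold d2. apply (pw_continuous_ext n ts (fun t => ((xi2 * z1 t - xi1 * z2 t) / 2) * cp k t + ((- xi2 * z2 t - xi1 * z1 t) / 2) * cq k t)); [intros; field|].
    apply pw_continuous_plus; apply pw_continuous_mult; auto; apply pw_continuous_of_continuous; cont; lra. }
  { unfold is_lift, z1, z2. rewrite I1, I2, I3, I4, cos_0, sin_0.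
    replace ((1 + (xi1 * 0 + xi2 * 0)) ^ 2 + (0 + (xi2 * 0 - xi1 * 0)) ^ 2) with 1 by ring.
    rewrite sqrt_1. split; ring. }
  (* |B| < |A| keeps z in the open half plane around A, so the two angles never part
     by pi / 2. *)
  assert (Hclose : forall t, a <= t <= b -> - (PI / 2) < y t - al t < PI / 2).
  { apply (stays_close (fun t => y t - al t)); [cont| |rewrite Ya, Ia; lra].
    intros t Ht. destruct (Ly t Ht) as (E1 & E2). destruct (Lal t Ht) as (E3 & E4).
    specialize (HRe t). rewrite cos_minus.
    set (r := sqrt (z1 t ^ 2 + z2 t ^ 2)) in *. set (r' := sqrt (ca1 k t ^ 2 + ca2 k t ^ 2)) in *.
    assert (0 < r) by (apply sqrt_lt_R0, Hz).
    assert (0 < r') by (apply sqrt_lt_R0; specialize (HN t); nra).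
    assert (ca1 k t * z1 t + ca2 k t * z2 t = (r * r') * (cos (y t) * cos (al t) + sin (y t) * sin (al t))).
    { rewrite E1, E2, E3, E4 at 1. ring. }
    apply Rmult_lt_reg_l with (r * r'); nra. }
  (* The direction de is chosen so that z b = exp (cos nu / 2 * T) * exp (i (al b - Th)). *)
  assert (Hbb : a <= b <= b) by lra.
  destruct (Lal b Hbb) as (A1 & A2).
  replace (sqrt (ca1 k b ^ 2 + ca2 k b ^ 2)) with c in A1, A2
    by (rewrite <- Hcc; symmetry; apply sqrt_square; lra).
  assert (Z1 : z1 b = exp (cos nu / 2 * T) * cos (al b - Th)).
  { rewrite <- Hexp, HCc. unfold z1, xi1, xi2. rewrite A1, Hb1, Hb2.
    transitivity (c * cos (al b - Th + Th) + s * cos (de - be)); [rewrite cos_minus; f_equal; [f_equal; f_equal; ring|ring]|].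
    replace (de - be) with (al b - Th - nu) by (unfold de; ring).
    rewrite cos_plus, (cos_minus _ nu).
    transitivity ((c * cos Th + cos nu * s) * cos (al b - Th) + (kap * s - c * sin Th) * sin (al b - Th));
      [rewrite Hk; ring|rewrite Hks; ring]. }
  assert (Z2 : z2 b = exp (cos nu / 2 * T) * sin (al b - Th)).
  { rewrite <- Hexp, HCc. unfold z2, xi1, xi2. rewrite A2, Hb1, Hb2.
    transitivity (c * sin (al b - Th + Th) + s * sin (de - be)); [rewrite sin_minus; f_equal; [f_equal; f_equal; ring|ring]|].
    replace (de - be) with (al b - Th - nu) by (unfold de; ring).
    rewrite sin_plus, (sin_minus _ nu).
    transitivity ((c * cos Th + cos nu * s) * sin (al b - Th) + (c * sin Th - kap * s) * cos (al b - Th));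
      [rewrite Hk; ring|rewrite Hks; ring]. }
  pose proof (exp_pos (cos nu / 2 * T)) as He.
  assert (Zn : z1 b ^ 2 + z2 b ^ 2 = exp (cos nu / 2 * T) * exp (cos nu / 2 * T)).
  { rewrite Z1, Z2. pose proof (cos2_sin2 (al b - Th)).
    transitivity (exp (cos nu / 2 * T) * exp (cos nu / 2 * T) * (cos (al b - Th) * cos (al b - Th) + sin (al b - Th) * sin (al b - Th))); [ring|rewrite H; ring]. }
  assert (Hy : y b = al b - Th).
  { destruct (Ly b Hbb) as (E1 & E2). rewrite Zn, sqrt_square in E1, E2 by lra.
    rewrite Z1 in E1. rewrite Z2 in E2. apply Rmult_eq_reg_l in E1; [|lra]. apply Rmult_eq_reg_l in E2; [|lra].
    specialize (Hclose b Hbb).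
    assert (y b - al b = - Th); [|lra]. apply sin_cos_inj; [lra|lra|].
    rewrite sin_minus, <- E1, <- E2, <- sin_minus. f_equal. ring. }
  (* twice the component of Z in the direction (cos nu, - sin nu) of the candidate *)
  set (F := fun t => cos nu * ln (z1 t ^ 2 + z2 t ^ 2) - 2 * kap * y t).
  set (ph := fun t => nu + de - 2 * y t).
  assert (DF : forall t, inside n ts t -> is_derive F t (cp k t * cos (ph t) + cq k t * sin (ph t)) /\
     is_derive y t ((cp k t * sin (de - 2 * y t) - cq k t * cos (de - 2 * y t)) / 2)).
  { intros t Ht. destruct (Dz t Ht) as (Dz1 & Dz2). pose proof (Dy t Ht) as Dyt.
    pose proof (inside_bounds _ _ _ _ _ Hs Ht) as Htb.
    destruct (Ly t ltac:(lra)) as (E1 & E2). specialize (Hz t).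
    set (r := sqrt (z1 t ^ 2 + z2 t ^ 2)) in *.
    assert (Hr : 0 < r) by (apply sqrt_lt_R0, Hz).
    assert (Hr2 : r * r = z1 t ^ 2 + z2 t ^ 2) by (apply sqrt_sqrt; lra).
    assert (Hcos : cos (de - 2 * y t) * (r * r) = xi1 * (z1 t ^ 2 - z2 t ^ 2) + xi2 * (2 * z1 t * z2 t)).
    { rewrite cos_minus, cos_2a, sin_2a. fold xi1 xi2. rewrite E1, E2. ring. }
    assert (Hsin : sin (de - 2 * y t) * (r * r) = xi2 * (z1 t ^ 2 - z2 t ^ 2) - xi1 * (2 * z1 t * z2 t)).
    { rewrite sin_minus, cos_2a, sin_2a. fold xi1 xi2. rewrite E1, E2. ring. }
    assert (Hcos' : cos (de - 2 * y t) = (xi1 * (z1 t ^ 2 - z2 t ^ 2) + xi2 * (2 * z1 t * z2 t)) / (r * r)).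
    { rewrite <- Hcos. field. lra. }
    assert (Hsin' : sin (de - 2 * y t) = (xi2 * (z1 t ^ 2 - z2 t ^ 2) - xi1 * (2 * z1 t * z2 t)) / (r * r)).
    { rewrite <- Hsin. field. lra. }
    split.
    - unfold F. auto_derive; [exder; nra|]. known_derive.
      unfold ph. replace (nu + de - 2 * y t) with (nu + (de - 2 * y t)) by ring.
      rewrite cos_plus, sin_plus, Hcos', Hsin', Hr2. unfold d1, d2. rewrite Hk. field. lra.
    - eapply is_derive_eq; [exact Dyt|]. rewrite Hcos', Hsin', Hr2. unfold d1, d2. field. lra. }
  assert (CF : forall t, continuous F t) by (unfold F; cont; apply Hz).
  assert (Fa : F a = 0).
  { unfold F, z1, z2. rewrite I1, I2, I3, I4, Ya.
    replace ((1 + (xi1 * 0 + xi2 * 0)) ^ 2 + (0 + (xi2 * 0 - xi1 * 0)) ^ 2) with 1 by ring.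
    rewrite ln_1. ring. }
  assert (Hnu : cos nu * cos nu + kap * kap = 1) by (rewrite Hk; apply cos2_sin2).
  assert (Fb : T <= F b).
  { unfold F. rewrite Zn, ln_mult, ln_exp, Hy by lra.
    apply Rle_trans with ((cos nu * cos nu + kap * kap) * T); [rewrite Hnu; lra|].
    enough (0 <= kap * (Th - kap * T / 2 - al b)) by lra. apply Rmult_le_pos; lra. }
  assert (DG : forall t, inside n ts t -> exists l, is_derive (fun t => S t - F t) t l /\ 0 <= l).
  { intros t Ht. destruct (DF t Ht) as (DFt & _). pose proof (DS t Ht) as DSt.
    exists (speed k t - (cp k t * cos (ph t) + cq k t * sin (ph t))). split.
    - auto_derive; [exder|]. known_derive. ring.
    - enough (cp k t * cos (ph t) + cq k t * sin (ph t) <= speed k t) by lra.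
      apply dot_unit_le; [apply cos2_sin2|apply speed_nonneg|rewrite speed_sqr; lra]. }
  assert (CG : forall t, continuous (fun t => S t - F t) t) by cont.
  split.
  - pose proof (pw_monotone (fun t => S t - F t) a b n ts Hs (fun t _ => CG t) DG a b) as K. cbv beta in K. rewrite S0, Fa in K. lra.
  - intros HST t Ht.
    pose proof (pw_rigid (fun t => S t - F t) a b n ts Hs (fun t _ => CG t) DG) as K. cbv beta in K. rewrite S0, Fa in K.
    specialize (K ltac:(lra)).
    assert (E : forall t, inside n ts t -> cp k t = speed k t * cos (ph t) /\ cq k t = speed k t * sin (ph t)).
    { intros t' Ht'. apply dot_unit_eq; [apply cos2_sin2|apply speed_nonneg|rewrite speed_sqr; lra|].
      specialize (K t' Ht'). destruct (DF t' Ht') as (DFt & _). pose proof (DS t' Ht') as DSt.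
      assert (D' : is_derive (fun t => S t - F t) t' (speed k t' - (cp k t' * cos (ph t') + cq k t' * sin (ph t')))).
      { auto_derive; [exder|]. known_derive. ring. }
      pose proof (is_derive_uniq _ _ _ _ K D'). lra. }
    assert (Yl : forall t, a <= t <= b -> y t = - kap * S t / 2).
    { intros t' Ht'. assert (y t' + kap * S t' / 2 = y a + kap * S a / 2); [|rewrite Ya, S0 in *; lra].
      apply (pw_constant (fun t => y t + kap * S t / 2) a b n ts Hs); [cont; lra| |exact Ht'].
      intros x Hx. destruct (DF x Hx) as (_ & Dyx). pose proof (DS x Hx) as DSx. destruct (E x Hx) as (Ep & Eq).
      auto_derive; [exder|]. known_derive. rewrite Ep, Eq.
      transitivity (speed k x * (sin (de - 2 * y x) * cos (ph x) - cos (de - 2 * y x) * sin (ph x)) / 2 + kap * speed k x / 2); [field|].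
      rewrite <- sin_minus. replace (de - 2 * y x - ph x) with (- nu) by (unfold ph; ring). rewrite sin_neg, <- Hk. field. }
    assert (Hend : al b = Th - kap * T / 2).
    { pose proof (Yl b Hbb) as K1. rewrite Hy in K1.
      pose proof (pw_monotone (fun t => S t - F t) a b n ts Hs (fun t _ => CG t) DG a b) as K2. cbv beta in K2. rewrite S0, Fa in K2.
      assert (S b = T) by lra. rewrite H in K1. lra. }
    pose proof (inside_bounds _ _ _ _ _ Hs Ht) as Htb.
    destruct (E t Ht) as (Ep & Eq). rewrite Ep, Eq.
    replace (ph t) with (be - kap * T / 2 + kap * S t); [split; reflexivity|].
    unfold ph, de. rewrite (Yl t ltac:(lra)), Hend. field.
Qed.

(** * Tools for the bound with curvature greater than 1 *)

Ltac as_R_eq := lazymatch goal with |- @eq _ ?a ?b => change (@eq R a b) end.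

Lemma is_derive_pos_sqr (x : R) : is_derive (fun t => Rmax t 0 ^ 2) x (2 * Rmax x 0).
Proof.
  destruct (Rtotal_order x 0) as [H|[->|H]].
  - rewrite Rmax_right by lra. apply (is_derive_ext_loc (fun _ => 0)).
    + apply (locally_interval _ x m_infty 0); simpl; auto. intros y _ Hy. simpl in Hy. rewrite Rmax_right by lra. ring.
    + auto_derive; [auto|ring].
  - rewrite Rmax_right by lra. apply is_derive_Reals. intros e He. exists (mkposreal e He).
    simpl. intros h Hh Hb. rewrite (Rmax_left 0 0), Rplus_0_l by lra.
    unfold Rmax. destruct Rle_dec.
    + replace ((0 * (0 * 1) - 0 * (0 * 1)) / h - 2 * 0) with 0 by (field; lra). rewrite Rabs_R0. lra.
    + replace ((h * (h * 1) - 0 * (0 * 1)) / h - 2 * 0) with h by (field; lra). lra.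
  - rewrite Rmax_left by lra. apply (is_derive_ext_loc (fun t => t ^ 2)).
    + apply (locally_interval _ x 0 p_infty); simpl; auto. intros y Hy _. simpl in Hy. rewrite Rmax_left by lra. ring.
    + auto_derive; [auto|ring].
Qed.

(** A step of class C^1, constant outside the interval from -1 to 1 and increasing inside. *)
Definition spline (x : R) : R := (Rmax (1 + x) 0 ^ 2 - 2 * Rmax x 0 ^ 2 + Rmax (x - 1) 0 ^ 2) / 2.

Lemma is_derive_spline x : is_derive spline x (Rmax (1 + x) 0 - 2 * Rmax x 0 + Rmax (x - 1) 0).
Proof.
  unfold spline.
  assert (D : forall c, is_derive (fun t : R => Rmax (c + t) 0 ^ 2) x (2 * Rmax (c + x) 0)).
  { intros c. eapply is_derive_eq.
    - apply (is_derive_comp (fun t => Rmax t 0 ^ 2) (fun t => c + t)); [apply is_derive_pos_sqr|].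
      auto_derive; [auto|reflexivity].
    - unfold scal. simpl. unfold mult. simpl. ring. }
  apply (is_derive_ext (fun x => / 2 * (Rmax (1 + x) 0 ^ 2 - 2 * Rmax (0 + x) 0 ^ 2 + Rmax (- 1 + x) 0 ^ 2))).
  { intros t. rewrite Rplus_0_l. replace (-1 + t) with (t - 1) by ring. as_R_eq. field. }
  pose proof (D 1) as D1. pose proof (D 0) as D0. pose proof (D (-1)) as D2.
  set (f1 := fun t => Rmax (1 + t) 0 ^ 2) in *. set (f0 := fun t => Rmax (0 + t) 0 ^ 2) in *.
  set (f2 := fun t => Rmax (-1 + t) 0 ^ 2) in *.
  apply (is_derive_ext (fun x => / 2 * (f1 x - 2 * f0 x + f2 x))); [reflexivity|].
  auto_derive; [exder|]. known_derive. rewrite Rplus_0_l. replace (-1 + x) with (x - 1) by ring. field.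
Qed.

(** Composing with [spline] removes all knowledge about the derivative outside the band: the
    composite is monotone on the whole interval, so f can enter the band only from below and
    leave it only above. *)
Lemma stays_in_band (f : R -> R) (a b : R) (n : nat) (ts : nat -> R) :
  subdivision a b n ts -> (forall t, continuous f t) ->
  (forall t, inside n ts t -> exists l, is_derive f t l /\ (-1 < f t < 1 -> 0 <= l)) ->
  -1 < f a -> f b < 1 -> forall t, a <= t <= b -> -1 < f t < 1.
Proof.
  intros Hs C D Ha Hb t Ht. pose proof (subdivision_lt _ _ _ _ Hs) as Hab.
  assert (M : forall s t, a <= s -> s <= t -> t <= b -> spline (f s) <= spline (f t)).
  { apply (pw_monotone (fun t => spline (f t)) a b n ts Hs).
    - intros x _. apply (Rcont_comp f spline); auto. intros y. apply (is_derive_continuous _ _ _ (is_derive_spline y)).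
    - intros x Hx. destruct (D x Hx) as (l & Dl & Hl).
      exists (l * (Rmax (1 + f x) 0 - 2 * Rmax (f x) 0 + Rmax (f x - 1) 0)). split.
      + apply (is_derive_comp spline f); [apply is_derive_spline|exact Dl].
      + destruct (Rle_dec (f x) (-1)); [|destruct (Rle_dec 1 (f x))].
        * rewrite !Rmax_right by lra. lra.
        * rewrite !Rmax_left by lra. nra.
        * apply Rmult_le_pos; [apply Hl; lra|]. rewrite (Rmax_left (1 + f x)), (Rmax_right (f x - 1)) by lra.
          unfold Rmax; destruct Rle_dec; lra. }
  split; apply Rnot_le_lt; intros K.
  - pose proof (M a t ltac:(lra) ltac:(lra) ltac:(lra)) as M'. unfold spline in M'.
    rewrite (Rmax_right (1 + f t)), (Rmax_right (f t)), (Rmax_right (f t - 1)) in M' by lra.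
    revert M'. rewrite (Rmax_left (1 + f a)) by lra. unfold Rmax; repeat destruct Rle_dec; nra.
  - pose proof (M t b ltac:(lra) ltac:(lra) ltac:(lra)) as M'. unfold spline in M'.
    rewrite (Rmax_left (1 + f t)), (Rmax_left (f t)), (Rmax_left (f t - 1)) in M' by lra.
    revert M'. rewrite (Rmax_right (f b - 1)) by lra. unfold Rmax; repeat destruct Rle_dec; nra.
Qed.

(** Reverse Cauchy-Schwarz inequality in the Lorentz plane: kap J - be is the product of the
    timelike vectors (kap, 1) and (J, be), of norms 2 om and R0. *)
Lemma timelike_bound (kap om J be R0 : R) : 0 < kap -> 0 < om -> 4 * (om * om) = kap * kap - 1 ->
  0 < J -> 0 <= be -> 0 <= R0 -> R0 * R0 = J * J - be * be ->
  2 * om * R0 <= kap * J - be /\ (kap * J - be <= 2 * om * R0 -> J = kap * be).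
Proof.
  intros Hk Ho Hok HJ Hb HR E.
  assert (be <= J) by (apply Rnot_lt_le; intros K; nra).
  assert (1 < kap) by (apply Rnot_le_lt; intros K; nra).
  assert (0 < kap * J - be) by nra.
  assert (Q : (kap * J - be) * (kap * J - be) - (2 * om * R0) * (2 * om * R0) = (J - kap * be) * (J - kap * be)).
  { transitivity ((kap * J - be) * (kap * J - be) - (4 * (om * om)) * (R0 * R0)); [ring|rewrite Hok, E; ring]. }
  assert (0 <= 2 * om * R0) by nra.
  pose proof (Rle_0_sqr (J - kap * be)) as Q2. unfold Rsqr in Q2.
  split.
  - apply Rnot_lt_le; intros K. nra.
  - intros K. assert ((J - kap * be) * (J - kap * be) = 0) by nra.
    apply Rmult_integral in H3. lra.
Qed.

Lemma is_derive_asin x : -1 < x < 1 -> is_derive asin x (/ sqrt (1 - x ^ 2)).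
Proof.
  intros H. apply is_derive_Reals. replace (/ sqrt (1 - x ^ 2)) with (1 / sqrt (1 - x²)).
  - apply (derive_pt_eq_1 asin x _ (derivable_pt_asin x H)). apply derive_pt_asin.
  - unfold Rsqr. simpl. rewrite Rmult_1_r. field. apply Rgt_not_eq, sqrt_lt_R0. nra.
Qed.

(** * The calibration by a slice of anti-de Sitter space *)

(** As |B| < |A|, the argument of A decreases at most at half the speed, which the rotation by
    kap S / 2 with kap > 1 outweighs. *)
Lemma increasing_angle (k : curve) (a b : R) n ts (al S sg : R -> R) (kap : R) :
  horizontal k a b n ts -> lift_of k a b n ts al -> 1 < kap ->
  primitive a n ts sg S ->
  (forall t, inside n ts t -> speed k t <= sg t) ->
  forall s t, a <= s -> s <= t -> t <= b -> al s + kap * S s / 2 <= al t + kap * S t / 2.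
Proof.
  intros Hh (Cal & Lal & Dal) Hk (CS & S0 & DS) Hsg.
  pose proof Hh as (Hs & (C1 & C2 & C3 & C4) & HN & (P1 & P2) & HD).
  apply (pw_monotone (fun t => al t + kap * S t / 2) a b n ts Hs); [cont; lra|].
  intros t Ht. pose proof (DS t Ht) as DSt. pose proof (Dal t Ht) as Dalt. specialize (HN t).
  pose proof (speed_nonneg k t) as Hp0. pose proof (speed_sqr k t) as Hp. specialize (Hsg t Ht).
  eexists. split.
  - auto_derive; [exder|]. known_derive. reflexivity.
  - set (a1 := ca1 k t) in *. set (a2 := ca2 k t) in *. set (b1 := cb1 k t) in *. set (b2 := cb2 k t) in *.
    set (p := cp k t) in *. set (q := cq k t) in *.
    set (X := a1 ^ 2 + a2 ^ 2) in *.
    assert (HX : 1 <= X) by nra.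
    set (Y := a1 * (b2 * p - b1 * q) - a2 * (b1 * p + b2 * q)).
    assert (HY : Y * Y <= (X * speed k t) * (X * speed k t)).
    { assert (Y * Y + (a1 * (b1 * p + b2 * q) + a2 * (b2 * p - b1 * q)) ^ 2 = X * ((b1 ^ 2 + b2 ^ 2) * (p ^ 2 + q ^ 2)))
        by (unfold Y, X; ring).
      assert (0 <= (a1 * (b1 * p + b2 * q) + a2 * (b2 * p - b1 * q)) ^ 2) by apply pow2_ge_0.
      assert ((b1 ^ 2 + b2 ^ 2) * (p ^ 2 + q ^ 2) <= X * (p ^ 2 + q ^ 2)) by (apply Rmult_le_compat_r; nra).
      replace (X * speed k t * (X * speed k t)) with (X * (X * (p ^ 2 + q ^ 2))) by (rewrite <- Hp; ring).
      nra. }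
    assert (HY2 : - (X * speed k t) <= Y).
    { apply Rnot_lt_le. intros K. assert (0 <= X * speed k t) by nra. nra. }
    replace (1 * ((a1 * ((b2 * p - b1 * q) / 2) - a2 * ((b1 * p + b2 * q) / 2)) / X) +
      kap * (1 * sg t) * / 2) with ((Y + X * kap * sg t) / (2 * X)) by (unfold Y; field; lra).
    apply Rle_mult_inv_pos; [|lra].
    assert (X * speed k t <= X * kap * sg t); [|lra].
    rewrite Rmult_assoc. apply Rmult_le_compat_l; [lra|]. nra.
Qed.

(** In the frame turning with angle kap S / 2 the curve is timelike, and f is its product with
    a fixed unit normal N of a totally geodesic slice, so that asin f is the Lorentzian
    distance to this slice. With J = - Im (A exp (i kap S / 2)), the identity
    J^2 - |B|^2 = 1 - f^2 and the reverse Cauchy-Schwarz inequality give the growth of asin f.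
    The bounds on the angle keep the curve on the sheet where J > 0. The majorant sg of the
    speed allows stretches on which the frame turns faster than the curve moves. In the case
    of equality B exp (- i kap S / 2) / J is constant and the control is a multiple of it. *)
Lemma lower_bound_timelike (k : curve) (a b : R) n ts (al S sg : R -> R) (kap om : R) :
  horizontal k a b n ts -> lift_of k a b n ts al ->
  1 < kap -> 0 < om -> 4 * (om * om) = kap * kap - 1 ->
  primitive a n ts sg S ->
  (forall t, inside n ts t -> speed k t <= sg t) ->
  let f := fun t => ca1 k t * cos (kap * S t / 2) - ca2 k t * sin (kap * S t / 2) in
  - PI < al a -> al b + kap * S b / 2 < 0 ->
  -1 < f a -> f b < 1 ->
  om * S b <= asin (f b) - asin (f a) /\
  (asin (f b) - asin (f a) <= om * S b ->
   ca2 k a < 0 /\ forall t, inside n ts t ->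
     speed k t = sg t /\
     cp k t * cos (kap * S t) + cq k t * sin (kap * S t) = sg t * kap * (cb1 k a / ca2 k a) /\
     cq k t * cos (kap * S t) - cp k t * sin (kap * S t) = sg t * kap * (cb2 k a / ca2 k a)).
Proof.
  intros Hh Hl Hk Hom Hok HS Hsg f Ha Hb Hfa Hfb.
  pose proof (increasing_angle k a b n ts al S sg kap Hh Hl Hk HS Hsg) as Hinc.
  destruct Hl as (Cal & Lal & Dal). destruct HS as (CS & S0 & DS).
  pose proof Hh as (Hs & (C1 & C2 & C3 & C4) & HN & (P1 & P2) & HD).
  pose proof (subdivision_lt _ _ _ _ Hs) as Hab. pose proof PI_RGT_0 as HPI.
  set (ps := fun t => kap * S t / 2) in *.
  set (J := fun t => - (ca1 k t * sin (ps t) + ca2 k t * cos (ps t))).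
  assert (Cps : forall t, continuous ps t) by (unfold ps; cont; lra).
  assert (Cf : forall t, continuous f t) by (unfold f; cont; lra).
  assert (CJ : forall t, continuous J t) by (unfold J; cont).
  assert (HJ : forall t, a <= t <= b -> 0 < J t).
  { intros t Ht. destruct (Lal t Ht) as (E1 & E2).
    set (r := sqrt (ca1 k t ^ 2 + ca2 k t ^ 2)) in *.
    assert (Hr : 0 < r) by (apply sqrt_lt_R0; specialize (HN t); nra).
    assert (E : J t = - (r * sin (al t + ps t))).
    { unfold J. rewrite E1, E2, sin_plus. ring. }
    rewrite E. pose proof (Hinc a t) as K1. pose proof (Hinc t b) as K2. rewrite S0 in K1.
    assert (sin (al t + ps t) < 0); [|nra].
    apply sin_lt_0_var; unfold ps; lra. }
  set (U1 := fun t => cb1 k t * cp k t + cb2 k t * cq k t).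
  set (U2 := fun t => cb2 k t * cp k t - cb1 k t * cq k t).
  set (Y := fun t => U1 t * cos (ps t) - U2 t * sin (ps t)).
  set (Z := fun t => U1 t * sin (ps t) + U2 t * cos (ps t)).
  set (be := fun t => sqrt (cb1 k t ^ 2 + cb2 k t ^ 2)).
  assert (Hbe : forall t, be t * be t = cb1 k t ^ 2 + cb2 k t ^ 2) by (intros; apply sqrt_sqrt; nra).
  assert (Hbe0 : forall t, 0 <= be t) by (intros; apply sqrt_pos).
  assert (HfJ : forall t, J t * J t - be t * be t = 1 - f t ^ 2).
  { intros t. rewrite Hbe. specialize (HN t). pose proof (cos2_sin2 (ps t)) as T. unfold J, f. fold (ps t).
    transitivity ((ca1 k t ^ 2 + ca2 k t ^ 2) * (cos (ps t) * cos (ps t) + sin (ps t) * sin (ps t)) - (cb1 k t ^ 2 + cb2 k t ^ 2)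
       - (ca1 k t * cos (ps t) - ca2 k t * sin (ps t)) ^ 2); [ring|]. rewrite T. lra. }
  assert (Dps : forall t, inside n ts t -> is_derive ps t (kap * sg t / 2)).
  { intros t Ht. pose proof (DS t Ht) as DSt. unfold ps. auto_derive; [exder|]. known_derive. field. }
  assert (Df : forall t, inside n ts t -> is_derive f t ((kap * sg t * J t + Y t) / 2)).
  { intros t Ht. pose proof (Dps t Ht) as Dpst. destruct (HD t Ht) as (D1 & D2 & _).
    unfold f. apply (is_derive_ext (fun t => ca1 k t * cos (ps t) - ca2 k t * sin (ps t))); [reflexivity|].
    auto_derive; [exder|]. known_derive. unfold J, Y, U1, U2. field. }
  assert (DJ : forall t, inside n ts t -> is_derive J t (- (kap * sg t * f t + Z t) / 2)).
  { intros t Ht. pose proof (Dps t Ht) as Dpst. destruct (HD t Ht) as (D1 & D2 & _).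
    unfold J. auto_derive; [exder|]. known_derive. unfold f, Z, U1, U2. fold (ps t). field. }
  assert (HYZ : forall t, Y t * Y t + Z t * Z t = be t * be t * (speed k t * speed k t)).
  { intros t. rewrite Hbe, speed_sqr. unfold Y, Z.
    transitivity ((U1 t * U1 t + U2 t * U2 t) * (cos (ps t) * cos (ps t) + sin (ps t) * sin (ps t))); [ring|].
    rewrite cos2_sin2. unfold U1, U2. ring. }
  assert (HY : forall t, inside n ts t -> 0 <= sg t /\ 0 <= Y t + be t * sg t).
  { intros t Ht. specialize (HYZ t). specialize (Hbe0 t). specialize (Hsg t Ht). pose proof (speed_nonneg k t).
    split; [lra|]. apply Rnot_lt_le. intros K.
    assert (be t * speed k t <= be t * sg t) by (apply Rmult_le_compat_l; lra).
    assert (0 <= be t * speed k t) by nra.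
    assert (0 <= Z t * Z t) by nra.
    assert (Y t * Y t <= (be t * speed k t) * (be t * speed k t)) by nra. nra. }
  (* Leaving the band would mean crossing the light cone of the normal of the slice. *)
  assert (Hf1 : forall t, a <= t <= b -> -1 < f t < 1).
  { apply (stays_in_band f a b n ts Hs Cf); auto. intros t Ht.
    exists ((kap * sg t * J t + Y t) / 2). split; [apply Df, Ht|]. intros Hf.
    pose proof (inside_bounds _ _ _ _ _ Hs Ht) as Htb.
    specialize (HJ t ltac:(lra)). specialize (HfJ t). destruct (HY t Ht) as (H0 & H1). specialize (Hbe0 t).
    assert (be t <= J t) by nra.
    assert (be t * sg t <= J t * sg t) by (apply Rmult_le_compat_r; lra).
    assert (0 <= J t * sg t) by nra. nra. }
  set (R0 := fun t => sqrt (1 - f t ^ 2)).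
  assert (HR0 : forall t, a <= t <= b -> 0 < R0 t /\ R0 t * R0 t = J t * J t - be t * be t).
  { intros t Ht. specialize (Hf1 t Ht). unfold R0. split; [apply sqrt_lt_R0; nra|].
    rewrite sqrt_sqrt by nra. rewrite HfJ. reflexivity. }
  set (G := fun t => asin (f t) - om * S t).
  assert (DG : forall t, inside n ts t -> is_derive G t ((kap * sg t * J t + Y t) / 2 / R0 t - om * sg t)).
  { intros t Ht. pose proof (inside_bounds _ _ _ _ _ Hs Ht) as Htb.
    pose proof (DS t Ht) as DSt. pose proof (Df t Ht) as Dft.
    assert (Das : is_derive (fun t : R => asin (f t)) t ((kap * sg t * J t + Y t) / 2 / R0 t)).
    { apply (is_derive_comp asin f); [apply is_derive_asin, Hf1; lra|exact Dft]. }
    unfold G. set (as_f := fun t : R => asin (f t)) in *.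
    apply (is_derive_ext (fun t => as_f t - om * S t)); [reflexivity|].
    auto_derive; [exder|]. known_derive. field. apply Rgt_not_eq, HR0; lra. }
  assert (DG0 : forall t, inside n ts t ->
     (kap * sg t * J t + Y t) / 2 / R0 t - om * sg t =
     (sg t * (kap * J t - be t - 2 * om * R0 t) + (Y t + be t * sg t)) / (2 * R0 t) /\
     0 <= sg t * (kap * J t - be t - 2 * om * R0 t)).
  { intros t Ht. pose proof (inside_bounds _ _ _ _ _ Hs Ht) as Htb.
    destruct (HR0 t ltac:(lra)) as (Hr1 & Hr2). split; [field; lra|].
    destruct (HY t Ht) as (Hsg0 & _). apply Rmult_le_pos; auto.
    destruct (timelike_bound kap om (J t) (be t) (R0 t)) as (K & _); auto; try lra. apply HJ; lra. }
  assert (DG1 : forall t, inside n ts t -> exists l, is_derive G t l /\ 0 <= l).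
  { intros t Ht. eexists. split; [apply DG, Ht|]. destruct (DG0 t Ht) as (E & K). rewrite E.
    pose proof (inside_bounds _ _ _ _ _ Hs Ht) as Htb. destruct (HR0 t ltac:(lra)) as (Hr1 & _).
    destruct (HY t Ht) as (_ & K2). apply Rle_mult_inv_pos; lra. }
  assert (CG : forall t, a <= t <= b -> continuous G t).
  { intros t Ht. unfold G. apply (Rcont_minus (fun t => asin (f t)) (fun t => om * S t)); [|cont].
    apply (Rcont_comp_pt f asin); [apply Cf|]. apply (is_derive_continuous _ _ _ (is_derive_asin _ (Hf1 t Ht))). }
  split.
  - pose proof (pw_monotone G a b n ts Hs CG DG1 a b) as K. unfold G in K. rewrite S0 in K. lra.
  - intros Heq.
    pose proof (pw_rigid G a b n ts Hs CG DG1) as K. unfold G in K at 1 2. rewrite S0 in K. specialize (K ltac:(lra)).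
    assert (Hz : forall t, inside n ts t -> Y t = - (be t * sg t) /\ Z t = 0 /\
      (sg t = 0 \/ (J t = kap * be t /\ 0 < be t)) /\ speed k t = sg t).
    { intros t Ht. pose proof (is_derive_uniq _ _ _ _ (K t Ht) (DG t Ht)) as E0.
      destruct (DG0 t Ht) as (E & K1). rewrite E in E0.
      pose proof (inside_bounds _ _ _ _ _ Hs Ht) as Htb. destruct (HR0 t ltac:(lra)) as (Hr1 & Hr2).
      destruct (HY t Ht) as (Hsg0 & K2). specialize (HJ t ltac:(lra)).
      assert (E1 : sg t * (kap * J t - be t - 2 * om * R0 t) + (Y t + be t * sg t) = 0).
      { apply Rmult_eq_reg_r with (/ (2 * R0 t)); [|apply Rinv_neq_0_compat; lra]. rewrite Rmult_0_l. symmetry; exact E0. }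
      assert (E2 : Y t = - (be t * sg t)) by lra.
      specialize (HYZ t). rewrite E2 in HYZ. specialize (Hbe0 t). specialize (Hsg t Ht). pose proof (speed_nonneg k t) as Hp.
      assert (be t * speed k t <= be t * sg t) by (apply Rmult_le_compat_l; lra).
      assert (0 <= be t * speed k t) by nra.
      assert (Z2 : Z t * Z t <= 0) by nra.
      assert (Z t = 0) by (assert (0 <= Z t * Z t) by nra; apply Rsqr_0_uniq; unfold Rsqr; lra).
      split; [exact E2|]. split; [assumption|].
      assert (E3 : sg t * (kap * J t - be t - 2 * om * R0 t) = 0) by lra.
      apply Rmult_integral in E3. destruct E3 as [E3|E3]; [split; [now left|lra]|].
      assert (HJb : J t = kap * be t) by (apply (timelike_bound kap om (J t) (be t) (R0 t)); auto; lra).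
      assert (0 < be t) by nra. split; [right; auto|].
      rewrite H1 in HYZ.
      assert (Q : (be t * be t) * (sg t * sg t) = (be t * be t) * (speed k t * speed k t)) by lra.
      apply Rmult_eq_reg_l in Q; [|nra]. nra. }
    (* Equality in both Cauchy-Schwarz inequalities determines the control. *)
    assert (Hpq : forall t, inside n ts t ->
      cp k t = - (sg t * kap) * (cb1 k t * cos (ps t) - cb2 k t * sin (ps t)) / J t /\
      cq k t = - (sg t * kap) * (cb2 k t * cos (ps t) + cb1 k t * sin (ps t)) / J t).
    { intros t Ht. destruct (Hz t Ht) as (EY & EZ & [E|(EJ & Eb)] & Esp).
      - rewrite E in *. pose proof (speed_sqr k t) as Hp. rewrite Esp in Hp.
        assert (cp k t = 0) by nra. assert (cq k t = 0) by nra. rewrite H, H0.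
        pose proof (inside_bounds _ _ _ _ _ Hs Ht) as Htb. specialize (HJ t ltac:(lra)). split; field; lra.
      - assert (V1 : U1 t = - (be t * sg t) * cos (ps t)).
        { transitivity (U1 t * (cos (ps t) * cos (ps t) + sin (ps t) * sin (ps t))); [rewrite cos2_sin2; ring|].
          transitivity (Y t * cos (ps t) + Z t * sin (ps t)); [unfold Y, Z; ring|rewrite EY, EZ; ring]. }
        assert (V2 : U2 t = (be t * sg t) * sin (ps t)).
        { transitivity (U2 t * (cos (ps t) * cos (ps t) + sin (ps t) * sin (ps t))); [rewrite cos2_sin2; ring|].
          transitivity (- Y t * sin (ps t) + Z t * cos (ps t)); [unfold Y, Z; ring|rewrite EY, EZ; ring]. }
        split; rewrite EJ; apply Rmult_eq_reg_l with (be t * be t); try nra.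
        + transitivity (cb1 k t * U1 t + cb2 k t * U2 t); [rewrite Hbe; unfold U1, U2; ring|]. rewrite V1, V2. field. lra.
        + transitivity (cb2 k t * U1 t - cb1 k t * U2 t); [rewrite Hbe; unfold U1, U2; ring|]. rewrite V1, V2. field. lra. }
    set (m1 := fun t => (cb1 k t * cos (ps t) + cb2 k t * sin (ps t)) / J t).
    set (m2 := fun t => (cb2 k t * cos (ps t) - cb1 k t * sin (ps t)) / J t).
    assert (Psa : ps a = 0) by (unfold ps; rewrite S0; field).
    assert (HJa : J a = - ca2 k a) by (unfold J; rewrite Psa, sin_0, cos_0; ring).
    assert (Hm : forall t, a <= t <= b -> m1 t = m1 a /\ m2 t = m2 a).
    { assert (Dm : forall t, inside n ts t -> is_derive m1 t 0 /\ is_derive m2 t 0).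
      { intros t Ht. pose proof (Dps t Ht) as Dpst. pose proof (DJ t Ht) as DJt.
        destruct (HD t Ht) as (_ & _ & D3 & D4).
        pose proof (inside_bounds _ _ _ _ _ Hs Ht) as Htb. specialize (HJ t ltac:(lra)).
        destruct (Hpq t Ht) as (Ep & Eq). destruct (Hz t Ht) as (_ & EZ & _ & _). rewrite EZ in DJt.
        pose proof (cos2_sin2 (ps t)) as T.
        assert (Q1 : ca1 k t = f t * cos (ps t) - J t * sin (ps t)).
        { transitivity (ca1 k t * (cos (ps t) * cos (ps t) + sin (ps t) * sin (ps t))); [rewrite T; ring|].
          unfold f, J; fold (ps t). ring. }
        assert (Q2 : ca2 k t = - f t * sin (ps t) - J t * cos (ps t)).
        { transitivity (ca2 k t * (cos (ps t) * cos (ps t) + sin (ps t) * sin (ps t))); [rewrite T; ring|].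
          unfold f, J; fold (ps t). ring. }
        assert (F1 : cos (ps t) * cos (ps t) = 1 - sin (ps t) * sin (ps t)) by lra.
        unfold m1, m2. split.
        - auto_derive; [exder; lra|]. known_derive. rewrite Q1, Q2, Ep, Eq. field_simplify_eq; [|lra].
          ring_simplify.
          replace (cos (ps t) ^ 3) with ((1 - sin (ps t) * sin (ps t)) * cos (ps t)) by (rewrite <- F1; ring).
          replace (cos (ps t) ^ 2) with ((1 - sin (ps t) * sin (ps t))) by (rewrite <- F1; ring). ring.
        - auto_derive; [exder; lra|]. known_derive. rewrite Q1, Q2, Ep, Eq. field_simplify_eq; [|lra].
          ring_simplify.
          replace (cos (ps t) ^ 3) with ((1 - sin (ps t) * sin (ps t)) * cos (ps t)) by (rewrite <- F1; ring).
          replace (cos (ps t) ^ 2) with ((1 - sin (ps t) * sin (ps t))) by (rewrite <- F1; ring). ring. }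
      intros t Ht. split.
      - apply (pw_constant m1 a b n ts Hs); auto; [|intros; apply Dm; auto].
        intros x Hx. specialize (HJ x Hx). unfold m1. cont. lra.
      - apply (pw_constant m2 a b n ts Hs); auto; [|intros; apply Dm; auto].
        intros x Hx. specialize (HJ x Hx). unfold m2. cont. lra. }
    pose proof (HJ a ltac:(lra)) as HJa0. rewrite HJa in HJa0. split; [lra|].
    intros t Ht. pose proof (inside_bounds _ _ _ _ _ Hs Ht) as Htb.
    split; [apply Hz, Ht|].
    destruct (Hm t ltac:(lra)) as (M1 & M2). destruct (Hpq t Ht) as (Ep & Eq). specialize (HJ t ltac:(lra)).
    assert (N1 : m1 a = - (cb1 k a / ca2 k a)) by (unfold m1; rewrite HJa, Psa, sin_0, cos_0; field; lra).
    assert (N2 : m2 a = - (cb2 k a / ca2 k a)) by (unfold m2; rewrite HJa, Psa, sin_0, cos_0; field; lra).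
    pose proof (cos2_sin2 (ps t)) as T.
    assert (Ec : cos (kap * S t) = cos (ps t) * cos (ps t) - sin (ps t) * sin (ps t)).
    { replace (kap * S t) with (2 * ps t) by (unfold ps; field). apply cos_2a. }
    assert (Es : sin (kap * S t) = 2 * sin (ps t) * cos (ps t)).
    { replace (kap * S t) with (2 * ps t) by (unfold ps; field). apply sin_2a. }
    split.
    + replace (cb1 k a / ca2 k a) with (- m1 t) by lra. unfold m1. rewrite Ep, Eq, Ec, Es.
      transitivity (- sg t * kap * ((cb1 k t * cos (ps t) + cb2 k t * sin (ps t)) * (cos (ps t) * cos (ps t) + sin (ps t) * sin (ps t))) / J t).
      * field. lra.
      * rewrite T. field. lra.
    + replace (cb2 k a / ca2 k a) with (- m2 t) by lra. unfold m2. rewrite Ep, Eq, Ec, Es.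
      transitivity (- sg t * kap * ((cb2 k t * cos (ps t) - cb1 k t * sin (ps t)) * (cos (ps t) * cos (ps t) + sin (ps t) * sin (ps t))) / J t).
      * field. lra.
      * rewrite T. field. lra.
Qed.

(** * The bound for curvature greater than 1 *)

(** Left multiplication by the element with entries u1 + i u2 and v1 + i v2. *)
Definition translate (u1 u2 v1 v2 : R) (k : curve) : curve := Curve
  (fun t => u1 * ca1 k t - u2 * ca2 k t + (v1 * cb1 k t + v2 * cb2 k t))
  (fun t => u1 * ca2 k t + u2 * ca1 k t + (v2 * cb1 k t - v1 * cb2 k t))
  (fun t => u1 * cb1 k t - u2 * cb2 k t + (v1 * ca1 k t + v2 * ca2 k t))
  (fun t => u1 * cb2 k t + u2 * cb1 k t + (v2 * ca1 k t - v1 * ca2 k t))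
  (cp k) (cq k).

Lemma horizontal_translate u1 u2 v1 v2 k a b n ts :
  u1 ^ 2 + u2 ^ 2 - (v1 ^ 2 + v2 ^ 2) = 1 -> horizontal k a b n ts ->
  horizontal (translate u1 u2 v1 v2 k) a b n ts.
Proof.
  intros HN (Hs & (C1 & C2 & C3 & C4) & Hk & HP & HD).
  refine (conj Hs (conj (conj _ (conj _ (conj _ _))) (conj _ (conj HP _)))); simpl.
  1-4: cont.
  - intros t. specialize (Hk t).
    transitivity ((u1 ^ 2 + u2 ^ 2 - (v1 ^ 2 + v2 ^ 2)) * (ca1 k t ^ 2 + ca2 k t ^ 2 - (cb1 k t ^ 2 + cb2 k t ^ 2))); [ring|].
    rewrite HN, Hk. ring.
  - intros t Ht. destruct (HD t Ht) as (D1 & D2 & D3 & D4). unfold is_horizontal_at; simpl.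
    refine (conj _ (conj _ (conj _ _))); (auto_derive; [exder|known_derive; field]).
Qed.

Lemma lift_at_unit k a th0 : starts_at_unit k a -> th0 = 0 -> is_lift (ca1 k) (ca2 k) (fun _ => th0) a.
Proof.
  intros (I1 & I2 & _) ->. unfold is_lift. rewrite I1, I2, cos_0, sin_0.
  replace (1 ^ 2 + 0 ^ 2) with 1 by ring. rewrite sqrt_1. split; ring.
Qed.

(** The candidate has phase om T < pi in the turning frame. The left translation
    by (u, v) moves its midpoint normal to the vector N of [lower_bound_timelike], so that it
    runs from asin f = - om T / 2 to om T / 2. If A has turned further than on the candidate,
    the frame is turned on by the surplus tst - T, which makes the endpoints agree and only
    adds proper time. *)
Lemma lower_bound_elliptic (k : curve) (a b : R) n ts (al S : R -> R)
  (s c kap om T Th be : R) :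
  horizontal k a b n ts -> starts_at_unit k a ->
  lift_of k a b n ts al -> al a = 0 ->
  primitive a n ts (speed k) S ->
  0 < c ->
  cb1 k b = s * cos be -> cb2 k b = s * sin be -> c * c = ca1 k b ^ 2 + ca2 k b ^ 2 ->
  1 < kap -> 0 < om -> 4 * (om * om) = kap * kap - 1 ->
  0 < T -> om * T < PI -> sin (om * T) = 2 * om * s ->
  0 <= Th < PI -> cos (om * T) = c * cos Th -> kap * s = c * sin Th ->
  al b <= Th - kap * T / 2 ->
  T <= S b /\
  (S b <= T -> has_rotating_control k n ts S kap (be - kap * T / 2)).
Proof.
  intros Hh HI Hl Ia HS Hc Hb1 Hb2 Hcc Hk Hom Hok HT HomT Hsin HTh Hcos Hks Hal.
  pose proof HI as (I1 & I2 & I3 & I4).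
  pose proof Hl as (Cal & Lal & _). pose proof HS as (CS & S0 & DS).
  pose proof Hh as (Hs & (C1 & C2 & C3 & C4) & HN & (P1 & P2) & HD).
  pose proof (subdivision_lt _ _ _ _ Hs) as Hab. pose proof PI_RGT_0 as HPI.
  enough (Key : S b <= T -> S b = T /\ has_rotating_control k n ts S kap (be - kap * T / 2)).
  { split; [|intros; apply Key; auto]. destruct (Rle_dec (S b) T); [|lra]. destruct Key; lra. }
  intros HST.
  (* the length after which the turning frame brings A to the argument Th *)
  set (tst := 2 * (Th - al b) / kap).
  assert (Htst : kap * tst / 2 = Th - al b) by (unfold tst; field; lra).
  assert (HtT : T <= tst).
  { apply Rmult_le_reg_l with (kap / 2); lra. }
  set (ex := (tst - S b) / (b - a)).
  assert (Hex : 0 <= ex) by (apply Rle_mult_inv_pos; lra).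
  set (sg := fun t => speed k t + ex). set (Sh := fun t => S t + ex * (t - a)).
  assert (HSh : primitive a n ts sg Sh).
  { unfold sg, Sh. refine (conj _ (conj _ _)).
    - cont.
    - rewrite S0. ring.
    - intros t Ht. pose proof (DS t Ht). auto_derive; [exder|]. known_derive. ring. }
  assert (HShb : Sh b = tst) by (unfold Sh, ex; field; lra).
  set (mu := be - kap * tst / 2). set (h := om * T / 2).
  assert (Hh0 : 0 < h < PI / 2) by (unfold h; nra).
  assert (Hsh : 0 < sin h) by (apply sin_gt_0; lra).
  assert (Hch : 0 < cos h) by (apply cos_gt_0; lra).
  pose proof (cos2_sin2 h) as Th1.
  set (u1 := - sin h). set (u2 := - (kap / (2 * om) * cos h)).
  set (v1 := - (cos mu / (2 * om) * cos h)). set (v2 := - (sin mu / (2 * om) * cos h)).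
  assert (Hu2 : u2 < 0).
  { unfold u2. enough (0 < kap / (2 * om) * cos h) by lra. apply Rmult_lt_0_compat; auto. apply Rdiv_lt_0_compat; lra. }
  assert (Hnorm : u1 ^ 2 + u2 ^ 2 - (v1 ^ 2 + v2 ^ 2) = 1).
  { unfold u1, u2, v1, v2. pose proof (cos2_sin2 mu) as Tm.
    transitivity (sin h * sin h + (kap * kap - (cos mu * cos mu + sin mu * sin mu)) / (4 * (om * om)) * (cos h * cos h)); [field; lra|].
    rewrite Tm, <- Hok, <- Th1. field. lra. }
  set (k' := translate u1 u2 v1 v2 k).
  assert (Hh' : horizontal k' a b n ts) by (apply horizontal_translate; auto).
  assert (S1 : ca1 k' a = u1) by (simpl; rewrite I1, I2, I3, I4; ring).
  assert (S2 : ca2 k' a = u2) by (simpl; rewrite I1, I2, I3, I4; ring).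
  assert (S3 : cb1 k' a = v1) by (simpl; rewrite I1, I2, I3, I4; ring).
  assert (S4 : cb2 k' a = v2) by (simpl; rewrite I1, I2, I3, I4; ring).
  (* The translated curve starts with argument nu; its sign and size place the start
     and the end on the sheet required by lower_bound_timelike. *)
  set (ga := atan (u1 / u2)).
  assert (Hga : 0 <= ga < PI / 2).
  { split; [|apply atan_bound]. unfold ga. rewrite <- atan_0. destruct (Req_dec (u1 / u2) 0) as [->|]; [lra|].
    left. apply atan_increasing. replace (u1 / u2) with ((- u1) / (- u2)) by (field; lra).
    apply Rdiv_lt_0_compat; unfold u1 in *; lra. }
  set (nu := - (PI / 2) - ga).
  assert (Lnu : is_lift (ca1 k') (ca2 k') (fun _ => nu) a).
  { unfold is_lift. rewrite S1, S2. set (r := sqrt (u1 ^ 2 + u2 ^ 2)).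
    assert (Hr : 0 < r) by (apply sqrt_lt_R0; nra).
    assert (Hr2 : r * r = u1 ^ 2 + u2 ^ 2) by (apply sqrt_sqrt; nra).
    destruct (atan_polar (- u2) (- u1) ltac:(lra)) as (G1 & G2).
    replace (- u1 / - u2) with (u1 / u2) in G1, G2 by (field; lra).
    replace ((- u2) ^ 2 + (- u1) ^ 2) with (u1 ^ 2 + u2 ^ 2) in G1, G2 by ring. fold r ga in G1, G2.
    unfold nu. replace (- (PI / 2) - ga) with (- (PI / 2 + ga)) by ring.
    rewrite cos_neg, sin_neg. replace (PI / 2 + ga) with (PI / 2 - (- ga)) by ring.
    rewrite cos_shift, sin_shift, sin_neg, cos_neg. split; lra. }
  destruct (lift_of_exists k' a b n ts nu Hh' Lnu) as (al' & Hl' & Ia').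
  pose proof Hl' as (Cal' & Lal' & _).
  assert (Hclose : forall t, a <= t <= b -> - (PI / 2) < al' t - al t - nu < PI / 2).
  { apply (stays_close (fun t => al' t - al t - nu)); [cont| |rewrite Ia', Ia; lra].
    intros t Ht. destruct (Lal' t Ht) as (E1 & E2). destruct (Lal t Ht) as (E3 & E4).
    destruct Lnu as (E5 & E6). rewrite S1, S2 in E5, E6. specialize (HN t). pose proof Hh' as (_ & _ & HN' & _). specialize (HN' t).
    set (r1 := sqrt (ca1 k' t ^ 2 + ca2 k' t ^ 2)) in *. set (r2 := sqrt (ca1 k t ^ 2 + ca2 k t ^ 2)) in *.
    set (r3 := sqrt (u1 ^ 2 + u2 ^ 2)) in *.
    assert (0 < r1) by (apply sqrt_lt_R0; nra).
    assert (0 < r2) by (apply sqrt_lt_R0; nra).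
    assert (0 < r3) by (apply sqrt_lt_R0; nra).
    replace (al' t - al t - nu) with (al' t - (al t + nu)) by ring.
    rewrite cos_minus, cos_plus, sin_plus.
    assert (Q : 0 < ca1 k' t * (u1 * ca1 k t - u2 * ca2 k t) + ca2 k' t * (u1 * ca2 k t + u2 * ca1 k t)).
    { simpl. set (x1 := u1 * ca1 k t - u2 * ca2 k t). set (x2 := u1 * ca2 k t + u2 * ca1 k t).
      set (y1 := v1 * cb1 k t + v2 * cb2 k t). set (y2 := v2 * cb1 k t - v1 * cb2 k t).
      assert (X : x1 ^ 2 + x2 ^ 2 = (u1 ^ 2 + u2 ^ 2) * (ca1 k t ^ 2 + ca2 k t ^ 2)) by (unfold x1, x2; ring).
      assert (Yy : y1 ^ 2 + y2 ^ 2 = (v1 ^ 2 + v2 ^ 2) * (cb1 k t ^ 2 + cb2 k t ^ 2)) by (unfold y1, y2; ring).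
      assert (Lt : y1 ^ 2 + y2 ^ 2 < x1 ^ 2 + x2 ^ 2).
      { rewrite X, Yy. assert (0 <= v1 ^ 2 + v2 ^ 2) by nra. assert (0 <= cb1 k t ^ 2 + cb2 k t ^ 2) by nra. nra. }
      assert (0 < (x1 + y1) * x1 + (x2 + y2) * x2); [|lra].
      assert ((x1 - - y1) ^ 2 + (x2 - - y2) ^ 2 + x1 ^ 2 + x2 ^ 2 - (y1 ^ 2 + y2 ^ 2) = 2 * ((x1 + y1) * x1 + (x2 + y2) * x2)) by ring.
      assert (0 <= (x1 - - y1) ^ 2) by apply pow2_ge_0. assert (0 <= (x2 - - y2) ^ 2) by apply pow2_ge_0. lra. }
    rewrite E1, E2, E3, E4, E5, E6 in Q.
    apply Rmult_lt_reg_l with (r1 * (r2 * r3)); [apply Rmult_lt_0_compat; [lra|apply Rmult_lt_0_compat; lra]|].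
    rewrite Rmult_0_r. eapply Rlt_le_trans; [exact Q|]. right. ring. }
  assert (Hbb : a <= b <= b) by lra.
  destruct (Lal b Hbb) as (A1 & A2).
  replace (sqrt (ca1 k b ^ 2 + ca2 k b ^ 2)) with c in A1, A2
    by (rewrite <- Hcc; symmetry; apply sqrt_square; lra).
  (* In the frame turning at rate kap, A and B end at cos (om T) + i kap s and s exp (i mu),
     the endpoint of the candidate. *)
  set (ps := kap * Sh b / 2).
  assert (Hps : ps = Th - al b) by (unfold ps; rewrite HShb; exact Htst).
  assert (X1 : ca1 k b * cos ps - ca2 k b * sin ps = cos (om * T)).
  { rewrite A1, A2, Hcos. replace Th with (al b + ps) by lra. rewrite cos_plus. ring. }
  assert (X2 : ca1 k b * sin ps + ca2 k b * cos ps = kap * s).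
  { rewrite A1, A2, Hks. replace Th with (al b + ps) by lra. rewrite sin_plus. ring. }
  assert (Y1 : cb1 k b * cos ps + cb2 k b * sin ps = s * cos mu).
  { unfold mu. rewrite Htst, <- Hps, Hb1, Hb2, cos_minus. ring. }
  assert (Y2 : cb2 k b * cos ps - cb1 k b * sin ps = s * sin mu).
  { unfold mu. rewrite Htst, <- Hps, Hb1, Hb2, sin_minus. ring. }
  assert (Hs2 : s = sin h * cos h / om).
  { apply Rmult_eq_reg_l with (2 * om); [|lra]. rewrite <- Hsin. replace (om * T) with (2 * h) by (unfold h; field).
    rewrite sin_2a. field. lra. }
  assert (Hc2 : cos (om * T) = cos h * cos h - sin h * sin h).
  { replace (om * T) with (2 * h) by (unfold h; field). apply cos_2a. }
  assert (F1 : ca1 k' b * cos ps - ca2 k' b * sin ps = sin h).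
  { transitivity (u1 * (ca1 k b * cos ps - ca2 k b * sin ps) - u2 * (ca1 k b * sin ps + ca2 k b * cos ps)
      + (v1 * (cb1 k b * cos ps + cb2 k b * sin ps) + v2 * (cb2 k b * cos ps - cb1 k b * sin ps))); [simpl; ring|].
    rewrite X1, X2, Y1, Y2. unfold u1, u2, v1, v2. rewrite Hs2, Hc2.
    transitivity (sin h * ((kap * kap - (cos mu * cos mu + sin mu * sin mu)) / (2 * (om * om)) * (cos h * cos h) - cos h * cos h + sin h * sin h)); [field; lra|].
    rewrite cos2_sin2, <- Hok. transitivity (sin h * (cos h * cos h + sin h * sin h)); [field; lra|rewrite Th1; ring]. }
  assert (F2 : ca1 k' b * sin ps + ca2 k' b * cos ps = - (kap / (2 * om) * cos h)).
  { transitivity (u2 * (ca1 k b * cos ps - ca2 k b * sin ps) + u1 * (ca1 k b * sin ps + ca2 k b * cos ps)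
      + (v2 * (cb1 k b * cos ps + cb2 k b * sin ps) - v1 * (cb2 k b * cos ps - cb1 k b * sin ps))); [simpl; ring|].
    rewrite X1, X2, Y1, Y2. unfold u1, u2, v1, v2. rewrite Hs2, Hc2.
    transitivity (- (kap / (2 * om) * cos h) * (cos h * cos h + sin h * sin h)); [field; lra|rewrite Th1; ring]. }
  assert (Hend : al' b + kap * Sh b / 2 < 0).
  { fold ps. apply Rnot_le_lt. intros K.
    destruct (Lal' b Hbb) as (E1 & E2). pose proof Hh' as (_ & _ & HN' & _). specialize (HN' b).
    set (r1 := sqrt (ca1 k' b ^ 2 + ca2 k' b ^ 2)) in *.
    assert (0 < r1) by (apply sqrt_lt_R0; nra).
    assert (E : r1 * sin (al' b + ps) < 0).
    { fold u2 in F2. replace (r1 * sin (al' b + ps))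
        with ((r1 * cos (al' b)) * sin ps + (r1 * sin (al' b)) * cos ps) by (rewrite sin_plus; ring).
      rewrite <- E1, <- E2. lra. }
    specialize (Hclose b Hbb).
    assert (0 <= sin (al' b + ps)); [|nra].
    apply sin_ge_0; [lra|]. rewrite Hps. unfold nu in Hclose. lra. }
  destruct (lower_bound_timelike k' a b n ts al' Sh sg kap om Hh' Hl' Hk Hom Hok HSh) as (K1 & K2).
  - intros t Ht. unfold sg. change (speed k' t) with (speed k t). lra.
  - rewrite Ia'. unfold nu. lra.
  - exact Hend.
  - replace (Sh a) with 0 by (symmetry; apply HSh). replace (kap * 0 / 2) with 0 by field.
    rewrite cos_0, sin_0, S1, S2. unfold u1. pose proof (sin_lt_x h).
    assert (sin h < 1); [|lra]. rewrite <- sin_PI2. apply sin_increasing_1; lra.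
  - fold ps. rewrite F1. rewrite <- sin_PI2. apply sin_increasing_1; lra.
  - fold ps in K1, K2. rewrite F1 in K1, K2. replace (Sh a) with 0 in K1, K2 by (symmetry; apply HSh).
    replace (kap * 0 / 2) with 0 in K1, K2 by field. rewrite cos_0, sin_0, S1, S2 in K1, K2.
    replace (u1 * 1 - u2 * 0) with (- sin h) in K1, K2 by (unfold u1; ring).
    rewrite asin_opp, asin_sin, HShb in K1, K2 by lra.
    assert (HtT' : tst <= T) by (apply Rmult_le_reg_l with om; unfold h in *; lra).
    destruct K2 as (_ & K2). { unfold h. nra. }
    assert (Htt : tst = T) by lra.
    assert (Hex0 : ex = 0).
    { destruct Hs as (Ha & Hb & Hss). specialize (Hss 0%nat ltac:(lia)).
      destruct (K2 ((ts 0%nat + ts 1%nat) / 2)) as (K3 & _).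
      - exists 0%nat. split; [lia|lra].
      - unfold sg in K3. change (speed k' ?t) with (speed k t) in K3. lra. }
    split.
    + unfold Sh in HShb. rewrite Hex0 in HShb. lra.
    + intros t Ht. destruct (K2 t Ht) as (_ & K3 & K4). rewrite S3 in K3. rewrite S4 in K4.
      unfold Sh, sg in K3, K4. rewrite Hex0 in K3, K4.
      replace (S t + 0 * (t - a)) with (S t) in K3, K4 by ring. rewrite Rplus_0_r in K3, K4.
      change (cp k' t) with (cp k t) in *. change (cq k' t) with (cq k t) in *.
      replace (speed k t * kap * (v1 / u2)) with (speed k t * cos mu) in K3 by (unfold v1, u2; field; lra).
      replace (speed k t * kap * (v2 / u2)) with (speed k t * sin mu) in K4 by (unfold v2, u2; field; lra).
      rewrite <- Htt. fold mu. rewrite cos_plus, sin_plus. pose proof (cos2_sin2 (kap * S t)) as T2.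
      split.
      * transitivity (cp k t * (cos (kap * S t) * cos (kap * S t) + sin (kap * S t) * sin (kap * S t))); [rewrite T2; ring|].
        transitivity ((speed k t * cos mu) * cos (kap * S t) - (speed k t * sin mu) * sin (kap * S t)); [rewrite <- K3, <- K4; ring|ring].
      * transitivity (cq k t * (cos (kap * S t) * cos (kap * S t) + sin (kap * S t) * sin (kap * S t))); [rewrite T2; ring|].
        transitivity ((speed k t * cos mu) * sin (kap * S t) + (speed k t * sin mu) * cos (kap * S t)); [rewrite <- K3, <- K4; ring|ring].
Qed.

(** The case B = 0 at the end, where the slice can be taken symmetric with respect to the
    origin. *)
Lemma lower_bound_closed (k : curve) (a b : R) n ts (al S : R -> R) (kap om : R) :
  horizontal k a b n ts -> starts_at_unit k a ->
  lift_of k a b n ts al -> al a = 0 -> primitive a n ts (speed k) S ->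
  ca1 k b ^ 2 + ca2 k b ^ 2 = 1 ->
  1 < kap -> 0 < om -> 4 * (om * om) = kap * kap - 1 ->
  al b + kap * S b / 2 < PI -> om * S b <= al b + kap * S b / 2.
Proof.
  intros Hh HI Hl Ia HS Hend Hk Hom Hok Hphi.
  pose proof HI as (I1 & I2 & I3 & I4).
  pose proof (increasing_angle k a b n ts al S (speed k) kap Hh Hl Hk HS ltac:(intros; lra)) as Hinc.
  pose proof Hl as (Cal & Lal & Dal). pose proof HS as (CS & S0 & DS).
  pose proof Hh as (Hs & (C1 & C2 & C3 & C4) & HN & (P1 & P2) & HD).
  pose proof (subdivision_lt _ _ _ _ Hs) as Hab. pose proof PI_RGT_0 as HPI.
  set (phi := al b + kap * S b / 2) in *.
  assert (Hphi0 : 0 <= phi).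
  { specialize (Hinc a b). rewrite Ia, S0 in Hinc. unfold phi. lra. }
  set (h := phi / 2). set (nu := - (PI / 2) - h).
  assert (Hcn : cos nu = - sin h).
  { unfold nu. replace (- (PI / 2) - h) with (- (PI / 2 - (- h))) by ring. rewrite cos_neg, cos_shift. apply sin_neg. }
  assert (Hsn : sin nu = - cos h).
  { unfold nu. replace (- (PI / 2) - h) with (- (PI / 2 - (- h))) by ring. rewrite sin_neg, sin_shift, cos_neg. reflexivity. }
  set (k' := translate (cos nu) (sin nu) 0 0 k).
  assert (Hh' : horizontal k' a b n ts).
  { apply horizontal_translate; auto. pose proof (cos2_sin2 nu). lra. }
  assert (Hn' : forall t, ca1 k' t ^ 2 + ca2 k' t ^ 2 = ca1 k t ^ 2 + ca2 k t ^ 2).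
  { intros t. simpl. transitivity ((cos nu * cos nu + sin nu * sin nu) * (ca1 k t ^ 2 + ca2 k t ^ 2)); [ring|rewrite cos2_sin2; ring]. }
  assert (Hl' : lift_of k' a b n ts (fun t => al t + nu)).
  { refine (conj _ (conj _ _)).
    - cont.
    - intros t Ht. unfold is_lift. rewrite Hn'. destruct (Lal t Ht) as (E1 & E2).
      set (r := sqrt (ca1 k t ^ 2 + ca2 k t ^ 2)) in *. rewrite cos_plus, sin_plus. simpl. rewrite E1, E2. split; ring.
    - intros t Ht. pose proof (Dal t Ht) as Dalt. rewrite Hn'. auto_derive; [exder|]. known_derive.
      specialize (HN t). simpl.
      transitivity ((cos nu * cos nu + sin nu * sin nu) * ((ca1 k t * ((cb2 k t * cp k t - cb1 k t * cq k t) / 2) -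
       ca2 k t * ((cb1 k t * cp k t + cb2 k t * cq k t) / 2)) / (ca1 k t ^ 2 + ca2 k t ^ 2))); [rewrite cos2_sin2; field; nra|].
      field. nra. }
  assert (Hbb : a <= b <= b) by lra.
  destruct (Lal b Hbb) as (A1 & A2). rewrite Hend, sqrt_1, Rmult_1_l in A1, A2.
  assert (F1 : ca1 k' b * cos (kap * S b / 2) - ca2 k' b * sin (kap * S b / 2) = sin h).
  { transitivity (cos (nu + (al b + kap * S b / 2))).
    - rewrite !cos_plus, sin_plus. simpl. rewrite <- A1, <- A2. ring.
    - fold phi. unfold nu, h. replace (- (PI / 2) - phi / 2 + phi) with (- (PI / 2 - phi / 2)) by field.
      rewrite cos_neg. apply cos_shift. }
  assert (Hsin : 0 <= sin h < 1).
  { split; [apply sin_ge_0; unfold h; lra|]. rewrite <- sin_PI2. apply sin_increasing_1; unfold h; lra. }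
  destruct (lower_bound_timelike k' a b n ts (fun t => al t + nu) S (speed k) kap om Hh' Hl' Hk Hom Hok HS) as (K1 & _).
  - intros; apply Rle_refl.
  - rewrite Ia. unfold nu, h. lra.
  - unfold nu, h, phi in *. lra.
  - rewrite S0. replace (kap * 0 / 2) with 0 by field. rewrite cos_0, sin_0. simpl. rewrite I1, I2, I3, I4, Hcn. lra.
  - rewrite F1. lra.
  - rewrite F1, S0 in K1. replace (kap * 0 / 2) with 0 in K1 by field. rewrite cos_0, sin_0 in K1. simpl in K1.
    rewrite I1, I2, I3, I4, Hcn in K1.
    replace ((- sin h * 1 - sin nu * 0 + (0 * 0 + 0 * 0)) * 1 - (- sin h * 0 + sin nu * 1 + (0 * 0 - 0 * 0)) * 0)
      with (- sin h) in K1 by ring.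
    rewrite asin_opp, asin_sin in K1 by (unfold h; lra). unfold h in K1. lra.
Qed.

(** * Lower bounds for the length *)

(** [gcos m] and [gsin m] solve y'' = - m y with the initial data of cos and sin. *)
Definition gcos (m t : R) : R := if Rlt_dec 0 m then cos (sqrt m * t) else cosh (sqrt (- m) * t).
Definition gsin (m t : R) : R :=
  if Rlt_dec 0 m then sin (sqrt m * t) / sqrt m
  else if Rlt_dec m 0 then sinh (sqrt (- m) * t) / sqrt (- m) else t.

Lemma cosh2_sinh2 x : cosh x * cosh x - sinh x * sinh x = 1.
Proof.
  unfold cosh, sinh. transitivity (exp x * exp (- x)); [field|]. rewrite <- exp_plus, Rplus_opp_r. apply exp_0.
Qed.
Lemma cosh_at_0 : cosh 0 = 1. Proof. unfold cosh. rewrite Ropp_0, exp_0. field. Qed.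
Lemma sinh_at_0 : sinh 0 = 0. Proof. unfold sinh. rewrite Ropp_0, exp_0. field. Qed.
Lemma cosh_pos x : 0 < cosh x.
Proof. unfold cosh. pose proof (exp_pos x). pose proof (exp_pos (- x)). lra. Qed.

Lemma gcos_gsin m t : gcos m t * gcos m t + m * (gsin m t * gsin m t) = 1.
Proof.
  unfold gcos, gsin. destruct Rlt_dec as [H|H]; [|destruct Rlt_dec as [H0|H0]].
  - assert (Hr : 0 < sqrt m) by (now apply sqrt_lt_R0).
    assert (E : m = sqrt m * sqrt m) by (rewrite sqrt_sqrt; lra).
    rewrite <- (cos2_sin2 (sqrt m * t)). set (r := sqrt m) in *. clearbody r. rewrite E. field. lra.
  - assert (Hr : 0 < sqrt (- m)) by (apply sqrt_lt_R0; lra).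
    assert (E : m = - (sqrt (- m) * sqrt (- m))) by (rewrite sqrt_sqrt; lra).
    rewrite <- (cosh2_sinh2 (sqrt (- m) * t)). set (r := sqrt (- m)) in *. clearbody r. rewrite E. field. lra.
  - replace m with 0 by lra. rewrite Ropp_0, sqrt_0, Rmult_0_l, cosh_at_0. ring.
Qed.

Lemma is_derive_gsin m t : is_derive (gsin m) t (gcos m t).
Proof.
  unfold gcos, gsin. destruct Rlt_dec as [H|H]; [|destruct Rlt_dec as [H0|H0]].
  - assert (0 < sqrt m) by (now apply sqrt_lt_R0). auto_derive; [lra|]. field. lra.
  - assert (0 < sqrt (- m)) by (apply sqrt_lt_R0; lra). auto_derive; [lra|]. field. lra.
  - replace m with 0 by lra. rewrite Ropp_0, sqrt_0, Rmult_0_l, cosh_at_0. auto_derive; auto.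
Qed.

Lemma is_derive_gcos m t : is_derive (gcos m) t (- m * gsin m t).
Proof.
  unfold gcos, gsin. destruct Rlt_dec as [H|H]; [|destruct Rlt_dec as [H0|H0]].
  - assert (Hr : 0 < sqrt m) by (now apply sqrt_lt_R0).
    assert (E : m = sqrt m * sqrt m) by (rewrite sqrt_sqrt; lra).
    set (r := sqrt m) in *. clearbody r. rewrite E. auto_derive; [auto|]. field. lra.
  - assert (Hr : 0 < sqrt (- m)) by (apply sqrt_lt_R0; lra).
    assert (E : m = - (sqrt (- m) * sqrt (- m))) by (rewrite sqrt_sqrt; lra).
    set (r := sqrt (- m)) in *. clearbody r. rewrite E. auto_derive; [auto|]. field. lra.
  - replace m with 0 by lra. rewrite Ropp_0, sqrt_0. auto_derive; auto. ring.
Qed.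

Lemma continuous_gcos m t : continuous (gcos m) t.
Proof. apply (is_derive_continuous _ _ _ (is_derive_gcos m t)). Qed.
Lemma continuous_gsin m t : continuous (gsin m) t.
Proof. apply (is_derive_continuous _ _ _ (is_derive_gsin m t)). Qed.
Lemma gcos_0 m : gcos m 0 = 1.
Proof. unfold gcos. destruct Rlt_dec; rewrite Rmult_0_r; [apply cos_0|apply cosh_at_0]. Qed.
Lemma gsin_0 m : gsin m 0 = 0.
Proof. unfold gsin. destruct Rlt_dec; [|destruct Rlt_dec]; rewrite ?Rmult_0_r, ?sin_0, ?sinh_at_0; auto; unfold Rdiv; apply Rmult_0_l. Qed.

(** The determinant of the generator of the geodesics of curvature kap in the turning frame. *)
Definition gen_det (kap : R) : R := (kap * kap - 1) / 4.

(** The geodesic of curvature kap and length T ends with |B| = s, with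
    A = exp (- i kap T / 2) (C + i kap s) and C = gcos (gen_det kap) T. The angle Th is the
    argument of the last factor, so - P is the argument of A. The last condition excludes
    geodesics that have returned to B = 0. *)
Definition geodesic_data (s P kap T Th : R) : Prop :=
  0 <= kap /\ 0 < T /\ 0 <= Th < PI /\
  gsin (gen_det kap) T = 2 * s /\
  gcos (gen_det kap) T = sqrt (1 + s ^ 2) * cos Th /\
  kap * s = sqrt (1 + s ^ 2) * sin Th /\
  kap * T / 2 - Th = P /\
  (1 < kap -> sqrt (gen_det kap) * T < PI).

Lemma lower_bound_lift (k : curve) (a b : R) n ts (al S : R -> R) (s be P kap T Th : R) :
  horizontal k a b n ts -> starts_at_unit k a ->
  lift_of k a b n ts al -> al a = 0 ->
  primitive a n ts (speed k) S ->
  cb1 k b = s * cos be -> cb2 k b = s * sin be ->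
  geodesic_data s P kap T Th -> al b <= - P ->
  T <= S b /\
  (S b <= T -> has_rotating_control k n ts S kap (be - kap * T / 2)).
Proof.
  intros Hh HI Hl Ia HS Hb1 Hb2 (Hk & HT & HTh & Hsm & Hcm & Hks & HP & Hlt) Hal.
  pose proof Hh as (_ & _ & HN & _). specialize (HN b).
  assert (Hc : 0 < sqrt (1 + s ^ 2)) by (apply sqrt_lt_R0; nra).
  assert (Hcc : sqrt (1 + s ^ 2) * sqrt (1 + s ^ 2) = ca1 k b ^ 2 + ca2 k b ^ 2).
  { rewrite sqrt_sqrt by nra. rewrite Hb1, Hb2 in HN.
    transitivity (1 + s ^ 2 * (cos be * cos be + sin be * sin be)); [rewrite cos2_sin2; ring|lra]. }
  set (c := sqrt (1 + s ^ 2)) in *.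
  destruct (Rlt_dec 1 kap) as [K|K].
  - assert (Hm : 0 < gen_det kap) by (unfold gen_det; nra).
    assert (Hsq : 0 < sqrt (gen_det kap)) by (now apply sqrt_lt_R0).
    assert (Hsq2 : sqrt (gen_det kap) * sqrt (gen_det kap) = gen_det kap) by (apply sqrt_sqrt; lra).
    unfold gcos in Hcm. unfold gsin in Hsm. destruct (Rlt_dec 0 (gen_det kap)); [|lra].
    apply (lower_bound_elliptic k a b n ts al S s c kap (sqrt (gen_det kap)) T Th be); auto; try lra.
    + rewrite Hsq2. unfold gen_det. field.
    + transitivity ((sin (sqrt (gen_det kap) * T) / sqrt (gen_det kap)) * sqrt (gen_det kap)); [field; lra|rewrite Hsm; ring].
  - assert (Hm : ~ 0 < gen_det kap) by (unfold gen_det; nra).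
    unfold gcos in Hcm. unfold gsin in Hsm. destruct (Rlt_dec 0 (gen_det kap)); [lra|].
    assert (Hnu : sin (asin kap) = kap) by (apply sin_asin; lra).
    assert (Hcn : cos (asin kap) = 2 * sqrt (- gen_det kap)).
    { rewrite cos_asin by lra. replace (1 - kap²) with (2 * 2 * (- gen_det kap)) by (unfold gen_det, Rsqr; field).
      rewrite sqrt_mult, sqrt_square by lra. reflexivity. }
    apply (lower_bound_null k a b n ts al S s c (c * cos Th) kap (asin kap) T Th be); auto; try lra.
    + rewrite <- Hcm. apply cosh_pos.
    + rewrite <- Hcm, Hcn. replace (2 * sqrt (- gen_det kap) / 2 * T) with (sqrt (- gen_det kap) * T) by field.
      replace (2 * sqrt (- gen_det kap) * s) with (sqrt (- gen_det kap) * (2 * s)) by ring. rewrite <- Hsm.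
      destruct (Rlt_dec (gen_det kap) 0).
      * assert (0 < sqrt (- gen_det kap)) by (apply sqrt_lt_R0; lra). unfold cosh, sinh. field. lra.
      * replace (gen_det kap) with 0 by lra. rewrite Ropp_0, sqrt_0, !Rmult_0_l, cosh_at_0, exp_0. ring.
Qed.

Definition conjugate (k : curve) : curve := Curve (ca1 k) (fun t => - ca2 k t) (cb1 k) (fun t => - cb2 k t)
  (cp k) (fun t => - cq k t).

Lemma horizontal_conjugate k a b n ts : horizontal k a b n ts -> horizontal (conjugate k) a b n ts.
Proof.
  intros (Hs & (C1 & C2 & C3 & C4) & Hk & (HP & HQ) & HD).
  refine (conj Hs (conj (conj _ (conj _ (conj _ _))) (conj _ (conj (conj HP _) _)))); simpl.
  1-4: cont.
  - intros t. specialize (Hk t). lra.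
  - apply (pw_continuous_ext n ts (fun t => (-1) * cq k t)); [intros; ring|]. apply pw_continuous_mult; auto. apply pw_continuous_of_continuous; cont.
  - intros t Ht. destruct (HD t Ht) as (D1 & D2 & D3 & D4). unfold is_horizontal_at; simpl.
    refine (conj _ (conj _ (conj _ _))).
    + eapply is_derive_eq; [exact D1|field].
    + auto_derive; [exder|known_derive; field].
    + eapply is_derive_eq; [exact D3|field].
    + auto_derive; [exder|known_derive; field].
Qed.

Lemma speed_conjugate k t : speed (conjugate k) t = speed k t.
Proof. unfold speed. simpl. f_equal. ring. Qed.

Lemma lift_of_conjugate k a b n ts al : horizontal k a b n ts -> lift_of k a b n ts al ->
  lift_of (conjugate k) a b n ts (fun t => - al t).
Proof.
  intros Hh (Cal & Lal & Dal). refine (conj _ (conj _ _)).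
  - cont.
  - intros t Ht. destruct (Lal t Ht) as (E1 & E2). unfold is_lift. simpl ca1. simpl ca2.
    replace (ca1 k t ^ 2 + (- ca2 k t) ^ 2) with (ca1 k t ^ 2 + ca2 k t ^ 2) by ring.
    rewrite cos_neg, sin_neg. split; [exact E1|]. rewrite E2 at 1. ring.
  - intros t Ht. pose proof (Dal t Ht) as Dalt. auto_derive; [exder|]. known_derive. simpl. field.
    destruct Hh as (_ & _ & HN' & _). specialize (HN' t). nra.
Qed.

(** The endpoint determines only the cosine of the accumulated angle x; any such x has turned
    at least as far as P, in one direction or the other. *)
Lemma abs_ge_of_cos x P : - PI <= P <= PI -> cos x = cos P -> P <= x \/ x <= - P.
Proof.
  intros HP E. destruct (Rle_dec P x); [now left|]. destruct (Rle_dec x (- P)); [now right|]. exfalso.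
  destruct (Rle_dec 0 x).
  - pose proof (cos_decreasing_1 x P). lra.
  - pose proof (cos_decreasing_1 (- x) P). rewrite cos_neg in H. lra.
Qed.

Lemma primitive_ext a n ts F G S : (forall t, F t = G t) -> primitive a n ts F S -> primitive a n ts G S.
Proof. intros E (H1 & H2 & H3). refine (conj H1 (conj H2 _)). intros; rewrite <- E; auto. Qed.

(** The sign of kap' tells whether the curve or its mirror image [conjugate] is compared with
    the candidate. *)
Lemma lower_bound (k : curve) (a b : R) n ts (S : R -> R) (s be P kap T Th : R) :
  horizontal k a b n ts -> starts_at_unit k a ->
  primitive a n ts (speed k) S ->
  - PI <= P <= PI -> ca1 k b = sqrt (1 + s ^ 2) * cos P ->
  cb1 k b = s * cos be -> cb2 k b = s * sin be ->
  geodesic_data s P kap T Th ->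
  T <= S b /\
  (S b <= T -> exists kap', (kap' = kap \/ kap' = - kap) /\ has_rotating_control k n ts S kap' (be - kap' * T / 2)).
Proof.
  intros Hh HI HS HP Ha Hb1 Hb2 HG.
  pose proof Hh as (Hs & _ & HN & _ & _). specialize (HN b).
  pose proof (subdivision_lt _ _ _ _ Hs) as Hab.
  destruct (lift_of_exists k a b n ts 0 Hh (lift_at_unit k a 0 HI eq_refl)) as (al & Hl & Ia).
  assert (Hc : 0 < sqrt (1 + s ^ 2)) by (apply sqrt_lt_R0; nra).
  assert (Hcos : cos (al b) = cos P).
  { destruct Hl as (_ & L & _). destruct (L b ltac:(lra)) as (E1 & _).
    replace (ca1 k b ^ 2 + ca2 k b ^ 2) with (1 + s ^ 2) in E1.
    - rewrite Ha in E1. apply Rmult_eq_reg_l in E1; lra.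
    - rewrite Hb1, Hb2 in HN. transitivity (1 + s ^ 2 * (cos be * cos be + sin be * sin be)); [rewrite cos2_sin2; ring|lra]. }
  destruct (abs_ge_of_cos _ _ HP Hcos) as [K|K].
  - destruct (lower_bound_lift (conjugate k) a b n ts (fun t => - al t) S s (- be) P kap T Th) as (L1 & L2); auto.
    + apply horizontal_conjugate; auto.
    + destruct HI as (I1 & I2 & I3 & I4). unfold starts_at_unit; simpl. rewrite I1, I2, I3, I4. repeat split; ring.
    + now apply lift_of_conjugate.
    + rewrite Ia. ring.
    + apply (primitive_ext a n ts (speed k)); auto. intros; symmetry; apply speed_conjugate.
    + simpl. rewrite cos_neg. exact Hb1.
    + simpl. rewrite sin_neg, Hb2. ring.
    + lra.
    + split; [exact L1|]. intros HST. exists (- kap). split; [now right|]. intros t Ht.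
      destruct (L2 HST t Ht) as (E1 & E2). rewrite speed_conjugate in E1, E2. simpl in E1, E2.
      replace (be - - kap * T / 2 + - kap * S t) with (- (- be - kap * T / 2 + kap * S t)) by field.
      rewrite cos_neg, sin_neg. split; lra.
  - destruct (lower_bound_lift k a b n ts al S s be P kap T Th) as (L1 & L2); auto.
    split; [exact L1|]. intros HST. exists kap. split; [now left|]. auto.
Qed.

(** * Existence of geodesics with given area *)

(** The difference quotient of g at 0, continued by 1 = g'(0). *)
Definition slope (g : R -> R) (x : R) : R := if Req_EM_T x 0 then 1 else g x / x.

Lemma continuous_slope (g : R -> R) x : g 0 = 0 -> is_derive g 0 1 -> (forall y, continuous g y) ->
  continuous (slope g) x.
Proof.
  intros H0 HD Hc. destruct (Req_dec x 0) as [->|Hx].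
  - apply continuity_pt_filterlim. intros e He. apply is_derive_Reals in HD.
    destruct (HD e He) as (d & Hd). exists d. split; [apply cond_pos|].
    intros h ((_ & Hh) & Hhd). simpl in *. unfold Rdist in *. rewrite Rminus_0_r in Hhd.
    unfold slope. destruct (Req_EM_T h 0); [lra|]. destruct (Req_EM_T 0 0); [|lra].
    specialize (Hd h n Hhd). rewrite Rplus_0_l, H0, Rminus_0_r in Hd. exact Hd.
  - apply (continuous_ext_loc _ (fun y => g y / y)).
    + assert (L : locally x (fun y => y <> 0)) by (apply (open_neq 0); auto).
      revert L. apply filter_imp. intros y Hy. unfold slope. destruct (Req_EM_T y 0); [lra|reflexivity].
    + cont. exact Hx.
Qed.

Lemma sinh_pos x : 0 < x -> 0 < sinh x.
Proof. intros. rewrite <- sinh_at_0. apply sinh_lt; auto. Qed.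

Lemma slope_sinh_pos x : 0 < slope sinh x.
Proof.
  unfold slope. destruct Req_EM_T; [lra|]. destruct (Rlt_dec 0 x).
  - apply Rdiv_lt_0_compat; [apply sinh_pos|]; auto.
  - replace (sinh x / x) with ((- sinh x) / (- x)) by (field; lra).
    apply Rdiv_lt_0_compat; [|lra]. pose proof (sinh_lt x 0). rewrite sinh_at_0 in H. lra.
Qed.

Lemma continuous_slope_sinh x : continuous (slope sinh) x.
Proof.
  apply continuous_slope; [apply sinh_at_0| |].
  - auto_derive; [auto|]. rewrite cosh_at_0. ring.
  - intros y. apply (is_derive_continuous _ _ (cosh y)). auto_derive; [auto|ring].
Qed.
Lemma continuous_slope_sin x : continuous (slope sin) x.
Proof.
  apply continuous_slope; [apply sin_0| |exact continuous_sin].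
  auto_derive; [auto|]. rewrite cos_0. ring.
Qed.

Lemma continuous_sinh y : continuous sinh y.
Proof. apply (is_derive_continuous _ _ (cosh y)). auto_derive; [auto|ring]. Qed.
Lemma continuous_cosh y : continuous cosh y.
Proof. apply (is_derive_continuous _ _ (sinh y)). auto_derive; [auto|ring]. Qed.
Lemma continuous_atan_R y : continuous atan y.
Proof. apply (is_derive_continuous _ _ _ (is_derive_atan y)). Qed.

(** [area_hyp s x] and [area_ell s x] are the area P of the geodesic with |B| = s at the end,
    as functions of its phase x = T sqrt |gen_det kap|, for kap < 1 and for kap > 1. They agree
    at x = 0, which is the case kap = 1. *)
Definition area_hyp (s x : R) : R :=
  sqrt (s ^ 2 - sinh x ^ 2) / slope sinh x - atan (sqrt (s ^ 2 - sinh x ^ 2) / cosh x).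
Definition area_ell (s x : R) : R :=
  sqrt (s ^ 2 + sin x ^ 2) / slope sin x - (PI / 2 - atan (cos x / sqrt (s ^ 2 + sin x ^ 2))).

Lemma geodesic_data_hyp s x : 0 < s -> 0 < x -> sinh x <= s ->
  exists kap T Th, geodesic_data s (area_hyp s x) kap T Th.
Proof.
  intros Hs Hx Hxs. pose proof (sinh_pos x Hx) as Hsh. pose proof (cosh_pos x) as Hch. pose proof PI_RGT_0.
  set (Y := sqrt (s ^ 2 - sinh x ^ 2)).
  assert (HY : 0 <= Y) by apply sqrt_pos.
  assert (HY2 : Y * Y = s ^ 2 - sinh x ^ 2) by (apply sqrt_sqrt; nra).
  assert (Hcas : gen_det (Y / s) = - ((sinh x / (2 * s)) * (sinh x / (2 * s)))).
  { unfold gen_det. transitivity ((Y * Y - s * s) / (4 * s * s)); [field; lra|rewrite HY2; field; lra]. }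
  assert (Hq : 0 < sinh x / (2 * s)) by (apply Rdiv_lt_0_compat; lra).
  assert (Hsq : sqrt (- gen_det (Y / s)) = sinh x / (2 * s)) by (rewrite Hcas, Ropp_involutive; apply sqrt_square; lra).
  assert (HcasN : gen_det (Y / s) < 0) by (rewrite Hcas; nra).
  assert (Harg : sinh x / (2 * s) * (2 * s * x / sinh x) = x) by (field; lra).
  destruct (atan_polar (cosh x) Y Hch) as (A1 & A2).
  replace (cosh x ^ 2 + Y ^ 2) with (1 + s ^ 2) in A1, A2 by (pose proof (cosh2_sinh2 x); nra).
  exists (Y / s), (2 * s * x / sinh x), (atan (Y / cosh x)).
  assert (Hk : 0 <= Y / s) by (apply Rle_mult_inv_pos; lra).
  refine (conj Hk (conj _ (conj _ (conj _ (conj _ (conj _ (conj _ _))))))).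
  - apply Rdiv_lt_0_compat; nra.
  - split; [|pose proof (atan_bound (Y / cosh x)); lra]. rewrite <- atan_0.
    destruct (Req_dec Y 0) as [->|]; [unfold Rdiv; rewrite Rmult_0_l; lra|].
    left. apply atan_increasing, Rdiv_lt_0_compat; lra.
  - unfold gsin. destruct Rlt_dec; [lra|]. destruct Rlt_dec; [|lra]. rewrite Hsq, Harg. field. lra.
  - unfold gcos. destruct Rlt_dec; [lra|]. rewrite Hsq, Harg. exact A1.
  - rewrite <- A2. field. lra.
  - unfold area_hyp. fold Y. unfold slope. destruct Req_EM_T; [lra|]. field. lra.
  - intros K. exfalso. assert (Y / s <= 1); [|lra]. apply Rmult_le_reg_r with s; [lra|].
    unfold Rdiv. rewrite Rmult_assoc, Rinv_l by lra. nra.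
Qed.

Lemma geodesic_data_ell s x : 0 < s -> 0 < x < PI ->
  exists kap T Th, geodesic_data s (area_ell s x) kap T Th.
Proof.
  intros Hs Hx. assert (Hsn : 0 < sin x) by (apply sin_gt_0; lra). pose proof PI_RGT_0.
  set (Y := sqrt (s ^ 2 + sin x ^ 2)).
  assert (HY : 0 < Y) by (apply sqrt_lt_R0; nra).
  assert (HY2 : Y * Y = s ^ 2 + sin x ^ 2) by (apply sqrt_sqrt; nra).
  assert (Hcas : gen_det (Y / s) = ((sin x / (2 * s)) * (sin x / (2 * s)))).
  { unfold gen_det. transitivity ((Y * Y - s * s) / (4 * s * s)); [field; lra|rewrite HY2; field; lra]. }
  assert (Hq : 0 < sin x / (2 * s)) by (apply Rdiv_lt_0_compat; lra).
  assert (Hsq : sqrt (gen_det (Y / s)) = sin x / (2 * s)) by (rewrite Hcas; apply sqrt_square; lra).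
  assert (HcasN : 0 < gen_det (Y / s)) by (rewrite Hcas; nra).
  assert (Harg : sin x / (2 * s) * (2 * s * x / sin x) = x) by (field; lra).
  destruct (atan_polar Y (cos x) HY) as (A1 & A2).
  replace (Y ^ 2 + cos x ^ 2) with (1 + s ^ 2) in A1, A2 by (pose proof (cos2_sin2 x); nra).
  exists (Y / s), (2 * s * x / sin x), (PI / 2 - atan (cos x / Y)).
  assert (Hk : 0 <= Y / s) by (apply Rle_mult_inv_pos; lra).
  refine (conj Hk (conj _ (conj _ (conj _ (conj _ (conj _ (conj _ _))))))).
  - apply Rdiv_lt_0_compat; nra.
  - pose proof (atan_bound (cos x / Y)); lra.
  - unfold gsin. destruct Rlt_dec; [|lra]. rewrite Hsq, Harg. field. lra.
  - unfold gcos. destruct Rlt_dec; [|lra]. rewrite Hsq, Harg, cos_shift. exact A2.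
  - rewrite sin_shift, <- A1. field. lra.
  - unfold area_ell. fold Y. unfold slope. destruct Req_EM_T; [lra|]. field. lra.
  - intros K. rewrite Hsq, Harg. lra.
Qed.

Lemma geodesic_data_par s : 0 < s -> geodesic_data s (s - atan s) 1 (2 * s) (atan s).
Proof.
  intros Hs. pose proof PI_RGT_0. assert (Hc : gen_det 1 = 0) by (unfold gen_det; field).
  destruct (atan_polar 1 s ltac:(lra)) as (A1 & A2).
  replace (1 ^ 2 + s ^ 2) with (1 + s ^ 2) in A1, A2 by ring. rewrite Rdiv_1_r in A1, A2.
  refine (conj _ (conj _ (conj _ (conj _ (conj _ (conj _ (conj _ _))))))); try lra.
  - split; [|pose proof (atan_bound s); lra]. rewrite <- atan_0. left. apply atan_increasing, Hs.
  - unfold gsin. rewrite Hc. destruct Rlt_dec; lra.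
  - unfold gcos. rewrite Hc. destruct Rlt_dec; [lra|]. rewrite Ropp_0, sqrt_0, Rmult_0_l, cosh_at_0. exact A1.
Qed.

(** For kap < 1 the area runs from s - atan s at phase 0 to 0 at phase arcsinh s, where
    kap = 0; for kap > 1 it starts at the same value and exceeds pi as the phase tends to pi. *)
Lemma geodesic_data_exists s P : 0 < s -> 0 <= P <= PI -> exists kap T Th, geodesic_data s P kap T Th.
Proof.
  intros Hs HP. pose proof PI_RGT_0 as HPI.
  assert (H0 : area_hyp s 0 = s - atan s).
  { unfold area_hyp, slope. destruct Req_EM_T; [|lra]. rewrite sinh_at_0, cosh_at_0, !Rdiv_1_r.
    replace (s ^ 2 - 0 ^ 2) with (s * s) by ring. rewrite sqrt_square by lra. reflexivity. }
  assert (H0' : area_ell s 0 = s - atan s).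
  { unfold area_ell, slope. destruct Req_EM_T; [|lra]. rewrite sin_0, cos_0, !Rdiv_1_r.
    replace (s ^ 2 + 0 ^ 2) with (s * s) by ring. rewrite sqrt_square by lra.
    replace (1 / s) with (/ s) by (field; lra). rewrite atan_inv by lra. ring. }
  destruct (Rtotal_order P (s - atan s)) as [H|[->|H]].
  - set (x1 := arcsinh s). assert (Hx1 : sinh x1 = s) by apply sinh_arcsinh.
    assert (Hx1p : 0 < x1).
    { apply Rnot_le_lt. intros K. destruct K as [K|K].
      - pose proof (sinh_lt x1 0 K). rewrite sinh_at_0 in H1. lra.
      - rewrite K, sinh_at_0 in Hx1. lra. }
    assert (E1 : area_hyp s x1 = 0).
    { unfold area_hyp. rewrite Hx1. replace (s ^ 2 - s ^ 2) with 0 by ring. rewrite sqrt_0.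
      unfold Rdiv. rewrite !Rmult_0_l, atan_0. ring. }
    destruct (IVT_gen (area_hyp s) 0 x1 P) as (x & Hx & Ex).
    + intros x. apply continuity_pt_filterlim. unfold area_hyp.
      pose proof (slope_sinh_pos x). pose proof (cosh_pos x).
      pose proof continuous_slope_sinh. pose proof continuous_sinh. pose proof continuous_cosh. pose proof continuous_atan_R.
      apply (Rcont_minus (fun x => sqrt (s ^ 2 - sinh x ^ 2) / slope sinh x) (fun x => atan (sqrt (s ^ 2 - sinh x ^ 2) / cosh x))).
      * cont. lra.
      * apply (Rcont_comp (fun x => sqrt (s ^ 2 - sinh x ^ 2) / cosh x) atan); [auto|]. cont. lra.
    + rewrite E1, H0. rewrite Rmin_right, Rmax_left by lra. lra.
    + rewrite Rmin_left, Rmax_right in Hx by lra. rewrite <- Ex. apply geodesic_data_hyp; auto.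
      * destruct (Req_dec x 0) as [->|]; [|lra]. rewrite H0 in Ex. lra.
      * rewrite <- Hx1. destruct (Req_dec x x1) as [->|]; [lra|]. left. apply sinh_lt. lra.
  - exists 1, (2 * s), (atan s). now apply geodesic_data_par.
  - (* At phase pi - e the first term of area_ell exceeds s (pi - e) / e = 2 pi. *)
    set (e := s * PI / (2 * PI + s)).
    assert (He : 0 < e < PI).
    { unfold e. split; [apply Rdiv_lt_0_compat; nra|]. apply Rmult_lt_reg_r with (2 * PI + s); [lra|].
      unfold Rdiv. rewrite Rmult_assoc, Rinv_l by lra. nra. }
    assert (Ee : s * (PI - e) = 2 * PI * e) by (unfold e; field; lra).
    assert (Hse : 0 < sin e < e) by (split; [apply sin_gt_0; lra|apply sin_lt_x; lra]).
    assert (Hsx : forall x, 0 <= x <= PI - e -> 0 < slope sin x).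
    { intros x Hx. unfold slope. destruct Req_EM_T; [lra|]. apply Rdiv_lt_0_compat; [apply sin_gt_0|]; lra. }
    destruct (IVT_interv (fun x => area_ell s x - P) 0 (PI - e)) as (x & Hx & Ex).
    + intros x Hx. apply continuity_pt_filterlim. unfold area_ell. specialize (Hsx x Hx).
      pose proof continuous_slope_sin. pose proof continuous_sin. pose proof continuous_cos. pose proof continuous_atan_R.
      assert (0 < sqrt (s ^ 2 + sin x ^ 2)) by (apply sqrt_lt_R0; nra).
      apply (Rcont_minus (fun x => sqrt (s ^ 2 + sin x ^ 2) / slope sin x - (PI / 2 - atan (cos x / sqrt (s ^ 2 + sin x ^ 2)))) (fun _ => P)); [|cont].
      apply (Rcont_minus (fun x => sqrt (s ^ 2 + sin x ^ 2) / slope sin x) (fun x => (PI / 2 - atan (cos x / sqrt (s ^ 2 + sin x ^ 2))))).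
      * cont. lra.
      * apply (Rcont_minus (fun _ => PI / 2) (fun x => atan (cos x / sqrt (s ^ 2 + sin x ^ 2)))); [apply continuous_const|].
        apply (Rcont_comp (fun x => cos x / sqrt (s ^ 2 + sin x ^ 2)) atan); [auto|]. cont. lra.
    + lra.
    + cbv beta. rewrite H0'. lra.
    + assert (2 * PI < sqrt (s ^ 2 + sin (PI - e) ^ 2) / slope sin (PI - e)).
      { unfold slope. destruct Req_EM_T; [lra|]. rewrite sin_PI_x.
        assert (Hq : s <= sqrt (s ^ 2 + sin e ^ 2)).
        { rewrite <- (sqrt_square s) at 1 by lra. apply sqrt_le_1_alt. nra. }
        replace (sqrt (s ^ 2 + sin e ^ 2) / (sin e / (PI - e))) with (sqrt (s ^ 2 + sin e ^ 2) * (PI - e) / sin e) by (field; lra).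
        apply Rmult_lt_reg_r with (sin e); [lra|]. unfold Rdiv. rewrite (Rmult_assoc _ (/ sin e)), Rinv_l by lra.
        rewrite Rmult_1_r. apply Rlt_le_trans with (2 * PI * e); [apply Rmult_lt_compat_l; lra|].
        rewrite <- Ee. apply Rmult_le_compat_r; lra. }
      unfold area_ell. pose proof (atan_bound (cos (PI - e) / sqrt (s ^ 2 + sin (PI - e) ^ 2))). lra.
    + replace P with (area_ell s x) by lra. apply geodesic_data_ell; auto.
      destruct (Req_dec x 0) as [->|]; [|lra]. rewrite H0' in Ex. lra.
Qed.

(** With kap kept, T can be increased a little, since P < pi and the bound on the phase are
    open conditions. *)
Lemma geodesic_data_extend s P kap T Th : 0 < s -> geodesic_data s P kap T Th -> P < PI ->
  exists s' P' T' Th', geodesic_data s' P' kap T' Th' /\ T < T' /\ 0 < s' /\ -PI <= P' <= PI.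
Proof.
  intros Hs (Hk & HT & HTh & Hsm & Hcm & Hks & HP & Hlt) HPP. pose proof PI_RGT_0 as HPI.
  set (m := gen_det kap) in *.
  destruct Hk as [Hk|<-].
  - set (phi := fun t => kap * t / 2 - (PI / 2 - atan (gcos m t / (kap * (gsin m t / 2))))).
    assert (HcT : 0 < kap * (gsin m T / 2)) by (rewrite Hsm; nra).
    assert (Cphi : continuous phi T).
    { unfold phi. pose proof continuous_atan_R. pose proof (continuous_gcos m). pose proof (continuous_gsin m).
      apply (Rcont_minus (fun t => kap * t / 2) (fun t => PI / 2 - atan (gcos m t / (kap * (gsin m t / 2))))); [cont; lra|].
      apply (Rcont_minus (fun t => PI / 2) (fun t => atan (gcos m t / (kap * (gsin m t / 2))))); [apply continuous_const|].
      apply (Rcont_comp (fun t => gcos m t / (kap * (gsin m t / 2))) atan); [auto|]. cont; lra. }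
    assert (EP : phi T = P).
    { unfold phi. rewrite Hsm, Hcm. replace (2 * s / 2) with s by field. rewrite Hks, <- HP.
      set (c := sqrt (1 + s ^ 2)) in *. assert (Hc : 0 < c) by (apply sqrt_lt_R0; nra).
      assert (HsT : 0 < sin Th) by (apply Rmult_lt_reg_l with c; nra).
      assert (Th0 : 0 < Th) by (destruct (Req_dec Th 0) as [E|]; [rewrite E, sin_0 in HsT; lra|lra]).
      replace (c * cos Th / (c * sin Th)) with (tan (PI / 2 - Th)).
      - rewrite atan_tan by lra. ring.
      - unfold tan. rewrite sin_shift, cos_shift. field. lra. }
    assert (L1 : locally T (fun t => phi t < PI)).
    { apply (Cphi (fun y => y < PI)). apply (open_lt PI). rewrite EP. exact HPP. }
    assert (L2 : locally T (fun t => 0 < gsin m t)).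
    { apply (continuous_gsin m T (fun y => 0 < y)). apply (open_gt 0). rewrite Hsm. lra. }
    assert (L3 : locally T (fun t => 1 < kap -> sqrt m * t < PI)).
    { destruct (Rlt_dec 1 kap) as [K|K].
      - specialize (Hlt K).
        assert (C3 : continuous (fun t => sqrt m * t) T) by cont.
        generalize (C3 (fun y => y < PI) (open_lt PI _ Hlt)). unfold filtermap. apply filter_imp. auto.
      - apply filter_forall. intros; lra. }
    destruct (filter_and _ _ L1 (filter_and _ _ L2 L3)) as (e & He).
    set (T' := T + e / 2). pose proof (cond_pos e) as Hep.
    destruct (He T') as (B1 & B2 & B3).
    { unfold ball; simpl. unfold AbsRing_ball, abs, minus, plus, opp; simpl. unfold T'.
      replace (T + e / 2 + - T) with (e / 2) by ring. rewrite Rabs_pos_eq; lra. }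
    assert (HY : 0 < kap * (gsin m T' / 2)) by nra.
    destruct (atan_polar (kap * (gsin m T' / 2)) (gcos m T') HY) as (A1 & A2).
    assert (E2 : (kap * (gsin m T' / 2)) ^ 2 + gcos m T' ^ 2 = 1 + (gsin m T' / 2) ^ 2).
    { pose proof (gcos_gsin m T') as K. unfold m in K at 3. unfold gen_det in K. lra. }
    rewrite E2 in A1, A2.
    pose proof (atan_bound (gcos m T' / (kap * (gsin m T' / 2)))) as AB.
    exists (gsin m T' / 2), (phi T'), T', (PI / 2 - atan (gcos m T' / (kap * (gsin m T' / 2)))).
    split; [|split; [unfold T'; lra|split; [lra|]]].
    + refine (conj _ (conj _ (conj _ (conj _ (conj _ (conj _ (conj _ _))))))); fold m; try lra.
      * unfold T'; lra.
      * rewrite cos_shift. exact A2.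
      * rewrite sin_shift. exact A1.
      * unfold phi. ring.
    + assert (0 < T') by (unfold T'; lra). unfold phi in *. nra.
  - assert (Hm : m = - / 4) by (unfold m, gen_det; field).
    assert (Hsp : 0 < gsin m (T + 1)).
    { unfold gsin. destruct Rlt_dec; [lra|]. destruct Rlt_dec; [|lra].
      assert (0 < sqrt (- m)) by (apply sqrt_lt_R0; lra). apply Rdiv_lt_0_compat; [apply sinh_pos; nra|lra]. }
    assert (Hcp : 0 < gcos m (T + 1)) by (unfold gcos; destruct Rlt_dec; [lra|apply cosh_pos]).
    exists (gsin m (T + 1) / 2), 0, (T + 1), 0. split; [|split; [lra|split; lra]].
    refine (conj _ (conj _ (conj _ (conj _ (conj _ (conj _ (conj _ _))))))); fold m; try lra.
    + rewrite cos_0, Rmult_1_r. symmetry. rewrite <- (sqrt_square (gcos m (T + 1))) by lra. f_equal.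
      pose proof (gcos_gsin m (T + 1)) as K. rewrite Hm in K at 3. lra.
    + rewrite sin_0. ring.
Qed.

(** * Geodesics of SU(1,1) *)

Definition point : Type := (R * R * R * R)%type.
Lemma pt_eq (a b c d a' b' c' d' : R) : a = a' -> b = b' -> c = c' -> d = d' ->
  (a, b, c, d) = (a', b', c', d').
Proof. congruence. Qed.
Definition pos (k : curve) (t : R) : point := (ca1 k t, ca2 k t, cb1 k t, cb2 k t).
Definition in_su (g : point) : Prop :=
  let '(a1, a2, b1, b2) := g in a1 ^ 2 + a2 ^ 2 - (b1 ^ 2 + b2 ^ 2) = 1.
Definition unit_pt : point := (1, 0, 0, 0).
Definition mul (g h : point) : point :=
  let '(a1, a2, b1, b2) := g in let '(c1, c2, d1, d2) := h in
  (a1 * c1 - a2 * c2 + (b1 * d1 + b2 * d2), a1 * c2 + a2 * c1 + (b2 * d1 - b1 * d2),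
   a1 * d1 - a2 * d2 + (b1 * c1 + b2 * c2), a1 * d2 + a2 * d1 + (b2 * c1 - b1 * c2)).
Definition inv (g : point) : point := let '(a1, a2, b1, b2) := g in (a1, - a2, - b1, - b2).
Definition left_mul (g : point) (k : curve) : curve :=
  let '(a1, a2, b1, b2) := g in translate a1 a2 b1 b2 k.

Lemma pos_left_mul g k t : pos (left_mul g k) t = mul g (pos k t).
Proof. destruct g as [[[a1 a2] b1] b2]. reflexivity. Qed.
Lemma speed_left_mul g k t : speed (left_mul g k) t = speed k t.
Proof. destruct g as [[[a1 a2] b1] b2]. reflexivity. Qed.
Lemma in_su_mul g h : in_su g -> in_su h -> in_su (mul g h).
Proof.
  destruct g as [[[a1 a2] b1] b2], h as [[[c1 c2] d1] d2]. simpl. intros H1 H2.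
  transitivity ((a1 ^ 2 + a2 ^ 2 - (b1 ^ 2 + b2 ^ 2)) * (c1 ^ 2 + c2 ^ 2 - (d1 ^ 2 + d2 ^ 2))); [ring|].
  simpl. rewrite H1, H2. ring.
Qed.
Lemma in_su_inv g : in_su g -> in_su (inv g).
Proof. destruct g as [[[a1 a2] b1] b2]. simpl. lra. Qed.
Lemma mul_inv_l g h : in_su g -> mul (inv g) (mul g h) = h.
Proof.
  destruct g as [[[a1 a2] b1] b2], h as [[[c1 c2] d1] d2]. simpl. intros H.
  apply pt_eq; match goal with |- _ = ?x => transitivity ((a1 ^ 2 + a2 ^ 2 - (b1 ^ 2 + b2 ^ 2)) * x);
    [ring|simpl; rewrite H; ring] end.
Qed.
Lemma mul_inv_r g h : in_su g -> mul g (mul (inv g) h) = h.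
Proof.
  destruct g as [[[a1 a2] b1] b2], h as [[[c1 c2] d1] d2]. simpl. intros H.
  apply pt_eq; match goal with |- _ = ?x => transitivity ((a1 ^ 2 + a2 ^ 2 - (b1 ^ 2 + b2 ^ 2)) * x);
    [ring|simpl; rewrite H; ring] end.
Qed.
Lemma mul_unit_r g : mul g unit_pt = g.
Proof. destruct g as [[[a1 a2] b1] b2]. simpl. apply pt_eq; ring. Qed.
Lemma mul_unit_l g : mul unit_pt g = g.
Proof. destruct g as [[[a1 a2] b1] b2]. simpl. apply pt_eq; ring. Qed.
Lemma in_su_unit : in_su unit_pt.
Proof. simpl. ring. Qed.

Lemma horizontal_left_mul g k a b n ts : in_su g -> horizontal k a b n ts ->
  horizontal (left_mul g k) a b n ts.
Proof. destruct g as [[[a1 a2] b1] b2]. simpl. intros. now apply horizontal_translate. Qed.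

Definition smooth (k : curve) : Prop :=
  continuous_curve k /\
  (forall t, in_su (pos k t)) /\
  ((forall t, continuous (cp k) t) /\ (forall t, continuous (cq k) t)) /\
  forall t,
    is_horizontal_at k t.

Lemma smooth_horizontal k a b n ts : smooth k -> subdivision a b n ts -> horizontal k a b n ts.
Proof.
  intros (HC & HN & (HP & HQ) & HD) Hs. refine (conj Hs (conj HC (conj HN (conj _ _)))).
  - split; apply pw_continuous_of_continuous; auto.
  - auto.
Qed.

Lemma smooth_left_mul g k : in_su g -> smooth k -> smooth (left_mul g k).
Proof.
  intros Hg (HC & HN & (HP & HQ) & HD).
  refine (conj _ (conj _ (conj _ _))).
  - destruct g as [[[a1 a2] b1] b2]; destruct HC as (C1 & C2 & C3 & C4). unfold continuous_curve; simpl.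
    refine (conj _ (conj _ (conj _ _))); cont.
  - intros t. rewrite pos_left_mul. now apply in_su_mul.
  - destruct g as [[[a1 a2] b1] b2]. simpl. auto.
  - intros t. destruct g as [[[a1 a2] b1] b2]. unfold is_horizontal_at; simpl. destruct (HD t) as (D1 & D2 & D3 & D4).
    refine (conj _ (conj _ (conj _ _))); (auto_derive; [exder|known_derive; field]).
Qed.

Definition ray_of (C S : R -> R) (kap th T : R) : curve := Curve
  (fun t => cos (kap * T * t / 2) * C t + sin (kap * T * t / 2) * (kap / 2 * S t))
  (fun t => cos (kap * T * t / 2) * (kap / 2 * S t) - sin (kap * T * t / 2) * C t)
  (fun t => cos (kap * T * t / 2 + th) * (S t / 2))
  (fun t => sin (kap * T * t / 2 + th) * (S t / 2))
  (fun t => T * cos (kap * T * t + th))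
  (fun t => T * sin (kap * T * t + th)).

(** The geodesic of curvature kap with starting direction exp (i th), run through with
    constant speed T, so that T is its length at time 1. *)
Definition ray (kap th T : R) : curve :=
  ray_of (fun t => gcos (gen_det kap) (T * t)) (fun t => gsin (gen_det kap) (T * t)) kap th T.

Lemma smooth_ray kap th T : smooth (ray kap th T).
Proof.
  set (m := gen_det kap).
  assert (DC : forall t, is_derive (fun t : R => gcos m (T * t)) t (T * (- m * gsin m (T * t)))).
  { intros t. apply (is_derive_comp (gcos m) (fun t => T * t)); [apply is_derive_gcos|auto_derive; [auto|ring]]. }
  assert (DS : forall t, is_derive (fun t : R => gsin m (T * t)) t (T * gcos m (T * t))).
  { intros t. apply (is_derive_comp (gsin m) (fun t => T * t)); [apply is_derive_gsin|auto_derive; [auto|ring]]. }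
  assert (Em : m = (kap * kap - 1) / 4) by reflexivity.
  assert (HN : forall t, gcos m (T * t) * gcos m (T * t) + m * (gsin m (T * t) * gsin m (T * t)) = 1) by (intros; apply gcos_gsin).
  unfold ray. fold m. clearbody m.
  set (C := fun t : R => gcos m (T * t)) in *. set (S := fun t : R => gsin m (T * t)) in *.
  assert (CC : forall t, continuous C t) by (intros t; apply (is_derive_continuous _ _ _ (DC t))).
  assert (CS : forall t, continuous S t) by (intros t; apply (is_derive_continuous _ _ _ (DS t))).
  assert (DC' : forall t, is_derive C t (T * (- m * S t))) by exact DC.
  assert (DS' : forall t, is_derive S t (T * C t)) by exact DS.
  assert (HN' : forall t, C t * C t + m * (S t * S t) = 1) by exact HN.
  clearbody C S. clear DC DS HN.
  refine (conj _ (conj _ (conj _ _))); unfold continuous_curve; simpl.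
  - refine (conj _ (conj _ (conj _ _))); cont; lra.
  - intros t. pose proof (cos2_sin2 (kap * T * t / 2)) as T1. pose proof (cos2_sin2 (kap * T * t / 2 + th)) as T2.
    set (x := cos (kap * T * t / 2)) in *. set (y := sin (kap * T * t / 2)) in *.
    transitivity ((x * x + y * y) * (C t * C t + kap * kap / 4 * (S t * S t)) -
      (cos (kap * T * t / 2 + th) * cos (kap * T * t / 2 + th) + sin (kap * T * t / 2 + th) * sin (kap * T * t / 2 + th)) * (S t * S t / 4)); [field|].
    rewrite T1, T2. transitivity (C t * C t + (kap * kap - 1) / 4 * (S t * S t)); [field|rewrite <- Em; apply HN'].
  - split; cont.
  - intros t. unfold is_horizontal_at; simpl. pose proof (DC' t) as DC. pose proof (DS' t) as DS.
    assert (Ecd : cos (kap * T * t + th) = cos (kap * T * t / 2 + th) * cos (kap * T * t / 2) - sin (kap * T * t / 2 + th) * sin (kap * T * t / 2)).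
    { rewrite <- cos_plus. f_equal. field. }
    assert (Esd : sin (kap * T * t + th) = sin (kap * T * t / 2 + th) * cos (kap * T * t / 2) + cos (kap * T * t / 2 + th) * sin (kap * T * t / 2)).
    { rewrite <- sin_plus. f_equal. field. }
    pose proof (cos2_sin2 (kap * T * t / 2)) as T1. pose proof (cos2_sin2 (kap * T * t / 2 + th)) as T2.
    rewrite Ecd, Esd. set (ph := kap * T * t / 2) in *. set (ps := ph + th) in *.
    refine (conj _ (conj _ (conj _ _))).
    + auto_derive; [exder|]. known_derive. change (kap * T * t * / 2) with ph.
      transitivity ((cos ps * cos ps + sin ps * sin ps) * (T * cos ph * (S t / 4))); [rewrite T2, Em; field|field].
    + auto_derive; [exder|]. known_derive. change (kap * T * t * / 2) with ph.
      transitivity (- (cos ps * cos ps + sin ps * sin ps) * (T * sin ph * (S t / 4))); [rewrite T2, Em; field|field].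
    + auto_derive; [exder|]. known_derive. change (kap * T * t * / 2) with ph. fold ps.
      transitivity (T / 2 * (C t * (cos ps * (cos ph * cos ph + sin ph * sin ph)) - (kap / 2 * S t) * (sin ps * (cos ph * cos ph + sin ph * sin ph)))); [rewrite T1; field|field].
    + auto_derive; [exder|]. known_derive. change (kap * T * t * / 2) with ph. fold ps.
      transitivity (T / 2 * (C t * (sin ps * (cos ph * cos ph + sin ph * sin ph)) + (kap / 2 * S t) * (cos ps * (cos ph * cos ph + sin ph * sin ph)))); [rewrite T1; field|field].
Qed.

Lemma pos_ray_0 kap th T : pos (ray kap th T) 0 = unit_pt.
Proof.
  unfold pos, ray, unit_pt; simpl. rewrite !Rmult_0_r, gcos_0, gsin_0.
  replace (0 / 2) with 0 by field. rewrite cos_0, sin_0. apply pt_eq; field.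
Qed.

Lemma speed_ray kap th T t : 0 <= T -> speed (ray kap th T) t = T.
Proof.
  intros H. unfold speed. simpl. transitivity (sqrt (T * T)); [f_equal|apply sqrt_square; lra].
  pose proof (cos2_sin2 (kap * T * t + th)).
  transitivity (T * T * (cos (kap * T * t + th) * cos (kap * T * t + th) + sin (kap * T * t + th) * sin (kap * T * t + th))); [ring|rewrite H0; ring].
Qed.

Lemma gen_det_even kap kap' : kap' = kap \/ kap' = - kap -> gen_det kap' = gen_det kap.
Proof. unfold gen_det. intros [-> | ->]; field. Qed.

Definition minimal (g : point) (T : R) : Prop :=
  forall k a b n ts S, horizontal k a b n ts -> pos k a = unit_pt -> pos k b = g ->
    primitive a n ts (speed k) S -> T <= S b.

(** The point with |B| = s, argument be of B and argument - e P of A. *)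
Definition polar_point (s P e be : R) : point :=
  (sqrt (1 + s ^ 2) * cos P, - e * (sqrt (1 + s ^ 2) * sin P), s * cos be, s * sin be).

Lemma ray_end_polar s P kap T Th e be : e = 1 \/ e = -1 -> geodesic_data s P kap T Th ->
  pos (ray (e * kap) (be - e * kap * T / 2) T) 1 = polar_point s P e be.
Proof.
  intros He (Hk & HT & HTh & Hsm & Hcm & Hks & HP & _).
  unfold pos, ray, polar_point; simpl. rewrite !Rmult_1_r.
  replace (gen_det (e * kap)) with (gen_det kap) by (symmetry; apply gen_det_even; destruct He as [-> | ->]; [left|right]; ring).
  rewrite Hsm, Hcm. replace (1 + s * s) with (1 + s ^ 2) by ring. set (c := sqrt (1 + s ^ 2)) in *.
  replace (e * kap / 2 * (2 * s)) with (e * (kap * s)) by field. rewrite Hks, <- HP.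
  replace (e * kap * T / 2 + (be - e * kap * T / 2)) with be by ring.
  replace (2 * s / 2) with s by field.
  rewrite cos_minus, sin_minus.
  destruct He as [-> | ->].
  - rewrite !Rmult_1_l. apply pt_eq; ring.
  - replace (-1 * kap * T / 2) with (- (kap * T / 2)) by field. rewrite cos_neg, sin_neg. apply pt_eq; ring.
Qed.

Lemma unit_starts k a : pos k a = unit_pt -> starts_at_unit k a.
Proof. unfold pos, unit_pt. intros H. injection H as H1 H2 H3 H4. repeat split; assumption. Qed.

Lemma minimal_polar_point s P kap T Th e be : - PI <= P <= PI -> geodesic_data s P kap T Th ->
  minimal (polar_point s P e be) T.
Proof.
  intros HP HG k a b n ts S Hh Ha Hb HS. unfold pos, polar_point in Hb. injection Hb as E1 E2 E3 E4.
  destruct (lower_bound k a b n ts S s be P kap T Th) as (K & _); auto. now apply unit_starts.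
Qed.

(** The geodesic returns to B = 0 when om T = pi. There the argument of A is
    pi - kap T / 2 = - P, and x = 1 + P / pi equals kap / sqrt (kap^2 - 1). All starting
    directions th lead to the same endpoint. *)
Lemma closed_geodesic P e : e = 1 \/ e = -1 -> 0 < P <= PI -> exists kap T, 0 < T /\ 0 < kap /\
  (forall th, pos (ray (e * kap) th T) 1 = (cos P, - e * sin P, 0, 0)) /\
  minimal (cos P, - e * sin P, 0, 0) T.
Proof.
  intros He HP. pose proof PI_RGT_0 as HPI.
  set (x := 1 + P / PI). assert (HPP : 0 < P / PI) by (apply Rdiv_lt_0_compat; lra).
  assert (Hx : 1 < x) by (unfold x; lra).
  set (r := sqrt (x * x - 1)). assert (Hr : 0 < r) by (apply sqrt_lt_R0; nra).
  assert (Hr2 : r * r = x * x - 1) by (apply sqrt_sqrt; nra).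
  set (kap := x / r). set (T := 2 * PI * r). set (om := / (2 * r)).
  assert (Hom : 0 < om) by (apply Rinv_0_lt_compat; lra).
  assert (Hk : 1 < kap).
  { unfold kap. apply Rmult_lt_reg_r with r; [lra|]. unfold Rdiv. rewrite Rmult_assoc, Rinv_l by lra. nra. }
  assert (Hok : 4 * (om * om) = kap * kap - 1).
  { unfold om, kap. transitivity ((r * r + 1) / (r * r) - 1); [field; lra|].
    replace (r * r + 1) with (x * x) by lra. field. lra. }
  assert (Hcas : gen_det kap = om * om) by (unfold gen_det; lra).
  assert (Hsq : sqrt (gen_det kap) = om) by (rewrite Hcas; apply sqrt_square; lra).
  assert (HoT : om * T = PI) by (unfold om, T; field; lra).
  assert (HkT : kap * T / 2 = PI + P) by (unfold kap, T, x; field; lra).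
  assert (HT : 0 < T) by (unfold T; nra).
  exists kap, T. split; [auto|]. split; [lra|]. split.
  - intros th. unfold pos, ray; simpl. rewrite !Rmult_1_r.
    replace (gen_det (e * kap)) with (gen_det kap) by (symmetry; apply gen_det_even; destruct He as [-> | ->]; [left|right]; ring).
    unfold gcos, gsin. destruct Rlt_dec as [Hl|Hl]; [|exfalso; apply Hl; rewrite Hcas; nra].
    rewrite Hsq, HoT, cos_PI, sin_PI.
    replace (e * kap * T / 2) with (e * (kap * T / 2)) by (field). rewrite HkT.
    assert (C1 : cos (e * (PI + P)) = - cos P).
    { destruct He as [-> | ->]; [rewrite Rmult_1_l|replace (-1 * (PI + P)) with (- (PI + P)) by ring; rewrite cos_neg];
      rewrite Rplus_comm; apply neg_cos. }
    assert (C2 : sin (e * (PI + P)) = - e * sin P).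
    { destruct He as [-> | ->]; [rewrite Rmult_1_l|replace (-1 * (PI + P)) with (- (PI + P)) by ring; rewrite sin_neg];
      rewrite Rplus_comm, neg_sin; ring. }
    rewrite C1, C2. apply pt_eq; field; lra.
  - intros k a b n ts S Hh Ha Hb HS. apply Rnot_lt_le. intros HST.
    unfold pos in Hb. injection Hb as E1 E2 E3 E4. apply unit_starts in Ha.
    pose proof Hh as (Hs & _ & HN & _ & _). specialize (HN b).
    pose proof (subdivision_lt _ _ _ _ Hs) as Hab.
    destruct (lift_of_exists k a b n ts 0 Hh (lift_at_unit k a 0 Ha eq_refl)) as (al & Hl & Ia).
    assert (Hn1 : ca1 k b ^ 2 + ca2 k b ^ 2 = 1) by (rewrite E3, E4 in HN; lra).
    assert (Hcos : cos (al b) = cos P).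
    { destruct Hl as (_ & L & _). destruct (L b ltac:(lra)) as (F1 & _). rewrite Hn1, sqrt_1 in F1. lra. }
    assert (Fin : forall k' al', horizontal k' a b n ts -> starts_at_unit k' a -> lift_of k' a b n ts al' -> al' a = 0 ->
       primitive a n ts (speed k') S -> ca1 k' b ^ 2 + ca2 k' b ^ 2 = 1 -> al' b <= - P -> False).
    { intros k' al' H1 H2 H3 H4 H5 H6 H7.
      pose proof (lower_bound_closed k' a b n ts al' S kap om H1 H2 H3 H4 H5 H6 Hk Hom Hok) as K.
      assert (om < kap / 2) by nra.
      assert (kap * S b / 2 < PI + P) by (rewrite <- HkT; nra).
      specialize (K ltac:(lra)). nra. }
    destruct (abs_ge_of_cos (al b) P ltac:(lra) Hcos) as [K|K].
    + apply (Fin (conjugate k) (fun t => - al t)).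
      * apply horizontal_conjugate; auto.
      * destruct Ha as (I1 & I2 & I3 & I4). unfold starts_at_unit; simpl. rewrite I1, I2, I3, I4. repeat split; ring.
      * apply lift_of_conjugate with (1 := Hh); auto.
      * rewrite Ia. ring.
      * apply (primitive_ext a n ts (speed k)); auto. intros; symmetry; apply speed_conjugate.
      * simpl. simpl in Hn1. lra.
      * lra.
    + apply (Fin k al); auto.
Qed.

Lemma point_form (g : point) : in_su g -> exists s P e be, 0 <= s /\ 0 <= P <= PI /\ (e = 1 \/ e = -1) /\ g = polar_point s P e be.
Proof.
  destruct g as [[[a1 a2] b1] b2]. intros H. unfold in_su in H.
  set (s := sqrt (b1 ^ 2 + b2 ^ 2)).
  assert (Hs : 0 <= s) by apply sqrt_pos.
  assert (Hs2 : s ^ 2 = b1 ^ 2 + b2 ^ 2) by (unfold s; rewrite <- Rsqr_pow2; apply Rsqr_sqrt; nra).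
  assert (Hbe : exists be, b1 = s * cos be /\ b2 = s * sin be).
  { destruct (Req_dec s 0) as [E|E].
    - exists 0. rewrite E in *. assert (b1 = 0) by nra. assert (b2 = 0) by nra. subst. split; ring.
    - apply polar_exists. nra. }
  destruct Hbe as (be & B1 & B2).
  set (c := sqrt (1 + s ^ 2)).
  assert (Hc : 0 < c) by (apply sqrt_lt_R0; nra).
  assert (Hc2 : c * c = a1 ^ 2 + a2 ^ 2) by (unfold c; rewrite sqrt_sqrt by nra; lra).
  assert (Hx : -1 <= a1 / c <= 1).
  { split; apply Rmult_le_reg_r with c; auto; unfold Rdiv; rewrite Rmult_assoc, Rinv_l by lra; nra. }
  assert (Hsin : Rabs a2 = c * sin (acos (a1 / c))).
  { rewrite sin_acos by auto. rewrite <- (sqrt_square c) at 1 by lra. rewrite <- sqrt_mult; [|nra|unfold Rsqr; nra].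
    rewrite <- sqrt_Rsqr_abs. f_equal. unfold Rsqr. transitivity (c * c - a1 * a1); [rewrite Hc2; ring|field; lra]. }
  exists s, (acos (a1 / c)), (if Rle_dec a2 0 then 1 else -1), be.
  split; [auto|]. split; [apply acos_bound|]. split; [destruct Rle_dec; auto|].
  unfold polar_point. fold c. rewrite cos_acos by auto. rewrite <- Hsin.
  apply pt_eq; auto.
  - field. lra.
  - destruct Rle_dec; [rewrite Rabs_left1 by auto|rewrite Rabs_right by lra]; ring.
Qed.

Lemma minimal_unit : minimal unit_pt 0.
Proof.
  intros k a b n ts S (Hs & _) _ _ (CS & S0 & DS). rewrite <- S0.
  apply (pw_monotone S a b n ts Hs); auto; try lra.
  - intros t Ht. exists (speed k t). split; [apply DS, Ht|apply speed_nonneg].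
  - pose proof (subdivision_lt _ _ _ _ Hs). lra.
Qed.

Lemma geodesic_exists (g : point) : in_su g ->
  exists kap th T, 0 <= T /\ pos (ray kap th T) 1 = g /\ minimal g T.
Proof.
  intros Hg. destruct (point_form g Hg) as (s & P & e & be & Hs & HP & He & ->).
  destruct Hs as [Hs|<-].
  - destruct (geodesic_data_exists s P Hs HP) as (kap & T & Th & HG).
    exists (e * kap), (be - e * kap * T / 2), T. split; [destruct HG as (_ & K & _); lra|].
    split; [now apply ray_end_polar with (Th := Th)|]. apply (minimal_polar_point s P kap T Th); [pose proof PI_RGT_0; lra|exact HG].
  - assert (E : polar_point 0 P e be = (cos P, - e * sin P, 0, 0)).
    { unfold polar_point. replace (1 + 0 ^ 2) with 1 by ring. rewrite sqrt_1. apply pt_eq; ring. }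
    rewrite E. destruct (Req_dec P 0) as [->|HP0].
    + exists 0, 0, 0. rewrite cos_0, sin_0. replace (- e * 0) with 0 by ring. split; [lra|]. split; [|apply minimal_unit].
      unfold pos, ray; simpl. rewrite !Rmult_0_l, gcos_0, gsin_0. replace (0 / 2) with 0 by field.
      rewrite cos_0, sin_0. apply pt_eq; field.
    + destruct (closed_geodesic P e He) as (kap & T & HT & Hk & H1 & H2); [lra|].
      exists (e * kap), 0, T. split; [lra|]. split; auto.
Qed.

(** * Matrices and their components *)

Definition to_matrix (g : point) (v : R) : mat3 :=
  let '(a1, a2, b1, b2) := g in su11R_mat (a1, a2) (b1, b2) v.

Lemma Cmod_sqr z : Cmod z ^ 2 = fst z ^ 2 + snd z ^ 2.
Proof. unfold Cmod. rewrite <- Rsqr_pow2. apply Rsqr_sqrt. nra. Qed.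

Lemma SU11R_to_matrix g v : in_su g -> SU11R (to_matrix g v).
Proof.
  destruct g as [[[a1 a2] b1] b2]. intros H. exists (a1, a2), (b1, b2), v.
  split; [|reflexivity]. rewrite !Cmod_sqr. exact H.
Qed.

Lemma SU11R_inv M : SU11R M -> exists g v, in_su g /\ M = to_matrix g v.
Proof.
  intros ([a1 a2] & [b1 b2] & v & H & ->). exists (a1, a2, b1, b2), v.
  split; [|reflexivity]. rewrite !Cmod_sqr in H. exact H.
Qed.

Lemma to_matrix_inj g v h w : to_matrix g v = to_matrix h w -> g = h /\ v = w.
Proof.
  destruct g as [[[a1 a2] b1] b2], h as [[[c1 c2] d1] d2]. intros H.
  assert (E1 := f_equal (fun M => entry M 0 0) H). assert (E2 := f_equal (fun M => entry M 0 1) H).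
  assert (E3 := f_equal (fun M => entry M 2 2) H).
  cbn in E1, E2, E3. injection E1 as -> ->. injection E2 as -> ->. injection E3 as E3.
  split; [reflexivity|now apply exp_inv].
Qed.

Lemma Id3_to_matrix : Id3 = to_matrix unit_pt 0.
Proof.
  unfold Id3, Mone, to_matrix, unit_pt, su11R_mat.
  apply (coeff_mat_ext_aux (T := C) (RtoC 0) (RtoC 0)). intros i j Hi Hj.
  rewrite !coeff_mat_bij by auto.
  destruct i as [|[|[|i]]]; try lia; destruct j as [|[|[|j]]]; try lia; cbn; try reflexivity;
  unfold Cconj; cbn; rewrite ?Ropp_0, ?exp_0; reflexivity.
Qed.

Definition tangent (g : point) (v p x q : R) (i j : nat) : C :=
  let '(a1, a2, b1, b2) := g in
  match i, j with
  | 0%nat, 0%nat => ((b1 * p + b2 * q) / 2, (b2 * p - b1 * q) / 2)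
  | 0%nat, 1%nat => ((a1 * p - a2 * q) / 2, (a2 * p + a1 * q) / 2)
  | 1%nat, 0%nat => ((a1 * p - a2 * q) / 2, - ((a2 * p + a1 * q) / 2))
  | 1%nat, 1%nat => ((b1 * p + b2 * q) / 2, - ((b2 * p - b1 * q) / 2))
  | 2%nat, 2%nat => (x * exp v, 0)
  | _, _ => (0, 0)
  end.

Lemma entry_tangent g v p x q i j : (i < 3)%nat -> (j < 3)%nat ->
  entry (mmul (to_matrix g v) (span_elt (p, x, q))) i j = tangent g v p x q i j.
Proof.
  intros Hi Hj. destruct g as [[[a1 a2] b1] b2]. unfold tangent.
  destruct i as [|[|[|i]]]; try lia; destruct j as [|[|[|j]]]; try lia;
  unfold entry, mmul, Mmult; rewrite coeff_mat_bij by auto; cbn [Nat.pred]; rewrite !sum_Sn, sum_O;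
  cbn; apply injective_projections; cbn; field.
Qed.

Lemma continuous_C (f g : R -> R) t : continuous f t -> continuous g t ->
  @continuous R_UniformSpace C_UniformSpace (fun s => (f s, g s)) t.
Proof.
  intros Hf Hg. apply (continuous_comp_2 f g (fun x y => (x, y))); auto.
  apply (continuous_ext (fun z => z)); [intros [x y]; reflexivity|apply continuous_id].
Qed.

Lemma is_derive_C (f g : R -> R) (t l m : R) : is_derive f t l -> is_derive g t m ->
  @is_derive R_AbsRing C_R_NormedModule (fun s => (f s, g s)) t (l, m).
Proof.
  intros Hf Hg.
  pose proof (is_derive_scal_l (V := C_R_NormedModule) f t l (1, 0) Hf) as H1.
  pose proof (is_derive_scal_l (V := C_R_NormedModule) g t m (0, 1) Hg) as H2.
  pose proof (is_derive_plus (V := C_R_NormedModule) _ _ _ _ _ H1 H2) as H.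
  match type of H with is_derive _ _ ?d => replace d with ((l, m) : C_R_NormedModule) in H end.
  - apply (is_derive_ext _ _ t (l, m)) with (2 := H). intros s.
    unfold plus, scal; cbn. unfold prod_plus, prod_scal, plus, scal; cbn. unfold mult; cbn.
    apply injective_projections; cbn; as_R_eq; ring.
  - unfold plus, scal; cbn. unfold prod_plus, prod_scal, plus, scal; cbn. unfold mult; cbn.
    apply injective_projections; cbn; as_R_eq; ring.
Qed.

Lemma is_derive_C_fst (f : R -> C) t l :
  @is_derive R_AbsRing C_R_NormedModule f t l -> is_derive (fun s => fst (f s)) t (fst l).
Proof.
  intros H. unfold is_derive in *.
  apply (filterdiff_ext_lin (U := R_NormedModule) (V := R_NormedModule) _ (fun y : R => fst (scal y l : C_R_NormedModule))); [|reflexivity].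
  apply (filterdiff_comp' (U := R_NormedModule) (V := C_R_NormedModule) (W := R_NormedModule) f fst t (fun y : R => scal y l) fst H).
  apply filterdiff_linear. apply (is_linear_fst (U := R_NormedModule) (V := R_NormedModule)).
Qed.
Lemma is_derive_C_snd (f : R -> C) t l :
  @is_derive R_AbsRing C_R_NormedModule f t l -> is_derive (fun s => snd (f s)) t (snd l).
Proof.
  intros H. unfold is_derive in *.
  apply (filterdiff_ext_lin (U := R_NormedModule) (V := R_NormedModule) _ (fun y : R => snd (scal y l : C_R_NormedModule))); [|reflexivity].
  apply (filterdiff_comp' (U := R_NormedModule) (V := C_R_NormedModule) (W := R_NormedModule) f snd t (fun y : R => scal y l) snd H).
  apply filterdiff_linear. apply (is_linear_snd (U := R_NormedModule) (V := R_NormedModule)).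
Qed.

Lemma entry_to_matrix g v i j : (i < 3)%nat -> (j < 3)%nat ->
  entry (to_matrix g v) i j = let '(a1, a2, b1, b2) := g in
  match i, j with
  | 0%nat, 0%nat => (a1, a2)
  | 0%nat, 1%nat => (b1, b2)
  | 1%nat, 0%nat => (b1, - b2)
  | 1%nat, 1%nat => (a1, - a2)
  | 2%nat, 2%nat => (exp v, 0)
  | _, _ => (0, 0)
  end.
Proof.
  intros Hi Hj. destruct g as [[[a1 a2] b1] b2].
  destruct i as [|[|[|i]]]; try lia; destruct j as [|[|[|j]]]; try lia; reflexivity.
Qed.

Definition mcurve (k : curve) (V : R -> R) (t : R) : mat3 := to_matrix (pos k t) (V t).
Definition mcontrol (k : curve) (X : R -> R) (t : R) : R * R * R := (cp k t, X t, cq k t).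

Lemma mat_continuous_mcurve k V a b :
  (forall t, a <= t <= b -> continuous (ca1 k) t /\ continuous (ca2 k) t /\ continuous (cb1 k) t /\ continuous (cb2 k) t /\ continuous V t) ->
  mat_continuous_on (mcurve k V) a b.
Proof.
  intros H i j Hi Hj. apply continuous_on_forall. intros t Ht. destruct (H t Ht) as (C1 & C2 & C3 & C4 & C5).
  assert (K : forall f g : R -> R, continuous f t -> continuous g t -> (forall s, entry (mcurve k V s) i j = (f s, g s)) ->
    @continuous R_UniformSpace C_UniformSpace (fun s => entry (mcurve k V s) i j) t).
  { intros f g Hf Hg E. apply (continuous_ext (fun s => (f s, g s) : C)); [intros; symmetry; apply E|now apply continuous_C]. }
  assert (E : forall s, entry (mcurve k V s) i j = entry (to_matrix (pos k s) (V s)) i j) by reflexivity.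
  pose proof (fun s => eq_trans (E s) (entry_to_matrix (pos k s) (V s) i j Hi Hj)) as E'. unfold pos in E'.
  destruct i as [|[|[|i]]]; try lia; destruct j as [|[|[|j]]]; try lia;
  (eapply K; [| |exact E']); try apply continuous_const; auto;
  try (apply (continuous_opp (V := R_NormedModule)); assumption).
  apply (continuous_comp V exp); auto. apply continuous_exp.
Qed.

Lemma mat_derive_mcurve k V X t :
  is_horizontal_at k t ->
  is_derive V t (X t) ->
  mat_derive (mcurve k V) t (mmul (mcurve k V t) (span_elt (mcontrol k X t))).
Proof.
  intros (D1 & D2 & D3 & D4) DV i j Hi Hj.
  unfold mcurve at 2, mcontrol. rewrite entry_tangent by auto.
  assert (K : forall f g l m, is_derive f t l -> is_derive g t m -> (forall s, entry (mcurve k V s) i j = (f s, g s)) ->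
    @is_derive R_AbsRing C_R_NormedModule (fun s => entry (mcurve k V s) i j) t (l, m)).
  { intros f g l m Hf Hg E. apply (is_derive_ext (V := C_R_NormedModule) (fun s => (f s, g s) : C_R_NormedModule)); [intros; symmetry; apply E|now apply is_derive_C]. }
  assert (E : forall s, entry (mcurve k V s) i j = entry (to_matrix (pos k s) (V s)) i j) by reflexivity.
  pose proof (fun s => eq_trans (E s) (entry_to_matrix (pos k s) (V s) i j Hi Hj)) as E'. unfold pos in E'.
  assert (D0 : is_derive (fun _ : R => 0) t 0) by (auto_derive; auto).
  assert (DN : forall f l, is_derive f t l -> is_derive (fun s : R => - f s) t (- l)) by (intros; now apply (is_derive_opp f)).
  assert (DE : is_derive (fun s => exp (V s)) t (X t * exp (V t))).
  { auto_derive; [exder|]. known_derive. ring. }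
  unfold tangent, pos.
  destruct i as [|[|[|i]]]; try lia; destruct j as [|[|[|j]]]; try lia;
  (eapply K; [| |exact E']); auto.
Qed.

(** * The distance *)

Lemma continuous_triple (f g h : R -> R) t : continuous f t -> continuous g t -> continuous h t ->
  continuous (fun s => (f s, g s, h s)) t.
Proof.
  intros Hf Hg Hh.
  assert (P : forall (U V W : UniformSpace) (x : U -> V) (y : U -> W) t, continuous x t -> continuous y t -> continuous (fun s => (x s, y s)) t).
  { intros U V W x y t' Hx Hy. apply (continuous_comp_2 x y (fun x y => (x, y))); auto.
    apply (continuous_ext (fun z => z)); [intros [? ?]; reflexivity|apply continuous_id]. }
  apply (P _ _ _ (fun s => (f s, g s)) h); auto.
Qed.

Lemma horizontal_curve_intro k V X a b n ts :
  horizontal k a b n ts -> (forall t, continuous V t) -> pw_continuous n ts X ->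
  (forall t, inside n ts t -> is_derive V t (X t)) ->
  horizontal_curve (mcurve k V) (mcontrol k X) a b.
Proof.
  intros (Hs & (C1 & C2 & C3 & C4) & HN & (HP & HQ) & HD) CV HX DV.
  refine (conj (subdivision_lt _ _ _ _ Hs) (conj _ (conj _ _))).
  - intros t _. apply SU11R_to_matrix, HN.
  - apply mat_continuous_mcurve. auto.
  - exists n, ts. split; [exact Hs|]. intros i Hi.
    destruct (HP i Hi) as (P & CP & EP), (HQ i Hi) as (Q & CQ & EQ), (HX i Hi) as (X' & CX & EX).
    exists (fun t => (P t, X' t, Q t)). split; [intros; apply continuous_triple; auto|].
    intros t Ht. split.
    + unfold mcontrol. now rewrite EP, EQ, EX.
    + assert (Hin : inside n ts t) by (exists i; auto). apply mat_derive_mcurve; auto.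
Qed.

Definition clamp (a b t : R) : R := Rmax (Rmin t b) a.
Lemma clamp_in a b t : a <= b -> a <= clamp a b t <= b.
Proof. intros. unfold clamp, Rmax, Rmin. repeat destruct Rle_dec; lra. Qed.
Lemma clamp_id a b t : a <= t <= b -> clamp a b t = t.
Proof. intros. unfold clamp, Rmax, Rmin. repeat destruct Rle_dec; lra. Qed.
Lemma continuous_clamp a b t : continuous (clamp a b) t.
Proof.
  unfold clamp. apply (Rcont_comp (fun t => Rmin t b) (fun y => Rmax y a)); [exact (continuous_Rmax a)|apply continuous_Rmin].
Qed.

(** Clamping the time to the interval gives components that are continuous on the whole line. *)
Lemma horizontal_curve_elim c u a b : horizontal_curve c u a b ->
  exists k V X n ts, horizontal k a b n ts /\ (forall t, continuous V t) /\ pw_continuous n ts X /\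
    (forall t, inside n ts t -> is_derive V t (X t)) /\
    (forall t, a <= t <= b -> c t = mcurve k V t) /\ u = mcontrol k X.
Proof.
  intros (Hab & HSU & HC & n & ts & Hs & HP).
  set (e := fun i j t => entry (c (clamp a b t)) i j).
  set (k := Curve (fun t => fst (e 0%nat 0%nat t)) (fun t => snd (e 0%nat 0%nat t))
    (fun t => fst (e 0%nat 1%nat t)) (fun t => snd (e 0%nat 1%nat t)) (fun t => fst (fst (u t))) (fun t => snd (u t))).
  set (V := fun t => ln (fst (e 2%nat 2%nat t))). set (X := fun t => snd (fst (u t))).
  assert (Hcl : forall t, c (clamp a b t) = to_matrix (pos k t) (V t) /\ in_su (pos k t) /\ 0 < fst (e 2%nat 2%nat t)).
  { intros t. destruct (SU11R_inv _ (HSU _ (clamp_in a b t ltac:(lra)))) as (g & v & Hg & E).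
    unfold pos, k, V, e; cbn [ca1 ca2 cb1 cb2]. rewrite E. destruct g as [[[a1 a2] b1] b2]. cbn.
    rewrite ln_exp. split; [reflexivity|]. split; [exact Hg|apply exp_pos]. }
  assert (Ce : forall i j, (i < 3)%nat -> (j < 3)%nat -> forall t, @continuous R_UniformSpace C_UniformSpace (e i j) t).
  { intros i j Hi Hj t. unfold e. specialize (HC i j Hi Hj (clamp a b t) (clamp_in a b t ltac:(lra))).
    apply (filterlim_comp _ _ _ (clamp a b) (fun t => entry (c t) i j) (locally t) (within (fun t => a <= t <= b) (locally (clamp a b t))) _); [|exact HC].
    intros P HPx. unfold within in HPx. generalize (continuous_clamp a b t _ HPx). unfold filtermap. apply filter_imp.
    intros x Hx. apply Hx, clamp_in. lra. }
  assert (C1 : forall i j, (i < 3)%nat -> (j < 3)%nat -> forall t, continuous (fun t => fst (e i j t)) t).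
  { intros i j Hi Hj t. apply (continuous_comp (V := C_UniformSpace) (e i j) fst); [apply Ce; auto|].
    destruct (e i j t). apply continuous_fst. }
  assert (C2 : forall i j, (i < 3)%nat -> (j < 3)%nat -> forall t, continuous (fun t => snd (e i j t)) t).
  { intros i j Hi Hj t. apply (continuous_comp (V := C_UniformSpace) (e i j) snd); [apply Ce; auto|].
    destruct (e i j t). apply continuous_snd. }
  exists k, V, X, n, ts.
  assert (HM : forall t, inside n ts t -> mat_derive (fun t => c (clamp a b t)) t (mmul (to_matrix (pos k t) (V t)) (span_elt (fst (fst (u t)), snd (fst (u t)), snd (u t))))).
  { intros t Ht. pose proof (inside_bounds _ _ _ _ _ Hs Ht) as Htb. destruct Ht as (i0 & Hi0 & Ht).
    destruct (HP i0 Hi0) as (w & _ & HW). destruct (HW t Ht) as (_ & HD).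
    destruct (Hcl t) as (E & _). rewrite clamp_id in E by lra. rewrite E in HD.
    replace (fst (fst (u t)), snd (fst (u t)), snd (u t)) with (u t) by (destruct (u t) as [[? ?] ?]; reflexivity).
    intros i j Hi Hj. specialize (HD i j Hi Hj).
    apply (is_derive_ext_loc (V := C_R_NormedModule)) with (2 := HD).
    apply (locally_interval _ t a b); simpl; try lra. intros y H1 H2. simpl in *. rewrite clamp_id by lra. reflexivity. }
  refine (conj _ (conj _ (conj _ (conj _ (conj _ _))))).
  - refine (conj Hs (conj _ (conj _ (conj _ _)))).
    + refine (conj _ (conj _ (conj _ _))); intros t; unfold k; cbn [ca1 ca2 cb1 cb2];
      [apply C1|apply C2|apply C1|apply C2]; lia.
    + intros t. apply Hcl.
    + split; intros i Hi; destruct (HP i Hi) as (w & Cw & HW).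
      * exists (fun t => fst (fst (w t))). split.
        -- intros t. apply (continuous_comp (fun t => fst (w t)) fst); [apply (continuous_comp w fst); [apply Cw|]|].
           ++ destruct (w t). apply continuous_fst.
           ++ destruct (w t) as [[? ?] ?]. apply continuous_fst.
        -- intros t Ht. destruct (HW t Ht) as (E & _). unfold k; cbn. now rewrite E.
      * exists (fun t => snd (w t)). split.
        -- intros t. apply (continuous_comp w snd); [apply Cw|]. destruct (w t). apply continuous_snd.
        -- intros t Ht. destruct (HW t Ht) as (E & _). unfold k; cbn. now rewrite E.
    + intros t Ht. pose proof (HM t Ht 0%nat 0%nat ltac:(lia) ltac:(lia)) as D0.
      pose proof (HM t Ht 0%nat 1%nat ltac:(lia) ltac:(lia)) as D1. rewrite entry_tangent in D0, D1 by lia.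
      refine (conj (is_derive_C_fst _ _ _ D0) (conj (is_derive_C_snd _ _ _ D0) (conj (is_derive_C_fst _ _ _ D1) (is_derive_C_snd _ _ _ D1)))).
  - intros t. unfold V. apply (continuous_ln_comp (fun t => fst (e 2%nat 2%nat t))); [apply C1; lia|apply Hcl].
  - intros i Hi; destruct (HP i Hi) as (w & Cw & HW).
    exists (fun t => snd (fst (w t))). split.
    + intros t. apply (continuous_comp (fun t => fst (w t)) snd); [apply (continuous_comp w fst); [apply Cw|]|].
      * destruct (w t). apply continuous_fst.
      * destruct (w t) as [[? ?] ?]. apply continuous_snd.
    + intros t Ht. destruct (HW t Ht) as (E & _). unfold X; cbn. now rewrite E.
  - intros t Ht. pose proof (HM t Ht 2%nat 2%nat ltac:(lia) ltac:(lia)) as D0. rewrite entry_tangent in D0 by lia.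
    apply is_derive_C_fst in D0. fold (e 2%nat 2%nat) in D0.
    change (is_derive (fun s => fst (e 2%nat 2%nat s)) t (X t * exp (V t))) in D0.
    destruct (Hcl t) as (_ & _ & Hp). unfold V in D0. rewrite exp_ln in D0 by auto.
    unfold V. set (f := fun s : R => fst (e 2%nat 2%nat s)) in *.
    apply (is_derive_ext (fun s => ln (f s))); [reflexivity|]. change (0 < f t) in Hp. change (is_derive f t (X t * f t)) in D0.
    auto_derive; [exder; auto|]. known_derive. field. lra.
  - intros t Ht. destruct (Hcl t) as (E & _). rewrite clamp_id in E by lra. exact E.
  - unfold mcontrol, k, X. cbn.
    assert (E : forall x : R * R * R, x = (fst (fst x), snd (fst x), snd x)) by (intros [[? ?] ?]; reflexivity).
    apply FunctionalExtensionality.functional_extensionality. intros t. apply E.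
Qed.

(** The speed of the product curve is at least the product of (|w|, V') with the unit vector
    proportional to (T, w - v). *)
Lemma length_lower c u a b g h v w T : horizontal_curve c u a b ->
  in_su g -> c a = to_matrix g v -> c b = to_matrix h w -> 0 <= T -> minimal (mul (inv g) h) T ->
  sqrt (T ^ 2 + (w - v) ^ 2) <= sr_length u a b.
Proof.
  intros Hc Hg Ha Hb HT HM.
  destruct (horizontal_curve_elim c u a b Hc) as (k & V & X & n & ts & Hh & CV & HX & DV & E & ->).
  pose proof Hh as (Hs & _ & _ & (HP & HQ) & _). pose proof (subdivision_lt _ _ _ _ Hs) as Hab.
  rewrite (E a ltac:(lra)) in Ha. rewrite (E b ltac:(lra)) in Hb.
  apply to_matrix_inj in Ha as [Ka Va]. apply to_matrix_inj in Hb as [Kb Vb].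
  destruct (primitive_exists a b n ts (speed k) Hs (pw_continuous_speed _ _ _ HP HQ)) as (S & HS & _).
  assert (HTS : T <= S b).
  { apply (HM (left_mul (inv g) k) a b n ts S).
    - apply horizontal_left_mul; auto. now apply in_su_inv.
    - rewrite pos_left_mul, Ka. rewrite <- (mul_unit_r g) at 2. now apply mul_inv_l.
    - now rewrite pos_left_mul, Kb.
    - apply (primitive_ext a n ts (speed k)); auto. intros; symmetry; apply speed_left_mul. }
  destruct (primitive_exists a b n ts (fun t => span_norm (mcontrol k X t)) Hs) as (L & HL & IL).
  { unfold span_norm, mcontrol. apply (pw_continuous_comp n ts sqrt (fun t => cp k t ^ 2 + X t ^ 2 + cq k t ^ 2)); [exact continuous_sqrt|].
    apply (pw_continuous_ext n ts (fun t => cp k t * cp k t + X t * X t + cq k t * cq k t)); [intros; ring|].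
    repeat apply pw_continuous_plus; apply pw_continuous_mult; auto. }
  unfold sr_length. rewrite (is_RInt_unique _ _ _ _ IL).
  set (N := sqrt (T ^ 2 + (w - v) ^ 2)).
  assert (HN2 : N * N = T ^ 2 + (w - v) ^ 2) by (apply sqrt_sqrt, Rplus_le_le_0_compat; apply pow2_ge_0).
  assert (HN0 : 0 <= N) by apply sqrt_pos.
  destruct HS as (CS & S0 & DS). destruct HL as (CL & L0 & DL).
  destruct (Req_dec N 0) as [->|HN].
  - rewrite <- L0. apply (pw_monotone L a b n ts Hs); auto; try lra.
    intros t Ht. eexists. split; [apply DL, Ht|]. apply sqrt_pos.
  - assert (K : T * S a + (w - v) * V a - N * L a >= T * S b + (w - v) * V b - N * L b).
    { apply Rle_ge. enough (- (T * S a + (w - v) * V a - N * L a) <= - (T * S b + (w - v) * V b - N * L b)) by lra.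
      apply (pw_monotone (fun t => - (T * S t + (w - v) * V t - N * L t)) a b n ts Hs); try lra; [cont|].
      intros t Ht. pose proof (DS t Ht). pose proof (DL t Ht). pose proof (DV t Ht).
      exists (N * span_norm (mcontrol k X t) - (T * speed k t + (w - v) * X t)). split.
      - auto_derive; [exder|].
        replace (Derive (fun x : R => S x) t) with (speed k t) by (symmetry; apply is_derive_unique; auto).
        replace (Derive (fun x : R => L x) t) with (span_norm (mcontrol k X t)) by (symmetry; apply (is_derive_unique L); auto).
        replace (Derive (fun x : R => V x) t) with (X t) by (symmetry; apply is_derive_unique; auto). ring.
      - pose proof (speed_sqr k t) as E2. pose proof (speed_nonneg k t).
        set (sp := speed k t) in *.
        assert (E3 : span_norm (mcontrol k X t) * span_norm (mcontrol k X t) = sp * sp + X t * X t).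
        { unfold span_norm, mcontrol. rewrite sqrt_sqrt by nra. rewrite E2. ring. }
        assert (E4 : 0 <= span_norm (mcontrol k X t)) by apply sqrt_pos.
        set (m := span_norm (mcontrol k X t)) in *.
        enough (T * sp + (w - v) * X t <= N * m) by lra.
        apply Rnot_lt_le. intros Q. assert (0 <= N * m) by nra.
        assert ((N * m) * (N * m) = (T * sp + (w - v) * X t) * (T * sp + (w - v) * X t) + (T * X t - (w - v) * sp) ^ 2).
        { transitivity ((N * N) * (m * m)); [ring|]. rewrite HN2, E3. ring. }
        assert (0 <= (T * X t - (w - v) * sp) ^ 2) by apply pow2_ge_0. nra. }
    rewrite S0, L0, Va, Vb in K.
    apply Rmult_le_reg_l with N; [lra|]. rewrite HN2.
    assert (T ^ 2 <= T * S b) by nra. nra.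
Qed.

(** Geodesics of the product are geodesics of SU(1,1) paired with linear functions. *)
Definition segment (g : point) (v kap th T x : R) : R -> mat3 :=
  mcurve (left_mul g (ray kap th T)) (fun t => v + x * t).
Definition segment_control (kap th T x : R) : R -> R * R * R := mcontrol (ray kap th T) (fun _ => x).

Lemma segment_at g v kap th T x t : segment g v kap th T x t = to_matrix (mul g (pos (ray kap th T) t)) (v + x * t).
Proof. unfold segment, mcurve. now rewrite pos_left_mul. Qed.

Definition one_piece (s t : R) (i : nat) : R := match i with O => s | _ => t end.
Lemma subdivision_one s t : s < t -> subdivision s t 0 (one_piece s t).
Proof. intros H. repeat split; auto. intros i Hi. replace i with 0%nat by lia. exact H. Qed.

Lemma horizontal_segment g v kap th T x s t : in_su g -> s < t ->
  horizontal_curve (segment g v kap th T x) (segment_control kap th T x) s t.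
Proof.
  intros Hg Hst. pose proof (smooth_left_mul g _ Hg (smooth_ray kap th T)) as Hsm.
  replace (segment_control kap th T x) with (mcontrol (left_mul g (ray kap th T)) (fun _ => x)).
  - apply horizontal_curve_intro with (n := 0%nat) (ts := one_piece s t).
    + apply smooth_horizontal; auto. now apply subdivision_one.
    + cont.
    + apply pw_continuous_of_continuous. cont.
    + intros y _. auto_derive; auto. ring.
  - destruct g as [[[a1 a2] b1] b2]. reflexivity.
Qed.

Lemma segment_length kap th T x s t : 0 <= T ->
  sr_length (segment_control kap th T x) s t = (t - s) * sqrt (T ^ 2 + x ^ 2).
Proof.
  intros HT. unfold sr_length. rewrite (RInt_ext _ (fun _ => sqrt (T ^ 2 + x ^ 2))).
  - rewrite RInt_const. reflexivity.
  - intros y _. unfold span_norm, segment_control, mcontrol. f_equal.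
    pose proof (speed_sqr (ray kap th T) y) as E. rewrite speed_ray in E by auto.
    transitivity (cp (ray kap th T) y ^ 2 + cq (ray kap th T) y ^ 2 + x ^ 2); [ring|rewrite <- E; ring].
Qed.

Lemma d2_set_lower g v h w c u a b : in_su g -> in_su h -> horizontal_curve c u a b ->
  c a = to_matrix g v -> c b = to_matrix h w -> 0 <= sr_length u a b.
Proof.
  intros Hg Hh Hc Ha Hb.
  destruct (geodesic_exists (mul (inv g) h)) as (kap & th & T & HT & _ & HM).
  { apply in_su_mul; auto. now apply in_su_inv. }
  exact (Rle_trans _ _ _ (sqrt_pos _) (length_lower c u a b g h v w T Hc Hg Ha Hb HT HM)).
Qed.

Lemma d2_le g v h w c u a b : in_su g -> in_su h -> horizontal_curve c u a b ->
  c a = to_matrix g v -> c b = to_matrix h w -> d2 (to_matrix g v) (to_matrix h w) <= sr_length u a b.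
Proof.
  intros Hg Hh Hc Ha Hb. unfold d2.
  match goal with |- real (Glb_Rbar ?E) <= _ => set (S := E) end.
  destruct (Glb_Rbar_correct S) as (K1 & K2).
  assert (L0 : Rbar_le 0 (Glb_Rbar S)).
  { apply K2. intros x (c' & u' & a' & b' & H1 & H2 & H3 & ->). exact (d2_set_lower g v h w c' u' a' b' Hg Hh H1 H2 H3). }
  assert (LS : Rbar_le (Glb_Rbar S) (sr_length u a b)) by (apply K1; exists c, u, a, b; auto).
  destruct (Glb_Rbar S); simpl in *; auto; lra.
Qed.

Lemma d2_ge g v h w T kap th : in_su g -> in_su h -> 0 <= T -> minimal (mul (inv g) h) T ->
  pos (ray kap th T) 1 = mul (inv g) h ->
  sqrt (T ^ 2 + (w - v) ^ 2) <= d2 (to_matrix g v) (to_matrix h w).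
Proof.
  intros Hg Hh HT HM HR. unfold d2.
  match goal with |- _ <= real (Glb_Rbar ?E) => set (S := E) end.
  destruct (Glb_Rbar_correct S) as (K1 & K2).
  assert (L0 : Rbar_le (sqrt (T ^ 2 + (w - v) ^ 2)) (Glb_Rbar S)).
  { apply K2. intros x (c' & u' & a' & b' & H1 & H2 & H3 & ->). exact (length_lower c' u' a' b' g h v w T H1 Hg H2 H3 HT HM). }
  assert (LS : Rbar_le (Glb_Rbar S) (sr_length (segment_control kap th T (w - v)) 0 1)).
  { apply K1. exists (segment g v kap th T (w - v)), (segment_control kap th T (w - v)), 0, 1.
    split; [apply horizontal_segment; auto; lra|]. rewrite !segment_at, pos_ray_0, mul_unit_r, HR, mul_inv_r by auto.
    repeat split; f_equal; ring. }
  destruct (Glb_Rbar S); simpl in *; auto; lra.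
Qed.

Lemma d2_segment_le g v kap th T x s t : in_su g -> 0 <= T -> s < t ->
  d2 (segment g v kap th T x s) (segment g v kap th T x t) <= (t - s) * sqrt (T ^ 2 + x ^ 2).
Proof.
  intros Hg HT Hst. rewrite <- (segment_length kap th T x s t HT).
  pose proof (smooth_ray kap th T) as (_ & HN & _).
  rewrite !segment_at. eapply d2_le; try (apply in_su_mul; auto); [apply horizontal_segment; eauto| |]; apply segment_at.
Qed.

Lemma d2_formula g v h w T kap th : in_su g -> in_su h -> 0 <= T -> minimal (mul (inv g) h) T ->
  pos (ray kap th T) 1 = mul (inv g) h ->
  d2 (to_matrix g v) (to_matrix h w) = sqrt (T ^ 2 + (w - v) ^ 2).
Proof.
  intros Hg Hh HT HM HR. apply Rle_antisym; [|eapply d2_ge; eauto].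
  pose proof (d2_segment_le g v kap th T (w - v) 0 1 Hg HT ltac:(lra)) as K.
  rewrite !segment_at, pos_ray_0, mul_unit_r, HR, mul_inv_r in K by auto.
  replace (v + (w - v) * 0) with v in K by ring. replace (v + (w - v) * 1) with w in K by ring. lra.
Qed.

(** * Shortest arcs *)

(** Both functions are used on the interval from 0 to 1; the second one follows the first. *)
Definition glue (f g : R -> R) (t : R) : R := if Rle_dec t 1 then f t else g (t - 1).

Lemma continuous_glue f g : (forall t, continuous f t) -> (forall t, continuous g t) -> f 1 = g 0 ->
  forall t, continuous (glue f g) t.
Proof.
  intros Hf Hg E t. apply (continuous_ext (fun t => f (Rmin t 1) + g (Rmax t 1 - 1) - g 0)).
  - intros x. unfold glue. destruct Rle_dec.
    + rewrite Rmin_left, Rmax_right by lra. replace (1 - 1) with 0 by ring. as_R_eq. ring.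
    + rewrite Rmin_right, Rmax_left by lra. as_R_eq. rewrite E. ring.
  - cont.
Qed.

Definition two_pieces (i : nat) : R := match i with O => 0 | S O => 1 | _ => 2 end.
Lemma subdivision_two : subdivision 0 2 1 two_pieces.
Proof. repeat split; auto. intros i Hi. destruct i as [|[|i]]; simpl; try lra. lia. Qed.
Lemma inside_two t : inside 1 two_pieces t -> 0 < t < 1 \/ 1 < t < 2.
Proof. intros (i & Hi & Ht). destruct i as [|[|i]]; simpl in Ht; try lia; auto. Qed.

Lemma pw_continuous_glue f g : (forall t, continuous f t) -> (forall t, continuous g t) -> pw_continuous 1 two_pieces (glue f g).
Proof.
  intros Hf Hg i Hi. destruct i as [|[|i]]; try lia.
  - exists f. split; auto. simpl. intros t Ht. unfold glue. destruct Rle_dec; [reflexivity|lra].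
  - exists (fun t => g (t - 1)). split; [intros; cont|]. simpl. intros t Ht. unfold glue. destruct Rle_dec; [lra|reflexivity].
Qed.

Lemma is_derive_glue f g t l m : (t < 1 -> is_derive f t l) -> (1 < t -> is_derive g (t - 1) m) ->
  0 < t < 1 \/ 1 < t < 2 -> is_derive (glue f g) t (if Rle_dec t 1 then l else m).
Proof.
  intros Hf Hg [Ht|Ht]; destruct Rle_dec; try lra.
  - apply (is_derive_ext_loc f); [|apply Hf; lra].
    apply (locally_interval _ t m_infty 1); simpl; try lra; auto.
    intros y _ Hy. simpl in Hy. unfold glue. destruct Rle_dec; [reflexivity|lra].
  - apply (is_derive_ext_loc (fun t => g (t - 1))).
    + apply (locally_interval _ t 1 p_infty); simpl; try lra; auto.
      intros y Hy _. simpl in Hy. unfold glue. destruct Rle_dec; [lra|reflexivity].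
    + replace m with (1 * m) by ring. apply (is_derive_comp g (fun t => t - 1)); [apply Hg; lra|].
      auto_derive; [auto|ring].
Qed.

Definition join (k1 k2 : curve) : curve := Curve
  (glue (ca1 k1) (ca1 k2)) (glue (ca2 k1) (ca2 k2)) (glue (cb1 k1) (cb1 k2)) (glue (cb2 k1) (cb2 k2))
  (glue (cp k1) (cp k2)) (glue (cq k1) (cq k2)).

Lemma glue_left f g t : t <= 1 -> glue f g t = f t.
Proof. intros; unfold glue; destruct Rle_dec; [reflexivity|lra]. Qed.
Lemma glue_right f g t : 1 < t -> glue f g t = g (t - 1).
Proof. intros; unfold glue; destruct Rle_dec; [lra|reflexivity]. Qed.

Lemma pos_join_left k1 k2 t : t <= 1 -> pos (join k1 k2) t = pos k1 t.
Proof. intros; unfold pos; simpl; now rewrite !glue_left by auto. Qed.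
Lemma pos_join_right k1 k2 t : 1 < t -> pos (join k1 k2) t = pos k2 (t - 1).
Proof. intros; unfold pos; simpl; now rewrite !glue_right by auto. Qed.
Lemma speed_join k1 k2 t : speed (join k1 k2) t = glue (speed k1) (speed k2) t.
Proof. unfold speed, glue; simpl. unfold glue. destruct Rle_dec; reflexivity. Qed.

Lemma horizontal_join k1 k2 : smooth k1 -> smooth k2 -> pos k1 1 = pos k2 0 ->
  horizontal (join k1 k2) 0 2 1 two_pieces.
Proof.
  intros ((A1 & A2 & A3 & A4) & N1 & (P1 & Q1) & D1) ((B1 & B2 & B3 & B4) & N2 & (P2 & Q2) & D2) E.
  unfold pos in E. injection E as E1 E2 E3 E4.
  refine (conj subdivision_two (conj _ (conj _ (conj _ _)))).
  - refine (conj _ (conj _ (conj _ _))); simpl; apply continuous_glue; auto.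
  - intros t. change (in_su (pos (join k1 k2) t)). destruct (Rle_dec t 1).
    + now rewrite pos_join_left.
    + rewrite pos_join_right by lra. auto.
  - split; simpl; apply pw_continuous_glue; auto.
  - intros t Ht. apply inside_two in Ht. destruct (D1 t) as (X1 & X2 & X3 & X4). destruct (D2 (t - 1)) as (Y1 & Y2 & Y3 & Y4).
    unfold is_horizontal_at. refine (conj _ (conj _ (conj _ _))); simpl;
    (eapply is_derive_eq; [apply is_derive_glue; [intros _; eassumption|intros _; eassumption|exact Ht]|
      unfold glue; destruct Rle_dec; reflexivity]).
Qed.

Lemma primitive_join k1 k2 T1 T2 : (forall t, speed k1 t = T1) -> (forall t, speed k2 t = T2) ->
  primitive 0 1 two_pieces (speed (join k1 k2)) (glue (fun t => T1 * t) (fun t => T1 + T2 * t)).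
Proof.
  intros H1 H2. refine (conj _ (conj _ _)).
  - apply continuous_glue; [cont|cont|as_R_eq; ring].
  - rewrite glue_left by lra. as_R_eq. ring.
  - intros t Ht. apply inside_two in Ht. rewrite speed_join.
    eapply is_derive_eq; [apply (is_derive_glue _ _ t T1 T2)|]; auto.
    + intros _. auto_derive; auto. ring.
    + intros _. auto_derive; auto. ring.
    + unfold glue. rewrite H1, H2. reflexivity.
Qed.

Lemma is_RInt_constant (c x y l : R) : l = (y - x) * c -> is_RInt (fun _ => c) x y l.
Proof. intros ->. apply (is_RInt_const (V := R_NormedModule)). Qed.

Lemma d2_geodesic g v h w : in_su g -> in_su h -> exists kap th T, 0 <= T /\
  pos (ray kap th T) 1 = mul (inv g) h /\ minimal (mul (inv g) h) T /\
  d2 (to_matrix g v) (to_matrix h w) = sqrt (T ^ 2 + (w - v) ^ 2) /\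
  segment g v kap th T (w - v) 0 = to_matrix g v /\ segment g v kap th T (w - v) 1 = to_matrix h w.
Proof.
  intros Hg Hh. destruct (geodesic_exists (mul (inv g) h)) as (kap & th & T & HT & HR & HM).
  { apply in_su_mul; auto. now apply in_su_inv. }
  exists kap, th, T. split; [auto|]. split; [auto|]. split; [auto|]. split; [eapply d2_formula; eauto|].
  rewrite !segment_at, pos_ray_0, HR, mul_unit_r, mul_inv_r by auto. split; f_equal; ring.
Qed.

(** The two distances are attained by explicit geodesics, and only these are concatenated. *)
Lemma d2_triangle G H K : SU11R G -> SU11R H -> SU11R K -> d2 G K <= d2 G H + d2 H K.
Proof.
  intros HG HH HK.
  destruct (SU11R_inv _ HG) as (g & u & Hg & ->), (SU11R_inv _ HH) as (h & v & Hh & ->), (SU11R_inv _ HK) as (k & w & Hk & ->).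
  destruct (d2_geodesic g u h v Hg Hh) as (k1 & th1 & T1 & HT1 & R1 & _ & -> & _).
  destruct (d2_geodesic h v k w Hh Hk) as (k2 & th2 & T2 & HT2 & R2 & _ & -> & _).
  set (c1 := left_mul g (ray k1 th1 T1)). set (c2 := left_mul h (ray k2 th2 T2)).
  assert (S1 : smooth c1) by (apply smooth_left_mul, smooth_ray; auto).
  assert (S2 : smooth c2) by (apply smooth_left_mul, smooth_ray; auto).
  assert (E : pos c1 1 = pos c2 0).
  { unfold c1, c2. now rewrite !pos_left_mul, R1, pos_ray_0, mul_unit_r, mul_inv_r. }
  set (V := glue (fun t => u + (v - u) * t) (fun t => v + (w - v) * t)).
  set (X := glue (fun _ => v - u) (fun _ => w - v)).
  assert (HC : horizontal_curve (mcurve (join c1 c2) V) (mcontrol (join c1 c2) X) 0 2).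
  { apply horizontal_curve_intro with (n := 1%nat) (ts := two_pieces).
    - now apply horizontal_join.
    - apply continuous_glue; [cont|cont|as_R_eq; ring].
    - apply pw_continuous_glue; cont.
    - intros t Ht. apply inside_two in Ht. unfold V, X.
      eapply is_derive_eq; [apply (is_derive_glue _ _ t (v - u) (w - v)); auto; intros _; auto_derive; auto; ring|].
      unfold glue. reflexivity. }
  assert (HL : sr_length (mcontrol (join c1 c2) X) 0 2 = sqrt (T1 ^ 2 + (v - u) ^ 2) + sqrt (T2 ^ 2 + (w - v) ^ 2)).
  { unfold sr_length.
    assert (Sp : forall t, span_norm (mcontrol (join c1 c2) X t) = sqrt (speed (join c1 c2) t ^ 2 + X t ^ 2)).
    { intros t. unfold span_norm, mcontrol. f_equal. pose proof (speed_sqr (join c1 c2) t). lra. }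
    assert (I1 : is_RInt (fun t => span_norm (mcontrol (join c1 c2) X t)) 0 1 (sqrt (T1 ^ 2 + (v - u) ^ 2))).
    { apply (is_RInt_ext (fun _ => sqrt (T1 ^ 2 + (v - u) ^ 2))).
      - rewrite Rmin_left, Rmax_right by lra. intros t Ht. rewrite Sp, speed_join. unfold X. rewrite !glue_left by lra.
        unfold c1. rewrite speed_left_mul, speed_ray by auto. reflexivity.
      - apply is_RInt_constant. ring. }
    assert (I2 : is_RInt (fun t => span_norm (mcontrol (join c1 c2) X t)) 1 2 (sqrt (T2 ^ 2 + (w - v) ^ 2))).
    { apply (is_RInt_ext (fun _ => sqrt (T2 ^ 2 + (w - v) ^ 2))).
      - rewrite Rmin_left, Rmax_right by lra. intros t Ht. rewrite Sp, speed_join. unfold X. rewrite !glue_right by lra.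
        unfold c2. rewrite speed_left_mul, speed_ray by auto. reflexivity.
      - apply is_RInt_constant. ring. }
    apply is_RInt_unique. apply (is_RInt_Chasles _ _ _ _ _ _ I1 I2). }
  rewrite <- HL. apply (d2_le g u k w _ _ 0 2 Hg Hk HC); unfold mcurve.
  - rewrite pos_join_left by lra. unfold c1. rewrite pos_left_mul, pos_ray_0, mul_unit_r.
    f_equal. unfold V. rewrite glue_left by lra. ring.
  - rewrite pos_join_right by lra. unfold c2. rewrite pos_left_mul. replace (2 - 1) with 1 by ring.
    rewrite R2, mul_inv_r by auto. f_equal. unfold V. rewrite glue_right by lra. ring.
Qed.

Lemma d2_nonneg G H : SU11R G -> SU11R H -> 0 <= d2 G H.
Proof.
  intros HG HH. destruct (SU11R_inv _ HG) as (g & u & Hg & ->), (SU11R_inv _ HH) as (h & v & Hh & ->).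
  destruct (d2_geodesic g u h v Hg Hh) as (k1 & th1 & T1 & _ & _ & _ & -> & _). apply sqrt_pos.
Qed.

Lemma pos_ray_speed0 kap th t : pos (ray kap th 0) t = unit_pt.
Proof.
  unfold pos, ray, unit_pt; simpl. rewrite !Rmult_0_r, !Rmult_0_l, gcos_0, gsin_0.
  replace (0 / 2) with 0 by field. rewrite cos_0, sin_0. apply pt_eq; field.
Qed.

Lemma d2_refl G : SU11R G -> d2 G G = 0.
Proof.
  intros HG. destruct (SU11R_inv _ HG) as (g & u & Hg & ->).
  assert (E : mul (inv g) g = unit_pt) by (rewrite <- (mul_unit_r g) at 2; now apply mul_inv_l).
  rewrite (d2_formula g u g u 0 0 0); auto; try lra.
  - rewrite Rminus_diag. replace (0 ^ 2 + 0 ^ 2) with 0 by ring. apply sqrt_0.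
  - rewrite E. apply minimal_unit.
  - rewrite E. apply pos_ray_speed0.
Qed.

(** Minimality of length in terms of the distance from the starting point alone. *)
Definition additive (c : R -> mat3) (a b : R) : Prop :=
  forall s t, a <= s -> s <= t -> t <= b -> d2 (c s) (c t) = d2 (c a) (c t) - d2 (c a) (c s).

Lemma additive_length c a b : a < b -> (forall t, a <= t <= b -> SU11R (c t)) -> additive c a b ->
  curve_length c a b = Finite (d2 (c a) (c b)).
Proof.
  intros Hab HSU HA. unfold curve_length. apply is_lub_Rbar_unique.
  assert (K : forall n ts, subdivision a b n ts ->
    sum_n (fun i => d2 (c (ts i)) (c (ts (S i)))) n = d2 (c a) (c b)).
  { intros n ts Hs. pose proof (subdivision_mono _ _ _ _ Hs) as Hm. destruct Hs as (Ha & Hb & Hs).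
    assert (Q : forall i, (i <= n)%nat -> sum_n (fun i => d2 (c (ts i)) (c (ts (S i)))) i = d2 (c a) (c (ts (S i)))).
    { induction i as [|i IH]; intros Hi.
      - rewrite sum_O, Ha. reflexivity.
      - rewrite sum_Sn, IH by lia. unfold plus; simpl.
        rewrite (HA (ts (S i)) (ts (S (S i)))).
        + ring.
        + rewrite <- Ha. apply Hm; lia.
        + apply Hm; lia.
        + rewrite <- Hb. apply Hm; lia. }
    rewrite Q by lia. now rewrite Hb. }
  split.
  - intros x (n & ts & Hs & ->). rewrite K by auto. apply Rle_refl.
  - intros l Hl. apply Hl. exists 0%nat, (one_piece a b). split; [now apply subdivision_one|].
    symmetry. apply K. now apply subdivision_one.
Qed.

Lemma shortest_additive c a b : shortest_arc c a b -> additive c a b.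
Proof.
  intros (Hab & HSU & _ & HL).
  assert (Hub : forall n ts, subdivision a b n ts ->
    sum_n (fun i => d2 (c (ts i)) (c (ts (S i)))) n <= d2 (c a) (c b)).
  { intros n ts Hs. unfold curve_length in HL.
    match type of HL with Lub_Rbar ?E = _ => destruct (Lub_Rbar_correct E) as (K & _) end.
    rewrite HL in K. apply (K _). exists n, ts. auto. }
  assert (H2 : forall s, a <= s <= b -> d2 (c a) (c s) + d2 (c s) (c b) <= d2 (c a) (c b)).
  { intros s Hs. destruct (Req_dec s a) as [->|]; [rewrite d2_refl by auto; lra|].
    destruct (Req_dec s b) as [->|]; [rewrite (d2_refl (c b)) by auto; lra|].
    specialize (Hub 1%nat (fun i => match i with O => a | S O => s | _ => b end)).
    rewrite sum_Sn, sum_O in Hub. apply Hub. repeat split; auto.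
    intros i Hi. destruct i as [|[|i]]; simpl; try lia; lra. }
  assert (H3 : forall s t, a <= s -> s <= t -> t <= b ->
     d2 (c a) (c s) + d2 (c s) (c t) + d2 (c t) (c b) <= d2 (c a) (c b)).
  { intros s t H1 H3 H4.
    destruct (Req_dec s a) as [->|]; [rewrite d2_refl by (apply HSU; lra); specialize (H2 t); lra|].
    destruct (Req_dec t b) as [->|]; [rewrite (d2_refl (c b)) by (apply HSU; lra); specialize (H2 s); lra|].
    destruct (Req_dec s t) as [->|]; [rewrite (d2_refl (c t)) by (apply HSU; lra); specialize (H2 t); lra|].
    specialize (Hub 2%nat (fun i => match i with O => a | S O => s | S (S O) => t | _ => b end)).
    rewrite !sum_Sn, sum_O in Hub. apply Hub. repeat split; auto.
    intros i Hi. destruct i as [|[|[|i]]]; simpl; try lia; lra. }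
  intros s t H1 H4 H5. specialize (H3 s t H1 H4 H5).
  pose proof (d2_triangle (c a) (c s) (c t) (HSU a ltac:(lra)) (HSU s ltac:(lra)) (HSU t ltac:(lra))).
  pose proof (d2_triangle (c a) (c t) (c b) (HSU a ltac:(lra)) (HSU t ltac:(lra)) (HSU b ltac:(lra))). lra.
Qed.

Lemma continuous_segment g v kap th T x s t : mat_continuous_on (segment g v kap th T x) s t.
Proof.
  apply mat_continuous_mcurve. intros y _.
  destruct (smooth_ray kap th T) as ((C1 & C2 & C3 & C4) & _).
  set (k := ray kap th T) in *. clearbody k.
  destruct g as [[[a1 a2] b1] b2]. simpl. refine (conj _ (conj _ (conj _ (conj _ _)))); cont.
Qed.

Lemma segment_SU g v kap th T x t : in_su g -> SU11R (segment g v kap th T x t).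
Proof.
  intros Hg. rewrite segment_at. apply SU11R_to_matrix, in_su_mul; auto. apply (smooth_ray kap th T).
Qed.

(** The upper bounds for the three parts of the segment add up to the distance of its ends. *)
Lemma segment_dist g v kap th T x : in_su g -> 0 <= T ->
  sqrt (T ^ 2 + x ^ 2) <= d2 (segment g v kap th T x 0) (segment g v kap th T x 1) ->
  forall s t, 0 <= s -> s <= t -> t <= 1 ->
  d2 (segment g v kap th T x s) (segment g v kap th T x t) = (t - s) * sqrt (T ^ 2 + x ^ 2).
Proof.
  intros Hg HT Hd s t H0 Hst H1. set (c := segment g v kap th T x) in *. set (N := sqrt (T ^ 2 + x ^ 2)) in *.
  assert (SU : forall y, SU11R (c y)) by (intros; now apply segment_SU).
  assert (Up : forall y z, y <= z -> d2 (c y) (c z) <= (z - y) * N).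
  { intros y z Hyz. destruct (Req_dec y z) as [->|].
    - rewrite d2_refl by auto. lra.
    - apply d2_segment_le; auto. lra. }
  pose proof (Up 0 s H0). pose proof (Up s t Hst). pose proof (Up t 1 H1).
  pose proof (d2_triangle (c 0) (c s) (c 1) (SU _) (SU _) (SU _)).
  pose proof (d2_triangle (c s) (c t) (c 1) (SU _) (SU _) (SU _)). lra.
Qed.

Lemma segment_shortest g v kap th T x : in_su g -> 0 <= T ->
  sqrt (T ^ 2 + x ^ 2) <= d2 (segment g v kap th T x 0) (segment g v kap th T x 1) ->
  shortest_arc (segment g v kap th T x) 0 1.
Proof.
  intros Hg HT Hd. pose proof (segment_dist g v kap th T x Hg HT Hd) as D.
  refine (conj Rlt_0_1 (conj _ (conj _ _))).
  - intros; now apply segment_SU.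
  - apply continuous_segment.
  - apply additive_length; [lra|intros; now apply segment_SU|].
    intros s t H0 H1 H2. rewrite !D by lra. ring.
Qed.

Definition extend (c1 c2 : R -> mat3) (b t : R) : mat3 := if Rle_dec t b then c1 t else c2 (t - b).

Lemma continuous_extend c1 c2 a b : a < b -> mat_continuous_on c1 a b -> mat_continuous_on c2 0 1 ->
  c1 b = c2 0 -> mat_continuous_on (extend c1 c2 b) a (b + 1).
Proof.
  intros Hab H1 H2 E i j Hi Hj x Hx P HP.  cbv beta in Hx.
  specialize (H1 i j Hi Hj). specialize (H2 i j Hi Hj).
  assert (K1 : x <= b -> locally x (fun y => a <= y <= b -> P (entry (extend c1 c2 b y) i j))).
  { intros Hxb. unfold extend in HP. destruct (Rle_dec x b); [|lra].
    specialize (H1 x ltac:(lra) P HP). revert H1. unfold filtermap, within. apply filter_imp.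
    intros y Hy Hyb. unfold extend. destruct (Rle_dec y b); [auto|lra]. }
  assert (K2 : b <= x -> locally x (fun y => b < y <= b + 1 -> P (entry (extend c1 c2 b y) i j))).
  { intros Hxb.
    assert (HP' : locally (entry (c2 (x - b)) i j) P).
    { unfold extend in HP. destruct (Rle_dec x b); [|exact HP]. replace x with b in * by lra.
      rewrite E in HP. replace (b - b) with 0 by ring. exact HP. }
    specialize (H2 (x - b) ltac:(lra) P HP').
    assert (Cs : continuous (fun y => y - b) x) by cont.
    specialize (Cs _ H2). revert Cs. unfold filtermap. apply filter_imp.
    intros y Hy Hyb. unfold extend. destruct (Rle_dec y b); [lra|]. apply Hy. lra. }
  unfold filtermap, within.
  destruct (Rtotal_order x b) as [L|[L|L]].
  - assert (Lb : locally x (fun y => y < b)) by (apply (open_lt b); auto).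
    generalize (filter_and _ _ (K1 (Rlt_le _ _ L)) Lb). apply filter_imp. intros y (A & B) Hy. apply A. cbv beta in Hy. lra.
  - generalize (filter_and _ _ (K1 (Req_le _ _ L)) (K2 (Req_le _ _ (eq_sym L)))). apply filter_imp. intros y (A & B) Hy.
    cbv beta in Hy. destruct (Rle_dec y b); [apply A|apply B]; lra.
  - assert (Lb : locally x (fun y => b < y)) by (apply (open_gt b); auto).
    generalize (filter_and _ _ (K2 (Rlt_le _ _ L)) Lb). apply filter_imp. intros y (A & B) Hy. apply A. cbv beta in Hy. lra.
Qed.

Lemma SU11R_Id : SU11R Id3.
Proof. rewrite Id3_to_matrix. apply SU11R_to_matrix, in_su_unit. Qed.

(** A shortest arc to G followed by one from G to a point H with equality in the triangle
    inequality is again a shortest arc; conversely the endpoint of a longer arc is such a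
    point H. *)
Lemma Cut2_characterization G : Cut2 G <->
  SU11R G /\ forall H, SU11R H -> d2 Id3 H = d2 Id3 G + d2 G H -> d2 G H = 0.
Proof.
  split.
  - intros (c & a & b & Hsh & Ha & Hb & Hnc).
    pose proof Hsh as (Hab & HSU & HC & HL). pose proof (shortest_additive _ _ _ Hsh) as HA.
    assert (HG : SU11R G) by (rewrite <- Hb; apply HSU; lra). split; [exact HG|].
    intros H HH E. apply Rle_antisym; [|now apply d2_nonneg]. apply Rnot_lt_le. intros Hpos. apply Hnc.
    destruct (SU11R_inv _ HG) as (g & u & Hg & EG), (SU11R_inv _ HH) as (h & v & Hh & EH).
    destruct (d2_geodesic g u h v Hg Hh) as (kap & th & T & HT & _ & _ & Ed & E0 & E1).
    rewrite <- EG, <- EH in Ed. rewrite <- EG in E0. rewrite <- EH in E1.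
    set (c2 := segment g u kap th T (v - u)) in *.
    assert (D : forall s t, 0 <= s -> s <= t -> t <= 1 -> d2 (c2 s) (c2 t) = (t - s) * d2 G H).
    { intros. rewrite Ed. apply segment_dist; auto. fold c2. rewrite E0, E1, Ed. lra. }
    assert (SU2 : forall t, SU11R (c2 t)) by (intros; now apply segment_SU).
    set (c' := extend c c2 b).
    assert (Cl : forall t, t <= b -> c' t = c t) by (intros; unfold c', extend; destruct Rle_dec; [auto|lra]).
    assert (Cr : forall t, b <= t -> c' t = c2 (t - b)).
    { intros t Ht. unfold c', extend; destruct Rle_dec; [|auto]. replace t with b by lra.
      rewrite Hb, <- E0. f_equal. ring. }
    assert (SU' : forall t, a <= t <= b + 1 -> SU11R (c' t)).
    { intros t Ht. destruct (Rle_dec t b); [rewrite Cl by auto; apply HSU; lra|rewrite Cr by lra; auto]. }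
    assert (Ca : c' a = Id3) by (rewrite Cl; [exact Ha|lra]).
    assert (Cb : c' b = G) by (rewrite Cl; [exact Hb|lra]).
    assert (Ce : c' (b + 1) = H) by (rewrite Cr by lra; rewrite <- E1; f_equal; ring).
    rewrite <- Ca, <- Cb, <- Ce in E.
    assert (Add2 : forall t, b <= t <= b + 1 -> d2 (c' a) (c' t) = d2 (c' a) (c' b) + d2 (c' b) (c' t) /\ d2 (c' t) (c' (b + 1)) = d2 (c' b) (c' (b + 1)) - d2 (c' b) (c' t)).
    { intros t Ht.
      assert (Q : d2 (c' t) (c' (b + 1)) = d2 (c' b) (c' (b + 1)) - d2 (c' b) (c' t)).
      { rewrite !Cr by lra. rewrite !D by lra. ring. }
      pose proof (d2_triangle (c' a) (c' b) (c' t) (SU' a ltac:(lra)) (SU' b ltac:(lra)) (SU' t ltac:(lra))).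
      pose proof (d2_triangle (c' a) (c' t) (c' (b+1)) (SU' a ltac:(lra)) (SU' t ltac:(lra)) (SU' (b+1) ltac:(lra))).
      split; [lra|exact Q]. }
    assert (Add : additive c' a (b + 1)).
    { intros s t H1 H2 H3. destruct (Rle_dec t b).
      - rewrite !Cl by lra. apply HA; lra.
      - destruct (Rle_dec b s).
        + destruct (Add2 s ltac:(lra)) as (A1 & _). destruct (Add2 t ltac:(lra)) as (A2 & _). rewrite A1, A2.
          rewrite (Cr s), (Cr t), (Cr b) by lra. rewrite !D by lra. ring.
        + destruct (Add2 t ltac:(lra)) as (A2 & _). rewrite A2.
          assert (Q : d2 (c' s) (c' b) = d2 (c' a) (c' b) - d2 (c' a) (c' s)) by (rewrite !Cl by lra; apply HA; lra).
          pose proof (d2_triangle (c' s) (c' b) (c' t) (SU' s ltac:(lra)) (SU' b ltac:(lra)) (SU' t ltac:(lra))).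
          pose proof (d2_triangle (c' a) (c' s) (c' t) (SU' a ltac:(lra)) (SU' s ltac:(lra)) (SU' t ltac:(lra))).
          lra. }
    exists c', (b + 1). split; [lra|]. split; [intros; apply Cl; lra|].
    pose proof (additive_length c' a (b + 1) ltac:(lra) SU' Add) as L'.
    split.
    + refine (conj _ (conj SU' (conj _ L'))); [lra|].
      apply continuous_extend; auto; [apply continuous_segment|]. now rewrite Hb.
    + rewrite HL, L', Ha, Hb. rewrite Ca, Cb, Ce in *. simpl. lra.
  - intros (HG & Hno). destruct (SU11R_inv _ HG) as (g & u & Hg & EG).
    destruct (d2_geodesic unit_pt 0 g u in_su_unit Hg) as (kap & th & T & HT & _ & _ & Ed & E0 & E1).
    set (c := segment unit_pt 0 kap th T (u - 0)) in *.
    assert (Hsh : shortest_arc c 0 1).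
    { apply segment_shortest; [apply in_su_unit|auto|]. fold c. rewrite E0, E1, Ed. lra. }
    exists c, 0, 1. rewrite Id3_to_matrix, EG. split; [exact Hsh|]. split; [exact E0|]. split; [exact E1|].
    intros (c' & b' & Hb & Hc & Hsh' & Hlt).
    pose proof (shortest_additive _ _ _ Hsh') as HA. pose proof Hsh' as (_ & SU' & _ & L').
    pose proof Hsh as (_ & _ & _ & L). rewrite L, L' in Hlt. simpl in Hlt.
    assert (C0 : c 0 = Id3) by (rewrite E0; symmetry; apply Id3_to_matrix).
    assert (C1 : c 1 = G) by (rewrite E1; auto).
    pose proof (HA 1 b' ltac:(lra) ltac:(lra) ltac:(lra)) as A.
    rewrite (Hc 0), (Hc 1), C0, C1 in A by lra. rewrite (Hc 0), C0, C1 in Hlt by lra.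
    assert (Z : d2 G (c' b') = 0) by (apply Hno; [apply SU'; lra|lra]). lra.
Qed.

(** * The cut locus *)

(** The difference of the two phases has cosine 1 during an interval of time, which a nonzero
    rate does not allow. *)
Lemma phase_unique a b a' b' : (forall t, 0 < t < 1 -> cos (a + b * t) = cos (a' + b' * t) /\ sin (a + b * t) = sin (a' + b' * t)) ->
  b = b' /\ cos a = cos a' /\ sin a = sin a'.
Proof.
  intros H.
  assert (E : b = b').
  { assert (Q : forall t, 0 < t < 1 -> cos ((a - a') + (b - b') * t) = 1).
    { intros t Ht. destruct (H t Ht) as (E1 & E2).
      replace ((a - a') + (b - b') * t) with ((a + b * t) - (a' + b' * t)) by ring.
      rewrite cos_minus, E1, E2. apply cos2_sin2. }
    assert (Q' : forall t, 0 < t < 1 -> sin ((a - a') + (b - b') * t) = 0).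
    { intros t Ht. pose proof (cos2_sin2 ((a - a') + (b - b') * t)) as C. rewrite (Q t Ht) in C. nra. }
    apply Rminus_diag_uniq. destruct (Req_dec (b - b') 0) as [|Hd]; [assumption|exfalso]. set (d := b - b') in *.
    set (h := / (2 * (1 + Rabs d))). pose proof (Rabs_pos d).
    assert (Hh : 0 < h <= / 2) by (unfold h; split; [apply Rinv_0_lt_compat; lra|apply Rinv_le_contravar; lra]).
    assert (Hdh : 0 < Rabs (d * h) < 1).
    { rewrite Rabs_mult, (Rabs_pos_eq h) by lra. assert (0 < Rabs d) by (apply Rabs_pos_lt; auto).
      split; [nra|]. unfold h. apply Rmult_lt_reg_r with (2 * (1 + Rabs d)); [lra|].
      rewrite Rmult_assoc, Rinv_l by lra. lra. }
    pose proof PI2_1.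
    assert (C : cos (d * h) = 1).
    { replace (d * h) with (((a - a') + d * (h + / 4)) - ((a - a') + d * / 4)) by ring.
      rewrite cos_minus, !Q, !Q' by lra. ring. }
    assert (cos (Rabs (d * h)) < cos 0) by (apply cos_decreasing_1; lra).
    rewrite cos_0 in H2. unfold Rabs in H2. destruct Rcase_abs; [rewrite cos_neg in H2|]; lra. }
  split; [exact E|]. subst b'. destruct (H (/ 2) ltac:(lra)) as (E1 & E2).
  replace a with ((a + b * / 2) - b * / 2) by ring. replace a' with ((a' + b * / 2) - b * / 2) by ring.
  rewrite !cos_minus, !sin_minus, E1, E2. auto.
Qed.

Lemma minkowski a b c d : sqrt ((a + c) ^ 2 + (b + d) ^ 2) <= sqrt (a ^ 2 + b ^ 2) + sqrt (c ^ 2 + d ^ 2).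
Proof.
  assert (P : forall x y : R, 0 <= x ^ 2 + y ^ 2) by (intros; nra).
  pose proof (sqrt_pos (a ^ 2 + b ^ 2)). pose proof (sqrt_pos (c ^ 2 + d ^ 2)).
  apply Rsqr_incr_0_var; [|lra]. rewrite Rsqr_sqrt by apply P. rewrite Rsqr_plus, !Rsqr_sqrt by apply P.
  rewrite Rmult_assoc, <- sqrt_mult by apply P.
  assert (a * c + b * d <= sqrt ((a ^ 2 + b ^ 2) * (c ^ 2 + d ^ 2))); [|nra].
  destruct (Rle_dec (a * c + b * d) 0) as [L|L]; [eapply Rle_trans; [exact L|apply sqrt_pos]|].
  rewrite <- (sqrt_square (a * c + b * d)) by lra. apply sqrt_le_1_alt.
  assert (0 <= (a * d - b * c) ^ 2) by apply pow2_ge_0. nra.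
Qed.

Lemma sqrt_sum_le a b y : 0 <= b -> sqrt (a ^ 2 + y ^ 2) <= sqrt (b ^ 2 + y ^ 2) -> a <= b.
Proof.
  intros Hb H. apply sqrt_le_0 in H; [|nra|nra]. apply Rnot_lt_le. intros K. nra.
Qed.

Lemma ray_scale kap th T t : pos (ray kap th T) t = pos (ray kap th (T * t)) 1.
Proof.
  unfold pos, ray; simpl. rewrite !Rmult_1_r.
  replace (kap * (T * t) / 2) with (kap * T * t / 2) by field. reflexivity.
Qed.

Lemma Id_dist g v kap th T : in_su g -> 0 <= T -> minimal g T -> pos (ray kap th T) 1 = g ->
  d2 Id3 (to_matrix g v) = sqrt (T ^ 2 + v ^ 2).
Proof.
  intros Hg HT HM HR. rewrite Id3_to_matrix.
  assert (E : mul (inv unit_pt) g = g).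
  { destruct g as [[[a1 a2] b1] b2]. simpl. apply pt_eq; ring. }
  rewrite (d2_formula unit_pt 0 g v T kap th); rewrite ?E; auto using in_su_unit. f_equal. ring.
Qed.

Definition sqnorm_B (g : point) : R := let '(_, _, b1, b2) := g in b1 ^ 2 + b2 ^ 2.
Lemma sqnorm_B_polar_point s P e be : sqnorm_B (polar_point s P e be) = s ^ 2.
Proof. unfold polar_point, sqnorm_B. pose proof (cos2_sin2 be). transitivity (s ^ 2 * (cos be * cos be + sin be * sin be)); [ring|rewrite H; ring]. Qed.

Lemma in_su_polar_point s P e be : e = 1 \/ e = -1 -> in_su (polar_point s P e be).
Proof.
  intros He. unfold polar_point, in_su. pose proof (cos2_sin2 be) as H1. pose proof (cos2_sin2 P) as H2.
  assert (Hc : sqrt (1 + s ^ 2) * sqrt (1 + s ^ 2) = 1 + s ^ 2) by (apply sqrt_sqrt; nra).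
  assert (He2 : e * e = 1) by (destruct He as [-> | ->]; ring).
  transitivity ((sqrt (1 + s ^ 2) * sqrt (1 + s ^ 2)) * (cos P * cos P + (e * e) * (sin P * sin P)) - s ^ 2 * (cos be * cos be + sin be * sin be)); [ring|].
  rewrite He2, Rmult_1_l, H1, H2, Hc. ring.
Qed.

(** If h were beyond g, then so would be the points hy slightly beyond g on a segment from g
    to h, and by the equality case of the triangle inequality in the plane the components in
    SU(1,1) have lengths that add up as well. Both geodesics to g, continued to hy, would be
    optimal; the rigidity in [lower_bound] makes their curvatures equal to that of the
    continuation, and then their starting directions agree. The hypothesis on [sqnorm_B]
    provides points hy for which B <> 0, where the rigidity is available. *)
Lemma no_geodesic_beyond g u kap1 th1 kap2 th2 T h v :
  in_su g -> 0 < T -> pos (ray kap1 th1 T) 1 = g -> pos (ray kap2 th2 T) 1 = g -> minimal g T ->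
  kap1 <> 0 -> (kap2 = kap1 /\ th2 = th1 + PI) \/ kap2 = - kap1 ->
  (forall kap th T', 0 < T' -> exists x, 0 < x <= 1 /\ 0 < sqnorm_B (mul g (pos (ray kap th T') x))) ->
  in_su h -> d2 Id3 (to_matrix h v) = d2 Id3 (to_matrix g u) + d2 (to_matrix g u) (to_matrix h v) ->
  d2 (to_matrix g u) (to_matrix h v) = 0.
Proof.
  intros Hg HT R1 R2 HM Hk1 Hk HB Hh E.
  destruct (d2_geodesic g u h v Hg Hh) as (kk & thk & Tk & HTk & Rk & Mk & Ek & S0 & S1).
  assert (EG : d2 Id3 (to_matrix g u) = sqrt (T ^ 2 + u ^ 2)) by (apply (Id_dist g u kap1 th1); auto; lra).
  set (x := v - u) in *.
  destruct (Req_dec (d2 (to_matrix g u) (to_matrix h v)) 0) as [|Hne]; [assumption|exfalso].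
  assert (Tkpos : 0 < Tk).
  { destruct HTk as [|<-]; [auto|]. exfalso.
    rewrite pos_ray_speed0 in Rk.
    assert (Ehg : h = g) by (rewrite <- (mul_inv_r g h Hg), <- Rk; apply mul_unit_r).
    rewrite Ehg in E. rewrite Ehg in Ek.
    assert (EH : d2 Id3 (to_matrix g v) = sqrt (T ^ 2 + v ^ 2)) by (apply (Id_dist g v kap1 th1); auto; lra).
    rewrite EH, EG, Ek in E. rewrite Ehg, Ek in Hne.
    replace (0 ^ 2 + x ^ 2) with (x * x) in * by ring.
    assert (Hx : x <> 0) by (intros Z; apply Hne; rewrite Z, Rmult_0_l; apply sqrt_0).
    assert (Ea : sqrt (x * x) = Rabs x) by exact (sqrt_Rsqr_abs x). rewrite Ea in *.
    assert (E2 : (T ^ 2 + v ^ 2) = (sqrt (T ^ 2 + u ^ 2) + Rabs x) * (sqrt (T ^ 2 + u ^ 2) + Rabs x)).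
    { rewrite <- E. symmetry. apply sqrt_sqrt. nra. }
    assert (E3 : sqrt (T ^ 2 + u ^ 2) * sqrt (T ^ 2 + u ^ 2) = T ^ 2 + u ^ 2) by (apply sqrt_sqrt; nra).
    assert (E4 : Rabs x * Rabs x = x * x) by (rewrite <- Rabs_mult; apply Rabs_pos_eq; nra).
    assert (E5 : sqrt (T ^ 2 + u ^ 2) * Rabs x = u * x) by (unfold x in *; nra).
    assert (Hax : 0 < Rabs x) by now apply Rabs_pos_lt.
    assert (E6 : (sqrt (T ^ 2 + u ^ 2) * Rabs x) * (sqrt (T ^ 2 + u ^ 2) * Rabs x) = (u * x) * (u * x)) by now rewrite E5.
    assert (E7 : (T ^ 2 + u ^ 2) * (x * x) = u ^ 2 * (x * x)).
    { rewrite <- E3, <- E4 at 1. transitivity ((u * x) * (u * x)); [rewrite <- E6; ring|ring]. }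
    assert (0 < x * x) by nra. assert (0 < T ^ 2) by nra. nra. }
  destruct (HB kk thk Tk Tkpos) as (y & Hy & Hb).
  set (hy := mul g (pos (ray kk thk Tk) y)) in *.
  assert (Hhy : in_su hy) by (apply in_su_mul; auto; apply (smooth_ray kk thk Tk)).
  destruct (point_form hy Hhy) as (s & P & e & be & Hs & HP & He & Ehy).
  assert (Hs' : 0 < s).
  { destruct Hs as [|<-]; auto. rewrite Ehy, sqnorm_B_polar_point in Hb. lra. }
  destruct (geodesic_data_exists s P Hs' HP) as (kh & Th & TT & HG).
  assert (HTh : 0 < Th) by apply HG.
  pose proof PI_RGT_0 as HPI.
  assert (Mh : minimal hy Th) by (rewrite Ehy; apply (minimal_polar_point s P kh Th TT); auto; lra).
  assert (EHy : d2 Id3 (to_matrix hy (u + x * y)) = sqrt (Th ^ 2 + (u + x * y) ^ 2)).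
  { apply (Id_dist hy _ (e * kh) (be - e * kh * Th / 2)); auto; [lra|]. rewrite Ehy. now apply (ray_end_polar s P kh Th TT). }
  assert (D : forall s t, 0 <= s -> s <= t -> t <= 1 ->
     d2 (segment g u kk thk Tk x s) (segment g u kk thk Tk x t) = (t - s) * sqrt (Tk ^ 2 + x ^ 2)).
  { apply segment_dist; auto. rewrite S0, S1, Ek. lra. }
  assert (Long : T + y * Tk <= Th).
  { apply sqrt_sum_le with (y := u + x * y); [lra|]. rewrite <- EHy.
    assert (Q1 : d2 (to_matrix hy (u + x * y)) (to_matrix h v) = (1 - y) * sqrt (Tk ^ 2 + x ^ 2)).
    { rewrite <- (D y 1) by lra. rewrite S1, segment_at. reflexivity. }
    assert (Q2 : d2 Id3 (to_matrix h v) <= d2 Id3 (to_matrix hy (u + x * y)) + d2 (to_matrix hy (u + x * y)) (to_matrix h v)).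
    { apply d2_triangle; [apply SU11R_Id|apply SU11R_to_matrix; auto|apply SU11R_to_matrix; auto]. }
    assert (Q3 : sqrt ((y * Tk) ^ 2 + (x * y) ^ 2) = y * sqrt (Tk ^ 2 + x ^ 2)).
    { replace ((y * Tk) ^ 2 + (x * y) ^ 2) with ((y * y) * (Tk ^ 2 + x ^ 2)) by ring.
      rewrite sqrt_mult by nra. rewrite sqrt_square by lra. reflexivity. }
    pose proof (minkowski T u (y * Tk) (x * y)) as Q4. rewrite Q3 in Q4. rewrite Q1, E, EG, Ek in Q2. lra. }
  (* Continued to hy, any geodesic to g is as short as possible, so its control is the one
     determined by hy, first along the geodesic to g and then beyond g. *)
  set (k2 := left_mul g (ray kk thk (Tk * y))).
  assert (HTy : 0 < Tk * y) by nra.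
  assert (Opt : forall kap th, pos (ray kap th T) 1 = g -> exists kap', (kap' = kh \/ kap' = - kh) /\
     kap' = kap /\ kap' = kk /\ cos th = cos (be - kap' * Th / 2) /\ sin th = sin (be - kap' * Th / 2)).
  { intros kap th HR.
    assert (Hsm2 : smooth k2) by (apply smooth_left_mul, smooth_ray; auto).
    assert (Hj : pos (ray kap th T) 1 = pos k2 0) by (unfold k2; now rewrite pos_left_mul, pos_ray_0, mul_unit_r).
    assert (HS : primitive 0 1 two_pieces (speed (join (ray kap th T) k2)) (glue (fun t => T * t) (fun t => T + (Tk * y) * t))).
    { apply primitive_join; intros t; [apply speed_ray; lra|]. unfold k2. rewrite speed_left_mul. apply speed_ray; lra. }
    assert (Hend : pos (join (ray kap th T) k2) 2 = polar_point s P e be).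
    { rewrite pos_join_right by lra. unfold k2. rewrite pos_left_mul. replace (2 - 1) with 1 by ring.
      rewrite <- ray_scale. exact Ehy. }
    unfold pos, polar_point in Hend. injection Hend as F1 F2 F3 F4.
    destruct (lower_bound (join (ray kap th T) k2) 0 2 1 two_pieces (glue (fun t => T * t) (fun t => T + (Tk * y) * t)) s be P kh Th TT) as (_ & Rig); auto.
    - apply horizontal_join; auto. apply smooth_ray.
    - apply unit_starts. rewrite pos_join_left by lra. apply pos_ray_0.
    - lra.
    - destruct Rig as (kap' & Hkap' & Rig).
      { rewrite glue_right by lra. lra. }
      assert (Ph1 : forall t, 0 < t < 1 -> cos (th + kap * T * t) = cos ((be - kap' * Th / 2) + kap' * T * t) /\
         sin (th + kap * T * t) = sin ((be - kap' * Th / 2) + kap' * T * t)).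
      { intros t Ht. destruct (Rig t) as (G1 & G2); [exists 0%nat; simpl; split; [lia|lra]|].
        rewrite speed_join in G1, G2. simpl in G1, G2. rewrite !glue_left in G1, G2 by lra.
        rewrite speed_ray in G1, G2 by lra.
        apply Rmult_eq_reg_l in G1; [|lra]. apply Rmult_eq_reg_l in G2; [|lra].
        replace (th + kap * T * t) with (kap * T * t + th) by ring. rewrite G1, G2. split; f_equal; ring. }
      assert (Ph2 : forall t, 0 < t < 1 -> cos (thk + kk * (Tk * y) * t) = cos ((be - kap' * Th / 2 + kap' * T) + kap' * (Tk * y) * t) /\
         sin (thk + kk * (Tk * y) * t) = sin ((be - kap' * Th / 2 + kap' * T) + kap' * (Tk * y) * t)).
      { intros t Ht. destruct (Rig (t + 1)) as (G1 & G2); [exists 1%nat; simpl; split; [lia|lra]|].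
        rewrite speed_join in G1, G2. simpl in G1, G2. rewrite !glue_right in G1, G2 by lra.
        unfold k2 in G1, G2. rewrite speed_left_mul, speed_ray in G1, G2 by lra.
        replace (t + 1 - 1) with t in G1, G2 by ring.
        assert (C1 : cp (left_mul g (ray kk thk (Tk * y))) t = Tk * y * cos (kk * (Tk * y) * t + thk)) by (destruct g as [[[? ?] ?] ?]; reflexivity).
        assert (C2 : cq (left_mul g (ray kk thk (Tk * y))) t = Tk * y * sin (kk * (Tk * y) * t + thk)) by (destruct g as [[[? ?] ?] ?]; reflexivity).
        rewrite C1 in G1. rewrite C2 in G2.
        apply Rmult_eq_reg_l in G1; [|lra]. apply Rmult_eq_reg_l in G2; [|lra].
        replace (thk + kk * (Tk * y) * t) with (kk * (Tk * y) * t + thk) by ring. rewrite G1, G2. split; f_equal; ring. }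
      apply phase_unique in Ph1 as (B1 & B2 & B3). apply phase_unique in Ph2 as (B4 & _).
      exists kap'. split; [exact Hkap'|]. split; [|split; [|split; [exact B2|exact B3]]].
      + symmetry. apply Rmult_eq_reg_r in B1; lra.
      + symmetry. apply Rmult_eq_reg_r in B4; lra. }
  destruct (Opt kap1 th1 R1) as (k1' & _ & A1 & A2 & A3 & A4).
  destruct (Opt kap2 th2 R2) as (k2' & _ & A5 & A6 & A7 & A8).
  destruct Hk as [(Hk & Hth)|Hk].
  - assert (Ek' : k2' = k1') by congruence. rewrite Ek', <- A3, Hth, neg_cos in A7. rewrite Ek', <- A4, Hth, neg_sin in A8.
    pose proof (cos2_sin2 th1). nra.
  - apply Hk1. lra.
Qed.

Lemma gsin_pos_small m : exists d, 0 < d /\ forall y, 0 < y <= d -> 0 < gsin m y.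
Proof.
  unfold gsin. destruct Rlt_dec as [H|H]; [|destruct Rlt_dec as [H0|H0]].
  - assert (Hr : 0 < sqrt m) by (now apply sqrt_lt_R0). pose proof PI_RGT_0.
    exists (PI / 2 / sqrt m). split; [repeat apply Rdiv_lt_0_compat; lra|].
    intros y Hy. apply Rdiv_lt_0_compat; auto. apply sin_gt_0; [nra|].
    apply Rle_lt_trans with (sqrt m * (PI / 2 / sqrt m)); [apply Rmult_le_compat_l; lra|].
    replace (sqrt m * (PI / 2 / sqrt m)) with (PI / 2) by (field; lra). lra.
  - assert (Hr : 0 < sqrt (- m)) by (apply sqrt_lt_R0; lra).
    exists 1. split; [lra|]. intros y Hy. apply Rdiv_lt_0_compat; auto. apply sinh_pos. nra.
  - exists 1. split; [lra|]. intros; lra.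
Qed.

Lemma cut_loc_cut G : Cut2_loc G -> Cut2 G.
Proof.
  intros ([a1 a2] & [b1 b2] & u & HN & -> & HA & HB0).
  injection HB0 as -> ->.
  apply Cut2_characterization. split; [exists (a1, a2), (0, 0), u; auto|].
  intros H HH E. destruct (SU11R_inv _ HH) as (h & v & Hh & ->).
  set (g := (a1, a2, 0, 0) : point).
  assert (Hg : in_su g) by (rewrite !Cmod_sqr in HN; exact HN).
  change (su11R_mat (a1, a2) (0, 0) u) with (to_matrix g u) in *.
  destruct (point_form g Hg) as (s & P & e & be & Hs & HP & He & Eg).
  assert (Hs0 : s = 0).
  { assert (B : sqnorm_B g = 0) by (simpl; ring). rewrite Eg, sqnorm_B_polar_point in B. nra. }
  subst s.
  assert (Eg' : g = (cos P, - e * sin P, 0, 0)).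
  { rewrite Eg. unfold polar_point. replace (1 + 0 ^ 2) with 1 by ring. rewrite sqrt_1. apply pt_eq; ring. }
  assert (HP0 : 0 < P).
  { destruct HP as ([|<-] & _); auto. exfalso. apply HA. rewrite cos_0, sin_0 in Eg'. unfold g in Eg'.
    injection Eg' as -> ->. unfold RtoC. f_equal. ring. }
  destruct (closed_geodesic P e He) as (kap & T & HT & Hk & HR & HM); [lra|].
  rewrite <- Eg' in HR, HM.
  apply (no_geodesic_beyond g u (e * kap) 0 (e * kap) (0 + PI) T h v); auto.
  - destruct He as [-> | ->]; lra.
  - intros kk th T' HT'. destruct (gsin_pos_small (gen_det kk)) as (d & Hd & Hpos).
    set (x := Rmin 1 (d / T')).
    assert (Hx0 : 0 < x) by (unfold x; apply Rmin_glb_lt; [lra|apply Rdiv_lt_0_compat; lra]).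
    exists x. split; [split; [auto|apply Rmin_l]|].
    assert (Hx1 : T' * x <= d).
    { apply Rle_trans with (T' * (d / T')); [apply Rmult_le_compat_l; [lra|apply Rmin_r]|]. right; field; lra. }
    specialize (Hpos (T' * x) ltac:(split; [nra|auto])).
    assert (Hn : a1 ^ 2 + a2 ^ 2 = 1) by (unfold g, in_su in Hg; lra).
    unfold g, pos, ray. simpl. set (S := gsin (gen_det kk) (T' * x)) in *.
    set (ph := kk * T' * x / 2 + th). pose proof (cos2_sin2 ph) as C.
    match goal with |- 0 < ?z => replace z with ((a1 ^ 2 + a2 ^ 2) * (S ^ 2 / 4) * (cos ph * cos ph + sin ph * sin ph)) by field end.
    rewrite Hn, C. nra.
Qed.

Lemma cut_glob_cut G : Cut2_glob G -> Cut2 G.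
Proof.
  intros ([a1 a2] & [b1 b2] & u & HN & -> & HA1 & HA2). simpl in HA1, HA2. subst a2.
  apply Cut2_characterization. split; [exists (a1, 0), (b1, b2), u; auto|].
  intros H HH E. destruct (SU11R_inv _ HH) as (h & v & Hh & ->).
  set (g := (a1, 0, b1, b2) : point).
  assert (Hg : in_su g) by (rewrite !Cmod_sqr in HN; exact HN).
  change (su11R_mat (a1, 0) (b1, b2) u) with (to_matrix g u) in *.
  destruct (point_form g Hg) as (s & P & e & be & Hs & HP & He & Eg).
  assert (HB : 0 < sqnorm_B g) by (unfold g, in_su in Hg; simpl in *; nra).
  assert (Hs0 : 0 < s).
  { destruct Hs as [|<-]; auto. rewrite Eg, sqnorm_B_polar_point in HB. lra. }
  pose proof PI_RGT_0 as HPI.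
  set (c := sqrt (1 + s ^ 2)) in *. assert (Hc : 0 < c) by (apply sqrt_lt_R0; nra).
  assert (HPi : P = PI).
  { unfold g, polar_point in Eg. fold c in Eg. injection Eg as E1 E2 E3 E4.
    assert (He2 : e * (c * sin P) = 0) by lra.
    assert (HsP : sin P = 0) by (destruct He as [-> | ->]; nra).
    assert (HcP : cos P < 0) by nra.
    destruct (proj2 HP) as [L|]; auto. exfalso.
    destruct (Rle_lt_or_eq_dec 0 P (proj1 HP)) as [L0| <-]; [|rewrite cos_0 in HcP; lra].
    pose proof (sin_gt_0 P L0 L). lra. }
  subst P.
  destruct (geodesic_data_exists s PI Hs0 ltac:(lra)) as (kap & T & Th & HG).
  assert (HT : 0 < T) by apply HG.
  assert (Hk : 0 < kap).
  { destruct HG as (Hk0 & _ & HTh & _ & _ & _ & HP' & _). destruct Hk0 as [|<-]; auto. lra. }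
  assert (Eg2 : forall e', g = polar_point s PI e' be).
  { intros e'. rewrite Eg. unfold polar_point. rewrite sin_PI. apply pt_eq; ring. }
  apply (no_geodesic_beyond g u (1 * kap) (be - 1 * kap * T / 2) (-1 * kap) (be - -1 * kap * T / 2) T h v); auto.
  - rewrite (Eg2 1). apply (ray_end_polar s PI kap T Th); auto.
  - rewrite (Eg2 (-1)). apply (ray_end_polar s PI kap T Th); auto.
  - rewrite (Eg2 1). apply (minimal_polar_point s PI kap T Th); auto. lra.
  - lra.
  - right. ring.
  - intros kk th T' _. set (k := left_mul g (ray kk th T')).
    assert (Sk : smooth k) by (apply smooth_left_mul, smooth_ray; auto).
    destruct Sk as ((_ & _ & C3 & C4) & _).
    assert (Cc : continuous (fun t => cb1 k t ^ 2 + cb2 k t ^ 2) 0) by cont.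
    assert (L : locally 0 (fun t => 0 < cb1 k t ^ 2 + cb2 k t ^ 2)).
    { apply (Cc (fun y => 0 < y)). apply (open_gt 0).
      change (0 < sqnorm_B (pos k 0)). unfold k. now rewrite pos_left_mul, pos_ray_0, mul_unit_r. }
    destruct L as (d & Hd). pose proof (cond_pos d) as Hdp.
    exists (Rmin 1 (d / 2)). assert (Hm : 0 < Rmin 1 (d / 2)) by (apply Rmin_glb_lt; lra).
    split; [split; [auto|apply Rmin_l]|].
    rewrite <- pos_left_mul. apply (Hd (Rmin 1 (d / 2))).
    unfold ball; simpl. unfold AbsRing_ball, abs, minus, plus, opp; simpl.
    rewrite Ropp_0, Rplus_0_r, Rabs_pos_eq by lra. pose proof (Rmin_r 1 (d / 2)). lra.
Qed.

(** A point outside both sets has B <> 0 and P < pi, or is Id up to the last coordinate. In the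
    first case [geodesic_data_extend] provides a longer shortest arc through it. *)
Lemma cut_loc_or_glob G : Cut2 G -> Cut2_loc G \/ Cut2_glob G.
Proof.
  intros HC. apply Cut2_characterization in HC as (HG & Hno).
  destruct (SU11R_inv _ HG) as (g & v & Hg & ->).
  destruct (point_form g Hg) as (s & P & e & be & Hs & HP & He & Eg). pose proof PI_RGT_0 as HPI.
  assert (HSU : forall a1 a2 b1 b2, in_su (a1, a2, b1, b2) -> Cmod (a1, a2) ^ 2 - Cmod (b1, b2) ^ 2 = 1)
    by (intros; rewrite !Cmod_sqr; auto).
  destruct Hs as [Hs|<-].
  - destruct (proj2 HP) as [HPlt| ->].
    + exfalso.
      destruct (geodesic_data_exists s P Hs HP) as (kap & T & Th & HGd).
      destruct (geodesic_data_extend s P kap T Th Hs HGd HPlt) as (s' & P' & T' & Th' & HGd' & HTT & Hs' & HP').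
      assert (HT : 0 < T) by apply HGd.
      set (th := be - e * kap * T / 2).
      set (be' := th + e * kap * T' / 2).
      set (x := v * T' / T).
      assert (R' : pos (ray (e * kap) th T') 1 = polar_point s' P' e be').
      { replace th with (be' - e * kap * T' / 2) by (unfold be'; ring). now apply (ray_end_polar s' P' kap T' Th'). }
      set (c := segment unit_pt 0 (e * kap) th T' x).
      assert (Ec : forall t, c t = to_matrix (pos (ray (e * kap) th T') t) (x * t)).
      { intros t. unfold c. rewrite segment_at, mul_unit_l. f_equal. ring. }
      assert (D01 : d2 (c 0) (c 1) = sqrt (T' ^ 2 + x ^ 2)).
      { rewrite !Ec, pos_ray_0, R', Rmult_0_r, Rmult_1_r, <- Id3_to_matrix.
        apply (Id_dist _ _ (e * kap) th); auto; [now apply in_su_polar_point|lra|].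
        apply (minimal_polar_point s' P' kap T' Th'); auto. }
      assert (D : forall s t, 0 <= s -> s <= t -> t <= 1 -> d2 (c s) (c t) = (t - s) * sqrt (T' ^ 2 + x ^ 2)).
      { apply segment_dist; [apply in_su_unit|lra|]. fold c. rewrite D01. lra. }
      assert (Et : c (T / T') = to_matrix g v).
      { rewrite Ec, ray_scale. replace (T' * (T / T')) with T by (field; lra).
        replace (x * (T / T')) with v by (unfold x; field; lra). f_equal.
        rewrite Eg. unfold th. now apply (ray_end_polar s P kap T Th). }
      assert (E0 : c 0 = Id3) by (rewrite Ec, pos_ray_0, Rmult_0_r; symmetry; apply Id3_to_matrix).
      assert (Htt : 0 < T / T' < 1).
      { split; [apply Rdiv_lt_0_compat; lra|]. apply Rmult_lt_reg_r with T'; [lra|].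
        unfold Rdiv. rewrite Rmult_assoc, Rinv_l by lra. lra. }
      assert (Npos : 0 < sqrt (T' ^ 2 + x ^ 2)) by (apply sqrt_lt_R0; nra).
      rewrite <- Et, <- E0 in Hno. specialize (Hno (c 1)).
      rewrite !D in Hno by lra.
      assert (K : (1 - T / T') * sqrt (T' ^ 2 + x ^ 2) = 0) by (apply Hno; [apply segment_SU, in_su_unit|ring]).
      apply Rmult_integral in K. lra.
    + right. subst g. set (c := sqrt (1 + s ^ 2)).
      assert (Hc : 1 < c).
      { assert (0 <= c) by apply sqrt_pos. assert (c * c = 1 + s ^ 2) by (apply sqrt_sqrt; nra). nra. }
      exists (c * cos PI, - e * (c * sin PI)), (s * cos be, s * sin be), v.
      split; [apply HSU; exact Hg|]. split; [reflexivity|]. rewrite cos_PI, sin_PI. simpl. split; [lra|ring].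
  - assert (Eg' : g = (cos P, - e * sin P, 0, 0)).
    { rewrite Eg. unfold polar_point. replace (1 + 0 ^ 2) with 1 by ring. rewrite sqrt_1. apply pt_eq; ring. }
    subst g. rewrite Eg' in *.
    destruct (proj1 HP) as [HP0|<-].
    + left. exists (cos P, - e * sin P), (0, 0), v. split; [apply HSU; exact Hg|]. split; [reflexivity|].
      split; [|reflexivity]. intros K. injection K as K _.
      assert (cos P < cos 0) by (apply cos_decreasing_1; lra). rewrite cos_0 in H. lra.
    + exfalso. rewrite cos_0, sin_0, Rmult_0_r in Hno.
      assert (DD : forall x y, d2 (to_matrix unit_pt x) (to_matrix unit_pt y) = Rabs (y - x)).
      { intros x y. rewrite (d2_formula unit_pt x unit_pt y 0 0 0); auto using in_su_unit; try lra.
        - rewrite <- sqrt_Rsqr_abs. f_equal. unfold Rsqr. ring.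
        - replace (mul (inv unit_pt) unit_pt) with unit_pt by (simpl; apply pt_eq; ring). apply minimal_unit.
        - rewrite pos_ray_speed0. simpl. apply pt_eq; ring. }
      fold unit_pt in Hno. rewrite Id3_to_matrix in Hno.
      destruct (Rle_dec 0 v).
      * specialize (Hno (to_matrix unit_pt (v + 1)) (SU11R_to_matrix _ _ in_su_unit)). rewrite !DD in Hno.
        rewrite !Rabs_pos_eq in Hno by lra. lra.
      * specialize (Hno (to_matrix unit_pt (v - 1)) (SU11R_to_matrix _ _ in_su_unit)). rewrite !DD in Hno.
        rewrite !Rabs_left in Hno by lra. lra.
Qed.

Theorem proposition10 :
  forall g : mat3, Cut2 g <-> Cut2_loc g \/ Cut2_glob g.
Proof.
  intros g. split; [apply cut_loc_or_glob|]. intros [H|H]; [now apply cut_loc_cut|now apply cut_glob_cut].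
Qed.
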